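(* Let $1<p_1\le q_1<\infty$ and $w_1\in A_{p_1,q_1}$. Let $T$ be a linear operator, simultaneously defined on all the spaces below, which is compact from $L^{p_1}(w_1^{p_1})$ to $L^{q_1}(w_1^{q_1})$. Suppose moreover that $T$ is bounded from $L^{p}(\sigma^p)$ to $L^{q}(\lambda^q)$ for all $p,q\in(1,\infty)$ with $\frac1p-\frac1q=\frac1{p_1}-\frac1{q_1}$ and all $\sigma,\lambda\in A_{p,q}$. Then $T$ is compact from $L^{p}(\sigma^p)$ to $L^{q}(\lambda^q)$ for all $p,q\in(1,\infty)$ with $\frac1p-\frac1q=\frac1{p_1}-\frac1{q_1}$ and all $\sigma,\lambda\in A_{p,q}$.
   Context: A weight on $\mathbb{R}^d$ is a locally integrable function positive almost everywhere. For $p\in(1,\infty)$, $L^p(w)$ is the space of measurable $f:\mathbb{R}^d\to\mathbb{C}$ with $\|f\|_{L^p(w)}=(\int_{\mathbb{R}^d}|f|^pw)^{1/p}<\infty$. For $1<p\le q<\infty$, $w\in A_{p,q}$ means $[w]_{A_{p,q}}:=\sup_Q\langle w^q\rangle_Q^{1/q}\langle w^{-p'}\rangle_Q^{1/p'}<\infty$, the supremum over all cubes $Q\subset\mathbb{R}^d$, with $\langle f\rangle_Q=|Q|^{-1}\int_Qf$ and $p'=p/(p-1)$. ''Simultaneously defined'' means $T$ is a single linear operator defined on a common vector space of measurable functions containing all the spaces involved, acting consistently on them. *)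

(* Defs.v *)
From HB Require Import structures.
From mathcomp Require Import all_boot all_order all_algebra.
From mathcomp Require Import all_classical all_reals all_analysis.
From mathcomp.real_closed Require Export complex.
Export Order.TTheory GRing.Theory Num.Theory.

Set Implicit Arguments.
Unset Strict Implicit.
Unset Printing Implicit Defensive.

Local Open Scope classical_set_scope.
Local Open Scope ring_scope.

Section WeightedSpaces.
Context {R : realType} {d : nat}.

(* R^d is modelled as d.-tuple R, with its product (of Borel) sigma-algebra *)
Local Notation Rd := (d.-tuple R).

Definition box (a b : Rd) : set Rd :=
  [set x | forall i : 'I_d, tnth a i <= tnth x i < tnth b i].

(* mu is Lebesgue measure on R^d: it gives every box its volume.
   (By uniqueness of extension this characterises Lebesgue measure on the
   Borel sets of R^d.) *)
Definition is_lebesgue_measure (mu : {measure set Rd -> \bar R}) : Prop :=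
  forall a b : Rd, (forall i : 'I_d, tnth a i <= tnth b i) ->
    mu (box a b) = (\prod_(i < d) (tnth b i - tnth a i))%:E.

Definition is_cube (Q : set Rd) : Prop :=
  exists (a : Rd) (l : R), 0 < l /\
    Q = [set x | forall i : 'I_d, tnth a i <= tnth x i < tnth a i + l].

Definition avg (mu : {measure set Rd -> \bar R}) (Q : set Rd) (g : Rd -> R)
  : \bar R :=
  ((fine (mu Q))^-1)%:E * (\int[mu]_(x in Q) (g x)%:E)%E.

Definition conj_exp (p : R) : R := p / (p - 1).

Definition Apq (mu : {measure set Rd -> \bar R}) (p q : R) (w : Rd -> R)
  : Prop :=
  [/\ measurable_fun setT w,
      {ae mu, forall x, 0 < w x} &
      exists C : R, forall Q, is_cube Q ->
        (poweR (avg mu Q (fun x => powR (w x) q)) q^-1 *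
         poweR (avg mu Q (fun x => powR (w x) (- conj_exp p))) (conj_exp p)^-1
           <= C%:E)%E].

Definition cmeasurable (f : Rd -> R[i]) : Prop :=
  measurable_fun setT (fun x => complex.Re (f x)) /\
  measurable_fun setT (fun x => complex.Im (f x)).

Definition cabs (z : R[i]) : R := Normc.normc z.

Definition wint (mu : {measure set Rd -> \bar R}) (p : R) (v : Rd -> R)
  (f : Rd -> R[i]) : \bar R :=
  (\int[mu]_x (powR (cabs (f x)) p * v x)%:E)%E.

Definition wnorm (mu : {measure set Rd -> \bar R}) (p : R) (v : Rd -> R)
  (f : Rd -> R[i]) : \bar R :=
  poweR (wint mu p v f) p^-1.

Definition inLp (mu : {measure set Rd -> \bar R}) (p : R) (v : Rd -> R)
  (f : Rd -> R[i]) : Prop :=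
  cmeasurable f /\ (wint mu p v f < +oo)%E.

Definition wpow (sigma : Rd -> R) (p : R) : Rd -> R := fun x => powR (sigma x) p.

Definition bounded_op (mu : {measure set Rd -> \bar R})
  (T : (Rd -> R[i]) -> (Rd -> R[i])) (p : R) (sigma : Rd -> R)
  (q : R) (lambda : Rd -> R) : Prop :=
  exists C : R, forall f, inLp mu p (wpow sigma p) f ->
    inLp mu q (wpow lambda q) (T f) /\
    (wnorm mu q (wpow lambda q) (T f) <= C%:E * wnorm mu p (wpow sigma p) f)%E.

(* T compact from L^p(sigma^p) to L^q(lambda^q): T maps L^p(sigma^p) into
   L^q(lambda^q), and the image of every bounded sequence has a subsequence
   converging in L^q(lambda^q) (sequential form of "images of bounded sets
   are relatively compact", equivalent since these are metric spaces). *)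
Definition compact_op (mu : {measure set Rd -> \bar R})
  (T : (Rd -> R[i]) -> (Rd -> R[i])) (p : R) (sigma : Rd -> R)
  (q : R) (lambda : Rd -> R) : Prop :=
  (forall f, inLp mu p (wpow sigma p) f -> inLp mu q (wpow lambda q) (T f)) /\
  forall f : nat -> (Rd -> R[i]),
    (forall k, inLp mu p (wpow sigma p) (f k)) ->
    (exists M : R, forall k, (wnorm mu p (wpow sigma p) (f k) <= M%:E)%E) ->
    exists (phi : nat -> nat) (g : Rd -> R[i]),
      (forall k, (phi k < phi k.+1)%N) /\
      inLp mu q (wpow lambda q) g /\
      ((fun k => wnorm mu q (wpow lambda q) (fun x => T (f (phi k)) x - g x))
         @ \oo --> 0%E).

Definition admissible (p1 q1 p q : R) : Prop :=
  1 < p /\ 1 < q /\ p^-1 - q^-1 = p1^-1 - q1^-1.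

Definition simultaneously_linear (mu : {measure set Rd -> \bar R})
  (p1 q1 : R) (V : set (Rd -> R[i])) (T : (Rd -> R[i]) -> (Rd -> R[i]))
  : Prop :=
  [/\ (forall (c : R[i]) f g, V f -> V g -> V (fun x => c * f x + g x)),
      (forall (c : R[i]) f g, V f -> V g ->
          T (fun x => c * f x + g x) = (fun x => c * T f x + T g x)),
      (forall p q sigma f, admissible p1 q1 p q -> Apq mu p q sigma ->
          inLp mu p (wpow sigma p) f -> V f) &
      (forall p q lambda f, admissible p1 q1 p q -> Apq mu p q lambda ->
          inLp mu q (wpow lambda q) f -> V f)].

End WeightedSpaces.

(* Main.v *)
(** Write [v = lambda^q].  If [b] is an "A_1 weight with respect to [v dx]", i.e.
    [int_Q b v <= C v(Q) inf_Q b] for all cubes, then [lambda b^(1/q)] is again in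
    [A_{p,q}], and such [b] are produced by [b = (M_v g)^(1/2) + g^(1/2)], with
    [M_v] the maximal function of the doubling measure [v dx].  Since
    [A_{p,q}] is invariant under [w |-> 1/w] up to duality, it follows that every
    weight can be replaced by one that is arbitrarily larger (or smaller) at
    infinity, or on a prescribed sequence of sets whose measure tends to [0].  No
    reverse Hoelder inequality and no interpolation theorem is needed:

    - as [T] is bounded into [L^q(lambda'^q)] for all these [lambda'], the image of
      the unit ball of [L^p(sigma^p)] is equi-integrable in [L^q(lambda^q)], so
      only compactness into [L^1] of cubes is at stake;
    - as [T] is bounded from [L^p(sigma'^p)] for all these [sigma'], and from one
      more unweighted [L^p2], a function of the unit ball of [L^p(sigma^p)] is the
      sum of a part bounded in [L^p1(w1^p1)] and of parts with small image in
      [L^1] of a cube; the compactness of [T] on [L^p1(w1^p1)] then applies. *)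

Require Import Defs.
From HB Require Import structures.
From mathcomp Require Import all_boot all_order all_algebra.
From mathcomp Require Import all_classical all_reals all_analysis.
From mathcomp Require Import measurable_realfun.
From mathcomp.real_closed Require Import complex.
From mathcomp Require Import ring lra.
Import Order.TTheory GRing.Theory Num.Theory.
Import numFieldTopology.Exports numFieldNormedType.Exports.

Set Implicit Arguments.
Unset Strict Implicit.
Unset Printing Implicit Defensive.
Local Open Scope classical_set_scope.
Local Open Scope ring_scope.

(** The square root comes from the maximal function: [M_v g] itself need not be an A_1 weight with
    respect to [v dx], whereas its powers with exponent below 1 are, by Kolmogorov's argument.
    Adding the root of [g] gives [g <= b^2] at every point without differentiating integrals.
    Working relative to [v dx] rather than Lebesgue measure is what avoids reverse Hoelder: in the
    product of the two averages the powers of [inf b] cancel exactly.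

    The other obstacle is that [p] and [p1] differ and the weights are unrelated, so that neither of
    L^p(sigma^p) and L^p1(w1^p1) need contain the other. Cutting [f] at a level is useful on one
    side of the level only. The auxiliary exponent [p2] is therefore taken on the other side of [p]
    from [p1]: where [y^(p1-p)] exceeds a suitable bound, [y^(p2-p)] is small. *)

Section density.
Local Open Scope ereal_scope.
Context {dd} {X : measurableType dd} {R : realType}.
Variable mu : {measure set X -> \bar R}.

(** The proofs are arguments so that the term itself carries what the measure instance below
    needs. *)
Definition density (v : X -> R) of measurable_fun setT v & (forall x, (0 <= v x)%R) :
  set X -> \bar R := fun A => \int[mu]_(x in A) (v x)%:E.

Variables (v : X -> R) (mv : measurable_fun setT v) (v0 : forall x, (0 <= v x)%R).
Local Notation nu := (density mv v0).

Let nu0 : nu set0 = 0. Proof. exact: integral_set0. Qed.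

Let nu_ge0 A : 0 <= nu A.
Proof. by apply: integral_ge0 => x _; rewrite lee_fin. Qed.

Let nu_sigma_additive : semi_sigma_additive nu.
Proof.
move=> F mF tF mUF; rewrite /density ge0_integral_bigcup//.
- by apply: is_cvg_nneseries => n _ _; exact: nu_ge0.
- by apply/measurable_EFinP; exact: measurable_funTS.
- by move=> x _; rewrite lee_fin.
Qed.

HB.instance Definition _ := isMeasure.Build _ _ _ nu nu0 nu_ge0 nu_sigma_additive.

End density.

(** * Continuity from below and absolute continuity of the integral *)

Section measure_facts.
Local Open Scope ereal_scope.
Context {dd} {X : measurableType dd} {R : realType}.
Variable mu : {measure set X -> \bar R}.

(** Continuity from below: the covering argument, an induction on finite lists, reaches countable
    unions through this bound. *)
Lemma measure_bigcup_le (F : (set X)^nat) (c : \bar R) :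
  (forall i, measurable (F i)) ->
  (forall n, mu (\big[setU/set0]_(i < n) F i) <= c) -> mu (\bigcup_i F i) <= c.
Proof.
move=> mF Fc.
have mG n : measurable (\big[setU/set0]_(i < n.+1) F i) by exact: bigsetU_measurable.
have nd : nondecreasing_seq (fun n => \big[setU/set0]_(i < n.+1) F i).
  by move=> m n mn; apply/subsetPset; exact: subset_bigsetU.
have := @nondecreasing_cvg_mu _ _ _ mu _ mG (bigcup_measurable (fun k _ => mG k)) nd.
have -> : \bigcup_k \big[setU/set0]_(i < k.+1) F i = \bigcup_i F i by exact: bigcup_bigsetU_bigcup.
move=> /cvg_lim <- //.
apply: lime_le; last by apply: nearW => n; exact: Fc.
apply: ereal_nondecreasing_is_cvgn => m n mn; apply: le_measure; rewrite ?inE//.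
by apply/subsetPset; exact: nd.
Qed.

(** Truncation: [v] exceeds a level [n] only on a part of [D] of [v]-mass at most [e / 2], and on
    the rest a set of measure [k] has mass at most [n k]. *)
Lemma integral_abs_cont (v : X -> R) (D : set X) :
  measurable D -> measurable_fun setT v -> (forall x, (0 <= v x)%R) ->
  \int[mu]_(x in D) (v x)%:E < +oo ->
  forall e : R, (0 < e)%R -> exists2 k : R, (0 < k)%R &
    forall E, measurable E -> E `<=` D -> mu E <= k%:E ->
      \int[mu]_(x in E) (v x)%:E <= e%:E.
Proof.
move=> mD mv v0 vD e e0.
pose F n := D `&` [set x | (v x <= n%:R)%R].
have mF n : measurable (F n).
  rewrite /F; apply: measurable_fun_le => //; exact: measurable_funTS.
pose nu : {measure set X -> \bar R} := density mu mv v0.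
have ndF : nondecreasing_seq F.
  move=> m n mn; apply/subsetPset => x [Dx vm]; split => //=.
  by rewrite (le_trans vm)// ler_nat.
have UF : \bigcup_n F n = D.
  apply/seteqP; split => [x [n _ []]//|x Dx].
  exists (Num.bound (v x)) => //; split => //=.
  by rewrite ltW// archi_boundP.
have nuD : nu D \is a fin_num by rewrite ge0_fin_numE// measure_ge0.
have := @nondecreasing_cvg_mu _ _ _ nu _ mF (bigcup_measurable (fun k _ => mF k)) ndF.
rewrite UF => cvF.
have [n nuF] : exists n, nu D - (e / 2)%:E < nu (F n).
  apply: contrapT => /forallNP nF.
  have : nu D <= nu D - (e / 2)%:E.
    rewrite -[leLHS](cvg_lim _ cvF)//; apply: lime_le; first by apply/cvg_ex; eexists; exact: cvF.
    by apply: nearW => n /=; rewrite leNgt; apply/negP/nF.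
  by rewrite leNgt lteBlDr// lteDl// lte_fin divr_gt0.
exists (e / 2 / n.+1%:R)%R; first by rewrite !divr_gt0.
move=> E mE ED muE.
have mv' A : measurable_fun A (fun x => (v x)%:E).
  by apply/measurable_EFinP; exact: measurable_funTS.
have vE x : 0 <= (v x)%:E by rewrite lee_fin.
have nuDF : nu (D `\` F n) <= (e / 2)%:E.
  have := nuF; rewrite lteBlDr// => /ltW.
  have -> : nu D = nu (F n) + nu (D `\` F n).
    rewrite -measureU//; last by rewrite setDIK.
      by rewrite setDUK// => x [].
    exact: measurableD.
  rewrite leeD2lE//; rewrite ge0_fin_numE ?measure_ge0// (le_lt_trans _ vD)//.
  by apply: (@ge0_subset_integral _ _ _ mu) => // x [].
have -> : E = (E `&` F n) `|` (E `\` F n) by rewrite setUIDK.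
rewrite ge0_integral_setU//; [|exact: measurableI|exact: measurableD|].
- rewrite [e in leRHS]splitr EFinD; apply: leeD.
  + apply: (@le_trans _ _ (\int[mu]_(x in E) (n.+1%:R)%:E)).
      apply: (@le_trans _ _ (\int[mu]_(x in E `&` F n) (n.+1%:R)%:E)).
        apply: ge0_le_integral => //; first exact: measurableI.
        by move=> x [_ [_ /= vn]]; rewrite lee_fin (le_trans vn)// ler_nat.
      by apply: ge0_subset_integral => //; exact: measurableI.
    rewrite (integral_cst mu mE) (le_trans (lee_wpmul2l _ muE))//.

    by rewrite -EFinM lee_fin mulrCA divff ?mulr1// pnatr_eq0.
  + apply: le_trans nuDF; apply: ge0_subset_integral => //; [exact: measurableD|exact: measurableD|].
    by move=> x [Ex nFx]; split; [exact: ED|].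
- by rewrite disj_set2E; apply/eqP/seteqP; split => // x [[_ a] [_ b]].
Qed.
End measure_facts.

(** * Geometry of half-open cubes *)

Section cubes.
Context {R : realType} {d : nat}.
Local Notation Rd := (d.-tuple R).
Implicit Types (a x : Rd) (l : R).

Definition cube a l : set Rd :=
  [set x | forall i, tnth a i <= tnth x i < tnth a i + l].

(** Translation along the diagonal, so that [cube (shift a (- l)) (3 * l)] is the concentric triple
    of [cube a l]. *)
Definition shift a (h : R) : Rd := [tuple tnth a i + h | i < d].

Lemma measurable_cube a l : measurable (cube a l).
Proof.
have -> : cube a l = \bigcap_(i in [set: 'I_d])
    ((fun x : Rd => tnth x i) @^-1` `[tnth a i, (tnth a i + l)[).
  by apply/seteqP; split => x /= h i; have := h i; rewrite /= in_itv/=; exact.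
apply: fin_bigcap_measurable => // i _; rewrite -[X in measurable X]setTI.
exact: measurable_tnth.
Qed.

Lemma is_cube_cube a l : 0 < l -> is_cube (cube a l).
Proof. by move=> l0; exists a, l. Qed.

Lemma lebesgue_cube (mu : {measure set Rd -> \bar R}) a l :
  is_lebesgue_measure mu -> 0 <= l -> mu (cube a l) = (l ^+ d)%:E.
Proof.
move=> hmu l0; have := hmu a (shift a l).
have -> : box a (shift a l) = cube a l.
  by apply/seteqP; split => x /= h i; have := h i; rewrite /shift tnth_mktuple.
move=> ->; last by move=> i; rewrite tnth_mktuple lerDl.
under eq_bigr do rewrite tnth_mktuple addrAC subrr add0r.
by rewrite prodr_const card_ord.
Qed.

Lemma cube_shiftS a l h l' : h <= 0 -> l <= h + l' ->
  cube a l `<=` cube (shift a h) l'.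
Proof. by move=> h0 hl x xa i; have := xa i; rewrite tnth_mktuple; lra. Qed.

Lemma cube_shift_shift a h1 l1 h2 l2 : h2 <= h1 -> h1 + l1 <= h2 + l2 ->
  cube (shift a h1) l1 `<=` cube (shift a h2) l2.
Proof. by move=> h lh x xa i; have := xa i; rewrite !tnth_mktuple; lra. Qed.

Lemma cube_touch a l b m x : cube a l x -> cube b m x -> m <= l ->
  cube b m `<=` cube (shift a (- l)) (3 * l).
Proof.
move=> xa xb ml y yb i; have := xa i; have := xb i; have := yb i.
by rewrite tnth_mktuple; lra.
Qed.

Definition ratcube (k : d.-tuple rat * rat) : set Rd :=
  cube [tuple ratr (tnth k.1 i) | i < d] (ratr k.2).

(** The dilate by six leaves room for a rational cube around the triple: with the corner between
    [a - 2 l] and [a - l] and the side between [4 l] and [5 l], the upper corner falls between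
    [a + 2 l] and [a + 4 l]. *)
Lemma ratcube_engulf a l : 0 < l -> exists k,
  [/\ 0 < ratr k.2 :> R, cube (shift a (- l)) (3 * l) `<=` ratcube k &
      ratcube k `<=` cube (shift a (- 2 * l)) (6 * l)].
Proof.
move=> l0.
have : forall i, exists q : rat, tnth a i - 2 * l < ratr q < tnth a i - l.
  move=> i; have [|q] := @rat_in_itvoo R (tnth a i - 2 * l) (tnth a i - l).
    by lra.
  by rewrite in_itv/=; exists q.
move=> /choice[q hq].
have [|m] := @rat_in_itvoo R (4 * l) (5 * l); first by lra.
rewrite in_itv/= => /andP[m4 m5].
exists ([tuple q i | i < d], m); split => /=; first by lra.
- move=> x xa i; have := xa i; have := hq i; rewrite !tnth_mktuple; lra.
- move=> x xa i; have := xa i; have := hq i; rewrite !tnth_mktuple; lra.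
Qed.

Definition centered (r : R) : set Rd := cube [tuple - r | i < d] (2 * r).

Lemma centeredP r x : centered r x <-> forall i, - r <= tnth x i < r.
Proof.
by split => h i; have := h i; rewrite tnth_mktuple => ?; lra.
Qed.

Lemma cube_sub_centered a l : exists n : nat, cube a l `<=` centered n%:R.
Proof.
pose M := \sum_i `|tnth a i| + `|l|.
exists (Num.bound M) => x xa; apply/centeredP => i.
have M0 : 0 <= M by rewrite addr_ge0// sumr_ge0.
have := archi_boundP M0; have := xa i.
have : `|tnth a i| + `|l| <= M.
  rewrite lerD2r (bigD1 i)//= lerDl sumr_ge0//.
have := ler_norm (tnth a i); have := ler_norm (- tnth a i); have := ler_norm l.
rewrite normrN; lra.
Qed.

Lemma centeredS r s : r <= s -> centered r `<=` centered s.
Proof. by move=> rs x /centeredP h; apply/centeredP => i; have := h i; lra. Qed.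

Lemma measurable_centered r : measurable (centered r).
Proof. exact: measurable_cube. Qed.

End cubes.


(** * Vitali covering and the weak type inequality for a doubling measure *)

Section covering.
Local Open Scope ereal_scope.
Context {R : realType} {d : nat}.
Local Notation Rd := (d.-tuple R).
Variables (nu m : {measure set Rd -> \bar R}) (D : R).
Hypothesis D0 : (0 <= D)%R.
Hypothesis doubling : forall a l, (0 < l)%R ->
  nu (cube (shift a (- 2 * l)) (6 * l)) <= D%:E * nu (cube a l).

Let seq_max (s : seq (Rd * R)) : s != [::] ->
  exists2 k, k \in s & forall j, j \in s -> (j.2 <= k.2)%R.
Proof.
elim: s => // k s IH _; have [->|/IH[k' ks kmax]] := eqVneq s [::].
  by exists k; rewrite ?mem_head// => j; rewrite inE => /eqP ->.
have [kk'|kk'] := leP k'.2 k.2.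
  exists k; rewrite ?mem_head// => j; rewrite inE => /orP[/eqP -> //|/kmax jk].
  exact: le_trans kk'.
exists k'; first by rewrite inE ks orbT.
by move=> j; rewrite inE => /orP[/eqP ->|/kmax//]; exact: ltW.
Qed.

Let ucubes (s : seq (Rd * R)) := \bigcup_(k in [set` s]) cube k.1 k.2.

Let measurable_ucubes s : measurable (ucubes s).
Proof. by apply: fin_bigcup_measurable => // k _; exact: measurable_cube. Qed.


Lemma triple_cube_le a l : (0 < l)%R ->
  nu (cube (shift a (- l)) (3 * l)) <= D%:E * nu (cube a l).
Proof.
move=> l0; apply: le_trans (doubling _ l0).
apply: le_measure; rewrite ?inE; try exact: measurable_cube.
by apply: cube_shift_shift; lra.
Qed.

(* The Vitali selection, run as an induction: the largest cube pays for all the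
   cubes it meets, and the remaining cubes are disjoint from it. *)
Lemma vitali_cubes (t : R) (s : seq (Rd * R)) : (0 <= t)%R ->
  (forall k, k \in s -> (0 < k.2)%R) ->
  (forall k, k \in s -> t%:E * nu (cube k.1 k.2) <= m (cube k.1 k.2)) ->
  t%:E * nu (\bigcup_(k in [set` s]) cube k.1 k.2) <=
  D%:E * m (\bigcup_(k in [set` s]) cube k.1 k.2).
Proof.
move=> t0; have [n] := ubnP (size s); elim: n s => // n IH s sn s0 st.
rewrite -/(ucubes s); have [->|sN] := eqVneq s [::].
  by rewrite /ucubes set_nil bigcup_set0 !measure0 !mule0.
have [k ks kmax] := seq_max sN.
pose s1 := [seq j <- s | `[< cube j.1 j.2 `&` cube k.1 k.2 = set0 >]].
have k0 := s0 _ ks.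
have mk : measurable (cube k.1 k.2) by exact: measurable_cube.
have m3k : measurable (cube (shift k.1 (- k.2)) (3 * k.2)) by exact: measurable_cube.
have mUs := measurable_ucubes s; have mUs1 := measurable_ucubes s1.
have s1s j : j \in s1 -> j \in s by rewrite mem_filter => /andP[].
have sz : (size s1 < n)%N.
  (* [k] meets itself, as its corner lies in it, so at least one cube leaves the list. *)
  apply: leq_trans (ltnSE sn); rewrite ltn_neqAle size_filter count_size andbT.
  rewrite -all_count; apply/negP => /allP/(_ _ ks)/asboolP.
  move/seteqP => [/(_ k.1) + _]; apply; split => i; rewrite lexx ltrDl//.
have cov : ucubes s `<=` cube (shift k.1 (- k.2)) (3 * k.2) `|` ucubes s1.
  move=> x [j /= js xj].
  have [dj|/eqP/set0P[y [yj yk]]] := pselect (cube j.1 j.2 `&` cube k.1 k.2 = set0).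
    by right; exists j => //=; rewrite mem_filter js andbT; exact/asboolP.
  by left; apply: (cube_touch yk yj) => //; exact: kmax.
have IHs1 := IH s1 sz (fun j js => s0 j (s1s j js)) (fun j js => st j (s1s j js)).
have disj : cube k.1 k.2 `&` ucubes s1 = set0.
  apply/seteqP; split => // x [xk [j /= js xj]].
  move: js; rewrite mem_filter => /andP[/asboolP dj _].
  by have : (cube j.1 j.2 `&` cube k.1 k.2) x by []; rewrite dj.
apply: (@le_trans _ _ (t%:E * (D%:E * nu (cube k.1 k.2) + nu (ucubes s1)))).
  apply: lee_wpmul2l; first by rewrite lee_fin.
  apply: (@le_trans _ _ (nu (cube (shift k.1 (- k.2)) (3 * k.2) `|` ucubes s1))).
    apply: le_measure; rewrite ?inE//; exact: measurableU.
  apply: le_trans (measureU2 _ _ _) _ => //.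
  by apply: leeD => //; exact: triple_cube_le.
rewrite ge0_muleDr ?mule_ge0 ?lee_fin// muleCA.
apply: (@le_trans _ _ (D%:E * (m (cube k.1 k.2) + m (ucubes s1)))).
  rewrite ge0_muleDr// leeD// lee_wpmul2l ?lee_fin//; exact: st.
apply: lee_wpmul2l; first by rewrite lee_fin.
rewrite -measureU//.
apply: le_measure; rewrite ?inE//; first exact: measurableU.
by move=> x [xk|[j /= /s1s js xj]]; [exists k|exists j].
Qed.

(** Weak type (1,1): for [m = g nu] and [I] the cubes where the mean of [g] is at least [t], the
    union covers a level set of the maximal function. *)
Lemma weak_type_cubes (t : R) (I : set nat) (a : nat -> Rd) (l : nat -> R) :
  (0 <= t)%R -> (forall i, I i -> (0 < l i)%R) ->
  (forall i, I i -> t%:E * nu (cube (a i) (l i)) <= m (cube (a i) (l i))) ->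
  t%:E * nu (\bigcup_(i in I) cube (a i) (l i)) <=
  D%:E * m (\bigcup_(i in I) cube (a i) (l i)).
Proof.
move=> t0 l0 ht; set U := \bigcup_(i in I) _.
have mU : measurable U.
  by apply: bigcup_measurable => i _; exact: measurable_cube.
have [->|tN0] := eqVneq t 0%R; first by rewrite mul0e mule_ge0 ?lee_fin.
have tpos : (0 < t)%R by rewrite lt_neqAle eq_sym tN0.
rewrite muleC -lee_pdivlMr// /U bigcup_mkcond.
apply: measure_bigcup_le => [i|n].
  by case: ifP => // _; exact: measurable_cube.
rewrite lee_pdivlMr// muleC.
pose s := [seq (a i, l i) | i <- iota 0 n & i \in I].
have sI k : k \in s -> exists i, [/\ I i, (i < n)%N & k = (a i, l i)].
  case/mapP => i; rewrite mem_filter mem_iota => /andP[/set_mem iI ni] ->.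
  by exists i.
have -> : \big[setU/set0]_(i < n) (if (i : nat) \in I then cube (a i) (l i) else set0)
    = \bigcup_(k in [set` s]) cube k.1 k.2.
  rewrite -(bigcup_mkord n (fun i => if i \in I then cube (a i) (l i) else set0)).
  apply/seteqP; split => [x [i /= ni]|x [k /= /sI[i [iI ni ->]] xi]].
    case: ifPn => // iI xi; exists (a i, l i) => //=.
    by apply/mapP; exists i => //; rewrite mem_filter iI mem_iota.
  by exists i => //=; rewrite mem_set.
apply: le_trans (vitali_cubes t0 _ _) _.
- by move=> k /sI[i [iI _ ->]]; exact: l0.
- by move=> k /sI[i [iI _ ->]]; exact: ht.
apply: lee_wpmul2l; first by rewrite lee_fin.
apply: le_measure; rewrite ?inE//; [exact: measurable_ucubes|by rewrite -bigcup_mkcond|].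
rewrite -bigcup_mkcond => x [k ks xk]; have [i [iI _ ke]] := sI k ks.
by exists i => //; move: xk; rewrite ke.
Qed.

End covering.

Lemma measurable_sqrt {R : realType} : measurable_fun [set: R] (@Num.sqrt R).
Proof. by apply: continuous_measurable_fun; exact: sqrt_continuous. Qed.

Lemma measurable_fun_EFin {dd} {X : measurableType dd} {R : realType} (D : set X) (f : X -> R) :
  measurable_fun setT f -> measurable_fun D (fun x => (f x)%:E).
Proof. by move=> mf; apply/measurable_EFinP; exact: measurable_funTS. Qed.

Lemma density_eq0 {dd} {X : measurableType dd} {R : realType}
    (mu : {measure set X -> \bar R}) (v : X -> R) (N : set X) :
  measurable_fun setT v -> (forall x, 0 < v x) -> measurable N ->
  (\int[mu]_(x in N) (v x)%:E = 0)%E -> mu N = 0%E.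
Proof.
move=> mv v0 mN vN.
have := @ae_eq_integral_abs _ _ _ mu N mN _ (measurable_fun_EFin mv).
have -> : (\int[mu]_(x in N) `|(v x)%:E| = 0)%E.
  by rewrite -[RHS]vN; apply: eq_integral => x _; rewrite gee0_abs// lee_fin ltW.
move=> [/(_ erefl) [A [mA A0 NA]] _].
apply: (subset_measure0 mN mA _ A0) => x Nx; apply: NA => /= /(_ Nx) [].
by apply/eqP; rewrite gt_eqF.
Qed.

(** * The maximal function of a doubling weight, and A_1 weights built from it *)

Section maximal.
Local Open Scope ereal_scope.
Context {R : realType} {d : nat}.
Local Notation Rd := (d.-tuple R).
Variables (mu : {measure set Rd -> \bar R}) (v g : Rd -> R) (D : R).
Hypothesis D1 : (1 <= D)%R.
Hypothesis mv : measurable_fun setT v.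
Hypothesis v0 : forall x, (0 < v x)%R.
Hypothesis mg : measurable_fun setT g.
Hypothesis g0 : forall x, (0 <= g x)%R.

Let v0' x : (0 <= v x)%R. Proof. exact: ltW. Qed.
Let mgv : measurable_fun setT (g \* v)%R. Proof. exact: measurable_funM. Qed.
Let gv0 x : (0 <= (g \* v) x)%R. Proof. exact: mulr_ge0. Qed.

Local Notation nu := (density mu mv v0').
Local Notation m := (density mu mgv gv0).

Hypothesis nu_fin : forall a l, nu (cube a l) < +oo.
Hypothesis nu_gt0 : forall a l, (0 < l)%R -> 0 < nu (cube a l).
Hypothesis doubling : forall a l, (0 < l)%R ->
  nu (cube (shift a (- 2 * l)) (6 * l)) <= D%:E * nu (cube a l).
Hypothesis m_fin : m setT < +oo.
Variables (a0 : Rd) (l0 : R).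
Hypothesis l0_gt0 : (0 < l0)%R.
Hypothesis g1 : forall x, cube a0 l0 x -> (1 <= g x)%R.

Let D_ge0 : (0 <= D)%R. Proof. exact: le_trans D1. Qed.

Let nu_ge0 A : 0 <= nu A. Proof. exact: measure_ge0. Qed.
Let m_ge0 A : 0 <= m A. Proof. exact: measure_ge0. Qed.
#[local] Hint Resolve nu_ge0 m_ge0 : core.

(** Rational cubes of positive side, enumerated through [unpickle]; every other code names the cube
    [(a0, l0)]. A countable family makes the maximal function measurable, and [engulf] makes it
    comparable with the one over all cubes. *)
Let qcube (n : nat) : Rd * R :=
  if unpickle n is Some k then
    if (0 < ratr k.2 :> R)%R then
      ([tuple ratr (tnth (k : d.-tuple rat * rat).1 i) | i < d], ratr k.2)
    else (a0, l0)
  else (a0, l0).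

Let qa n := (qcube n).1.
Let ql n := (qcube n).2.
Let Q n : set Rd := cube (qa n) (ql n).

Let mQ n : measurable (Q n). Proof. exact: measurable_cube. Qed.

Let ql_gt0 n : (0 < ql n)%R.
Proof. by rewrite /ql /qcube; case: unpickle => [k|//]; case: ifPn. Qed.

Let engulf a l : (0 < l)%R -> exists n, cube (shift a (- l)) (3 * l) `<=` Q n /\
   Q n `<=` cube (shift a (- 2 * l)) (6 * l).
Proof.
move=> l_gt0; have [k [k0 h1 h2]] := ratcube_engulf a l_gt0.
by exists (pickle k); rewrite /Q /qa /ql /qcube pickleK k0.
Qed.

Let nu_engulf a l n : (0 < l)%R -> Q n `<=` cube (shift a (- 2 * l)) (6 * l) ->
  nu (Q n) <= D%:E * nu (cube a l).
Proof.
move=> l_gt0 h; apply: le_trans (doubling _ l_gt0).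
by apply: le_measure; rewrite ?inE//; exact: measurable_cube.
Qed.

Let m_cube_fin a l : m (cube a l) < +oo.
Proof.
apply: le_lt_trans m_fin; apply: le_measure; rewrite ?inE//; exact: measurable_cube.
Qed.

Let rho n : R := (fine (m (Q n)) / fine (nu (Q n)))%R.

Let rho_ge0 n : (0 <= rho n)%R.
Proof. by rewrite divr_ge0// fine_ge0. Qed.

Let rhoE n (c : R) : (rho n <= c)%R = (m (Q n) <= c%:E * nu (Q n)).
Proof.
have f0 : (0 < fine (nu (Q n)))%R.
  by apply: fine_gt0; apply/andP; split; [exact: nu_gt0|exact: nu_fin].
rewrite /rho ler_pdivrMr// -lee_fin EFinM !fineK// ge0_fin_numE//.
exact: nu_fin.
exact: m_cube_fin.
Qed.

(** The uncentred maximal function of [g] with respect to [v dx]. It takes extended real values, as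
    it is shown to be finite only almost everywhere. *)
Let Mx x : \bar R := esups (fun n => (rho n * \1_(Q n) x)%:E) 0%N.

Let mMx : measurable_fun setT Mx.
Proof.
apply: measurable_fun_esups => n; apply: measurable_fun_EFin.
by apply: measurable_funM => //; exact: measurable_indic.
Qed.

Let Mx_ge n x : Q n x -> (rho n)%:E <= Mx x.
Proof.
move=> Qx; apply: ereal_sup_ubound; exists n => //=.
by rewrite indicE mem_set// mulr1.
Qed.

Let Mx_ge0 x : 0 <= Mx x.
Proof.
apply: (@le_trans _ _ (rho 0 * \1_(Q 0) x)%:E).
  by rewrite lee_fin mulr_ge0.
by apply: ereal_sup_ubound; exists 0%N.
Qed.

Let Mx_gt (t : R) x : (0 <= t)%R -> t%:E < Mx x ->
  exists2 n, Q n x & (t < rho n)%R.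
Proof.
move=> t0 /ereal_sup_gt[_ [n _ <-]]; rewrite lte_fin indicE.
have [/set_mem Qx|_] := boolP (x \in Q n); rewrite ?mulr1 ?mulr0 ?(le_gtF t0)//.
by exists n.
Qed.

(** A large rational cube contains both [x] and the cube where [g >= 1]. The positivity of the
    weight [b] at every point rests on this. *)
Let Mx_gt0 x : 0 < Mx x.
Proof.
have [p xp] := cube_sub_centered x 1; have [q aq] := cube_sub_centered a0 l0.
pose r : R := (p + q).+1%:R.
have r0 : (0 < 2 * r)%R by rewrite mulr_gt0.
have [n [h _]] := @engulf [tuple (- r)%R | i < d] _ r0.
have hr : centered r `<=` Q n.
  by apply: subset_trans h; apply: cube_shiftS; rewrite /r; lra.
have Qx : Q n x.
  apply/hr/(@centeredS _ _ p%:R); first by rewrite ler_nat leqW// leq_addr.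
  by apply: xp => i; rewrite lexx ltrDl ltr01.
apply: lt_le_trans (Mx_ge Qx); rewrite lte_fin ltNge rhoE mul0e -ltNge.
apply: (@lt_le_trans _ _ (nu (cube a0 l0))); first exact: nu_gt0.
apply: (@le_trans _ _ (m (cube a0 l0))).
  apply: ge0_le_integral => //=; first exact: measurable_cube.
  - by move=> y _; rewrite lee_fin.
  - exact: measurable_fun_EFin.
  - exact: measurable_fun_EFin.
  - by move=> y Qy; rewrite lee_fin ler_peMl// g1.
apply: le_measure; rewrite ?inE//; first exact: measurable_cube.
apply: subset_trans hr; apply: subset_trans aq _; apply: centeredS.
by rewrite ler_nat leqW// leq_addl.
Qed.

Let mMxgt (t : \bar R) : measurable [set x | t < Mx x].
Proof. by rewrite -[X in measurable X]setTI; exact: emeasurable_fun_o_infty. Qed.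

Let mMx_infty : measurable [set x | Mx x = +oo].
Proof.
rewrite -[X in measurable X]setTI.
exact: (mMx measurableT (@emeasurable_set1 R +oo)).
Qed.

(** The weak type estimate bounds the [v]-mass of this set by [D m(setT) / t] for every [t > 0]. *)
Let mu_Mx_infty : mu [set x | Mx x = +oo] = 0.
Proof.
apply: (density_eq0 mv v0) => //; rewrite -/(nu _).
apply/eqP; rewrite eq_le measure_ge0 andbT.
have key t : (0 < t)%R -> t%:E * nu [set x | Mx x = +oo] <= D%:E * m setT.
  move=> t0; pose I := [set n | t%:E * nu (Q n) <= m (Q n)].
  apply: (@le_trans _ _ (t%:E * nu (\bigcup_(n in I) Q n))).
    apply: lee_wpmul2l; first by rewrite lee_fin ltW.
    apply: le_measure; rewrite ?inE//; first by apply: bigcup_measurable => n _; exact: mQ.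
    move=> x /= Mxy; have [|n Qx tr] := @Mx_gt t x (ltW t0); first by rewrite Mxy ltry.
    by exists n => //; rewrite /I/= ltW// ltNge -rhoE -ltNge.
  apply: le_trans (weak_type_cubes D_ge0 doubling (ltW t0) _ _) _.
  - by move=> n _; exact: ql_gt0.
  - by move=> n; exact.
  apply: lee_wpmul2l; first by rewrite lee_fin.
  apply: le_measure; rewrite ?inE//; apply: bigcup_measurable => n _; exact: mQ.
have mfin : D%:E * m setT \is a fin_num.
  by rewrite fin_numM// ge0_fin_numE.
apply/lee_addgt0Pr => e e0; rewrite add0e.
have := key ((fine (D%:E * m setT) + 1) / e)%R.
rewrite divr_gt0//; last first.
  by rewrite ltr_pwDr// fine_ge0// mule_ge0// lee_fin.
move=> /(_ isT); rewrite muleC -lee_pdivlMr; last first.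
  by rewrite divr_gt0// ltr_pwDr// fine_ge0// mule_ge0// lee_fin.
move=> /le_trans; apply; rewrite lee_pdivrMr; last first.
  by rewrite divr_gt0// ltr_pwDr// fine_ge0// mule_ge0// lee_fin.
rewrite -EFinM mulrC divfK ?gt_eqF// -{1}(fineK mfin) lee_fin; lra.
Qed.

(* Cubes meeting [cube a l] that are larger than it have small average (engulf
   both in one cube); the smaller ones stay in a fixed dilate. *)
Let local_weak_type a l x (c t : R) : (0 < l)%R -> cube a l x -> Mx x = c%:E ->
  (D * c <= t)%R ->
  t%:E * nu (cube a l `&` [set y | t%:E < Mx y]) <= (D * D * c)%:E * nu (cube a l).
Proof.
move=> l_gt0 Qx Mxc ct.
have c0 : (0 <= c)%R by rewrite -lee_fin -Mxc.
have t0 : (0 <= t)%R by rewrite (le_trans _ ct)// mulr_ge0.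
have avgx n : Q n x -> m (Q n) <= c%:E * nu (Q n).
  by move=> Qnx; rewrite -rhoE -lee_fin -Mxc; exact: Mx_ge.
have [n' [h1 h2]] := engulf a l_gt0.
pose I := [set n | t%:E * nu (Q n) < m (Q n) /\ Q n `&` cube a l !=set0].
have sub n : I n -> Q n `<=` Q n'.
  move=> [tn [y [yn ya]]]; apply: subset_trans h1.
  have [ln|ln] := leP (ql n) l; first exact: (cube_touch ya yn).
  exfalso; move: tn; apply/negP; rewrite -leNgt.
  have [k [k1 k2]] := engulf (qa n) (ql_gt0 n).
  have Qnk : Q n `<=` Q k by apply: subset_trans k1; apply: cube_shiftS; have := ql_gt0 n; lra.
  have Qkx : Q k x by apply: k1; exact: (cube_touch yn ya (ltW ln)).
  apply: (@le_trans _ _ (m (Q k))); first by apply: le_measure; rewrite ?inE.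
  apply: le_trans (avgx _ Qkx) _.
  apply: (@le_trans _ _ (c%:E * (D%:E * nu (Q n)))).
    apply: lee_wpmul2l; first by rewrite lee_fin.
    exact: nu_engulf.
  rewrite muleA -EFinM (mulrC c); exact: lee_wpmul2r.
have mU : measurable (\bigcup_(n in I) Q n) by apply: bigcup_measurable => n _; exact: mQ.
apply: (@le_trans _ _ (t%:E * nu (\bigcup_(n in I) Q n))).
  apply: lee_wpmul2l; first by rewrite lee_fin.
  apply: le_measure; rewrite ?inE//.
    by apply: measurableI => //; exact: measurable_cube.
  move=> y [ya /= /(Mx_gt t0)[n Qny tn]]; exists n => //; split; last by exists y.
  by rewrite ltNge -rhoE -ltNge.
(* One [D] comes from the weak type estimate, the other from comparing [Q n'] with [cube a l]; the
   mean of [g] over [Q n'] is at most [c] because [Q n'] contains [x]. *)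
apply: le_trans (weak_type_cubes D_ge0 doubling t0 _ _) _.
- by move=> n _; exact: ql_gt0.
- by move=> n [tn _]; exact: ltW tn.
apply: (@le_trans _ _ (D%:E * m (Q n'))).
  apply: lee_wpmul2l; first by rewrite lee_fin.
  by apply: le_measure; rewrite ?inE//; apply: bigcup_sub.
have Qn'x : Q n' x by apply: h1; apply: cube_shiftS Qx; lra.
apply: (@le_trans _ _ (D%:E * (c%:E * (D%:E * nu (cube a l))))).
  apply: lee_wpmul2l; first by rewrite lee_fin.
  apply: le_trans (avgx _ Qn'x) _.
  apply: lee_wpmul2l; first by rewrite lee_fin.
  exact: nu_engulf.
by rewrite !muleA -!EFinM -mulrA (mulrC c) mulrA.
Qed.


Let integral_level (a : Rd) (l K : R) (E : set Rd) : measurable E -> (0 <= K)%R ->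
  \int[mu]_(y in cube a l) (K * \1_E y * v y)%:E = K%:E * nu (cube a l `&` E).
Proof.
move=> mE K0; have mC : measurable (cube a l) by exact: measurable_cube.
under eq_integral do rewrite -mulrA EFinM.
rewrite ge0_integralZl//; last 2 first.
- by apply: measurable_fun_EFin; apply: measurable_funM => //; exact: measurable_indic.
- by move=> y _; rewrite lee_fin mulr_ge0.
congr (_ * _); rewrite /density integral_mkcondr epatch_indic.
by apply: eq_integral => y _; rewrite EFinM muleC.
Qed.

(** The mean of [g] over the cube is at most [D c], since a comparable rational cube contains both
    the cube and [x]; AM-GM then gives the constant [(D c / sqrt c + sqrt c) / 2]. *)
Let integral_sqrt_g a l x (c : R) : (0 < l)%R -> cube a l x -> Mx x = c%:E ->
  \int[mu]_(y in cube a l) (Num.sqrt (g y) * v y)%:E <=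
  (Num.sqrt c * ((D + 1) / 2))%:E * nu (cube a l).
Proof.
move=> l_gt0 Qx Mxc; have mC : measurable (cube a l) by exact: measurable_cube.
have c0 : (0 < c)%R by rewrite -lte_fin -Mxc.
have sc : (0 < Num.sqrt c)%R by rewrite sqrtr_gt0.
have [n [h1 h2]] := engulf a l_gt0.
have mle : m (cube a l) <= (c * D)%:E * nu (cube a l).
  apply: (@le_trans _ _ (m (Q n))).
    by apply: le_measure; rewrite ?inE//; apply: subset_trans h1; apply: cube_shiftS; lra.
  have : m (Q n) <= c%:E * nu (Q n).
    rewrite -rhoE -lee_fin -Mxc; apply: Mx_ge; apply: h1.
    by apply: cube_shiftS Qx; lra.
  move=> /le_trans; apply; rewrite EFinM -muleA; apply: lee_wpmul2l.
    by rewrite lee_fin ltW.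
  exact: nu_engulf.
apply: (@le_trans _ _ (\int[mu]_(y in cube a l)
    (((2 * Num.sqrt c)^-1)%:E * ((g \* v) y)%:E + (Num.sqrt c / 2)%:E * (v y)%:E))).
  apply: ge0_le_integral => //.
  - by move=> y _; rewrite lee_fin mulr_ge0// ?sqrtr_ge0.
  - apply: measurable_fun_EFin; apply: measurable_funM => //.
    exact: measurableT_comp measurable_sqrt mg.
  - apply: emeasurable_funD; apply: measurable_funeM; exact: measurable_fun_EFin.
  - move=> y _; rewrite -!EFinM -EFinD lee_fin /= mulrA -mulrDl ler_wpM2r//.
    (* AM-GM: [sqrt g <= (g / sqrt c + sqrt c) / 2] *)
    set u := Num.sqrt (g y); have -> : g y = (u ^+ 2)%R by rewrite sqr_sqrtr.
    have -> : ((2 * Num.sqrt c)^-1 * u ^+ 2 + Num.sqrt c / 2 =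
               u + (2 * Num.sqrt c)^-1 * (u - Num.sqrt c) ^+ 2)%R.
      by field; rewrite gt_eqF.
    by rewrite lerDl mulr_ge0 ?sqr_ge0// invr_ge0 mulr_ge0// ltW.
rewrite ge0_integralD//; last 4 first.
- by move=> y _; rewrite -EFinM lee_fin mulr_ge0// invr_ge0 mulr_ge0// ltW.
- apply: measurable_funeM; exact: measurable_fun_EFin.
- by move=> y _; rewrite -EFinM lee_fin mulr_ge0// divr_ge0// ltW.
- apply: measurable_funeM; exact: measurable_fun_EFin.
rewrite !ge0_integralZl//; last 4 first.
- exact: measurable_fun_EFin.
- by move=> y _; rewrite lee_fin.
- exact: measurable_fun_EFin.
- by move=> y _; rewrite lee_fin.
have := mle; rewrite -/(m _) -/(nu _) => {}mle.
apply: (@le_trans _ _ (((2 * Num.sqrt c)^-1)%:E * ((c * D)%:E * nu (cube a l)) +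
    (Num.sqrt c / 2)%:E * nu (cube a l))).
  by apply: leeD => //; apply: lee_wpmul2l => //; rewrite lee_fin invr_ge0 mulr_ge0// ltW.
rewrite muleA -EFinM -ge0_muleDl; last 2 first.
- by rewrite lee_fin !mulr_ge0// ?invr_ge0 ?mulr_ge0// ltW.
- by rewrite lee_fin divr_ge0// ltW.
apply: lee_wpmul2r => //; rewrite -EFinD lee_fin.
rewrite -{2}(sqr_sqrtr (ltW c0)) le_eqVlt; apply/orP; left; apply/eqP.
by field; rewrite gt_eqF.
Qed.

(* Kolmogorov's inequality: sum the weak-type bound over the levels [D c 4^k]. *)
Let integral_sqrt_Mx a l x (c : R) : (0 < l)%R -> cube a l x -> Mx x = c%:E ->
  \int[mu]_(y in cube a l) (Num.sqrt (fine (Mx y)) * v y)%:E <=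
  (Num.sqrt c * (Num.sqrt D * (1 + 4 * D)))%:E * nu (cube a l).
Proof.
move=> l_gt0 Qx Mxc; have mC : measurable (cube a l) by exact: measurable_cube.
have c0 : (0 < c)%R by rewrite -lte_fin -Mxc.
have D0' : (0 < D)%R by exact: lt_le_trans D1.
pose E := Num.sqrt (D * c); have E0 : (0 < E)%R by rewrite sqrtr_gt0 mulr_gt0.
pose L k := [set y | (D * c * 4 ^+ k)%:E < Mx y].
have mL k : measurable (L k) by exact: mMxgt.
have nuf : nu (cube a l) \is a fin_num by rewrite ge0_fin_numE// nu_fin.
pose nQ := fine (nu (cube a l)).
have nQ0 : (0 <= nQ)%R by exact: fine_ge0.
(* On the layer where [Mx] lies between [D c 4^k] and [D c 4^(k+1)], its root is at most
   [E 2^(k+1)]. *)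
pose h k y := (E * 2 ^+ k.+1 * \1_(L k) y * v y)%:E.
have h0 k y : 0 <= h k y.
  by rewrite lee_fin mulr_ge0// mulr_ge0// mulr_ge0 ?exprn_ge0// ltW.
have mh k B : measurable_fun B (h k).
  apply: measurable_fun_EFin; apply: measurable_funM => //.
  by apply: measurable_funM => //; exact: measurable_indic.
(* The level set has relative mass of order [4^-k] against a height of order [2^k], so the bounds
   form a geometric series with sum [4 D E nQ]. *)
have ih k : \int[mu]_(y in cube a l) h k y <= (4 * D * E * nQ / (2 ^ k.+1)%:R)%:E.
  rewrite integral_level//; last by rewrite mulr_ge0 ?exprn_ge0// ltW.
  have : (D * c * 4 ^+ k)%:E * nu (cube a l `&` L k) <= (D * D * c)%:E * nu (cube a l).
    by apply: (local_weak_type l_gt0 Qx Mxc); rewrite ler_peMr ?exprn_ege1 ?ler1n// mulr_ge0// ltW.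
  have nf : nu (cube a l `&` L k) \is a fin_num.
    rewrite ge0_fin_numE//; apply: le_lt_trans (nu_fin a l).
    by apply: le_measure; rewrite ?inE//; exact: measurableI.
  rewrite -(fineK nf) -(fineK nuf) -/nQ -!EFinM !lee_fin.
  set z := fine _ => hz.
  have {}hz : (4 ^+ k * z <= D * nQ)%R.
    rewrite -(@ler_pM2l _ (D * c)) ?mulr_gt0//.
    by move: hz; rewrite mulrA => /le_trans; apply; rewrite le_eqVlt; apply/orP; left; apply/eqP; ring.
  rewrite natrX ler_pdivlMr ?exprn_gt0//.
  have -> : (E * 2 ^+ k.+1 * z * 2 ^+ k.+1 = (4 * E) * (4 ^+ k * z))%R.
    have -> : 4%R = (2 ^+ 2)%R :> R by rewrite -natrX.
    by rewrite -exprM exprS mulnC exprM; ring.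
  have -> : (4 * D * E * nQ = (4 * E) * (D * nQ))%R by ring.
  by rewrite ler_wpM2l// mulr_ge0// ltW.
apply: (@le_trans _ _ (\int[mu]_(y in cube a l) (E%:E * (v y)%:E + \sum_(k <oo) h k y))).
  apply: ae_ge0_le_integral => //.
  - by move=> y _; rewrite lee_fin mulr_ge0// ?sqrtr_ge0.
  - apply: measurable_fun_EFin; apply: measurable_funM => //.
    apply: measurableT_comp measurable_sqrt _.
    exact: measurableT_comp (fine_measurable measurableT) mMx.
  - move=> y _; apply: adde_ge0; first by rewrite -EFinM lee_fin mulr_ge0// ltW.
    by apply: nneseries_ge0.
  - apply: emeasurable_funD; first by apply: measurable_funeM; exact: measurable_fun_EFin.
    exact: ge0_emeasurable_sum.
  exists [set y | Mx y = +oo]; split => //.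
  move=> y /= /not_implyP[_ /negP]; apply: contraPP => Mxy.
  have Mf : Mx y \is a fin_num by rewrite ge0_fin_numE// lt_neqAle leey andbT; apply/eqP.
  apply/negP; rewrite negbK; set u := fine (Mx y).
  have Mxu : Mx y = u%:E by rewrite fineK.
  have u0 : (0 <= u)%R by exact: fine_ge0.
  have [uDc|uDc] := leP u (D * c)%R.
    rewrite (le_trans _ (leeDl _ _))//; last exact: nneseries_ge0.
    by rewrite -EFinM lee_fin ler_wpM2r// ler_sqrt// mulr_ge0// ltW.
  (* [n] is the first level that reaches [u]; it is not 0 since [u > D c], so [y] belongs to the
     layer [n - 1]. *)
  have [n un nmin] : exists2 n, (u <= D * c * 4 ^+ n)%R &
      forall j, (u <= D * c * 4 ^+ j)%R -> (n <= j)%N.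
    have : exists n, (u <= D * c * 4 ^+ n)%R.
      have ub0 : (0 <= u / (D * c))%R by rewrite divr_ge0// mulr_ge0// ltW.
      exists (Num.bound (u / (D * c))).
      rewrite mulrC -ler_pdivrMr ?mulr_gt0//.
      apply: (le_trans (ltW (archi_boundP ub0))).
      by rewrite -natrX ler_nat ltnW// ltn_expl.
    by move=> ex; case: (ex_minnP ex) => n un nmin; exists n.
  case: n un nmin => [|k] un nmin.
    by move: uDc; rewrite ltNge; move: un; rewrite expr0 mulr1 => ->.
  have Lk : L k y.
    rewrite /L /= Mxu lte_fin ltNge; apply/negP => /nmin; by rewrite ltnn.
  rewrite (@le_trans _ _ (h k y))//.
    rewrite /h indicE mem_set// mulr1 lee_fin ler_wpM2r//.
    have -> : (E * 2 ^+ k.+1 = Num.sqrt (D * c * 4 ^+ k.+1))%R.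
      rewrite sqrtrM ?mulr_ge0 ?ltW//; congr (_ * _)%R.
      have -> : 4%R = (2 ^+ 2)%R :> R by rewrite -natrX.
      by rewrite exprAC sqrtr_sqr ger0_norm ?exprn_ge0.
    by rewrite ler_sqrt// mulr_ge0 ?exprn_ge0// mulr_ge0// ltW.
  rewrite (le_trans _ (leeDr _ _))//; last by rewrite -EFinM lee_fin mulr_ge0// ltW.
  apply: le_trans (nneseries_lim_ge k.+1 _) => //.
  by rewrite big_nat_recr//= leeDr// sume_ge0.
rewrite ge0_integralD//; last 4 first.
- by move=> y _; rewrite -EFinM lee_fin mulr_ge0// ltW.
- by apply: measurable_funeM; exact: measurable_fun_EFin.
- by move=> y _; exact: nneseries_ge0.
- exact: ge0_emeasurable_sum.
rewrite ge0_integralZl//; last 3 first.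
- exact: measurable_fun_EFin.
- by move=> y _; rewrite lee_fin.
- by rewrite lee_fin ltW.
rewrite integral_nneseries//.
apply: (@le_trans _ _ (E%:E * nu (cube a l) + (4 * D * E * nQ)%:E)).
  have e0 : (0 <= 4 * D * E * nQ)%R by rewrite !mulr_ge0// ltW.
  apply: leeD2l; apply: le_trans (epsilon_trick0 xpredT e0).
  by apply: lee_nneseries => // k _ _; exact: integral_ge0.
rewrite -(fineK nuf) -/nQ -!EFinM -EFinD lee_fin le_eqVlt; apply/orP; left.
by rewrite /E sqrtrM ?(ltW D0')//; apply/eqP; ring.
Qed.

(** Both roots in [b] have means over a cube through [x] bounded by a multiple of [sqrt (Mx x)],
    hence of [b x]. The last clause turns small means of [g] over all cubes through [x] into
    smallness of [b x]. *)
Lemma A1_weight_exists : exists b : Rd -> R,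
  [/\ measurable_fun setT b, (forall x, 0 < b x)%R, (forall x, g x <= b x ^+ 2)%R,
      exists2 K : R, (0 < K)%R &
        {ae mu, forall x, forall a l, (0 < l)%R -> cube a l x ->
          \int[mu]_(y in cube a l) (b y * v y)%:E <=
            (K * b x)%:E * \int[mu]_(y in cube a l) (v y)%:E} &
      forall x (e : R), (0 <= e)%R -> g x = 0%R ->
        (forall a l, (0 < l)%R -> cube a l x ->
          \int[mu]_(y in cube a l) (g y * v y)%:E <=
            e%:E * \int[mu]_(y in cube a l) (v y)%:E) ->
        (b x ^+ 2 <= e)%R].
Proof.
(* Since [fine] sends infinity to 0, the value 1 replaces the root of [Mx] on the null set where
   [Mx] is infinite; this keeps [b] positive. *)
pose b x := (if (Mx x == +oo)%E then 1 + Num.sqrt (g x)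
             else Num.sqrt (fine (Mx x)) + Num.sqrt (g x))%R.
have msg : measurable_fun setT (fun x => Num.sqrt (g x)).
  exact: measurableT_comp measurable_sqrt mg.
have msM : measurable_fun setT (fun x => Num.sqrt (fine (Mx x))).
  apply: measurableT_comp measurable_sqrt _.
  exact: measurableT_comp (fine_measurable measurableT) mMx.
have mb : measurable_fun setT b.
  apply: measurable_fun_ifT.
  - apply: (measurable_fun_bool true).
    rewrite setTI (_ : _ @^-1` _ = [set x | Mx x = +oo])//.
    by apply/seteqP; split => x /= /eqP.
  - exact: measurable_funD.
  - exact: measurable_funD.
have Mfin x : Mx x != +oo -> Mx x = (fine (Mx x))%:E.
  by move=> Mxy; rewrite fineK// ge0_fin_numE// lt_neqAle leey andbT.
have fM0 x : Mx x != +oo -> (0 < fine (Mx x))%R.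
  by move=> Mxy; rewrite -lte_fin -Mfin.
exists b; split => //.
- move=> x; rewrite /b; case: ifPn => [_|/fM0 fM].
    by rewrite ltr_pwDl// sqrtr_ge0.
  by rewrite ltr_pwDl// ?sqrtr_gt0// sqrtr_ge0.
- move=> x; rewrite -{1}(sqr_sqrtr (g0 x)) lerXn2r// ?nnegrE ?sqrtr_ge0//.
    by rewrite /b; case: ifP; rewrite addr_ge0 ?sqrtr_ge0.
  by rewrite /b; case: ifP; rewrite lerDr ?sqrtr_ge0.
- pose K := (Num.sqrt D * (1 + 4 * D) + (D + 1) / 2)%R.
  have K0 : (0 < K)%R.
    rewrite /K ltr_wpDl//; last by rewrite divr_gt0// ltr_wpDl.
    by rewrite mulr_ge0 ?sqrtr_ge0// addr_ge0// mulr_ge0.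
  exists K => //; exists [set x | Mx x = +oo]; split => //.
  move=> x /= /existsNP[a /existsNP[l /not_implyP[l_gt0 /not_implyP[Qx]]]].
  apply: contra_notP => /eqP Mxy; have Mxc := Mfin _ Mxy.
  have mC : measurable (cube a l) by exact: measurable_cube.
  apply: (@le_trans _ _ (\int[mu]_(y in cube a l)
     ((Num.sqrt (fine (Mx y)) * v y)%:E + (Num.sqrt (g y) * v y)%:E))).
    apply: ae_ge0_le_integral => //.
    + move=> y _; rewrite lee_fin mulr_ge0// /b.
      by case: ifP; rewrite addr_ge0 ?sqrtr_ge0.
    + by apply: measurable_fun_EFin; exact: measurable_funM.
    + by move=> y _; rewrite -EFinD lee_fin addr_ge0// mulr_ge0 ?sqrtr_ge0.
    + by apply: emeasurable_funD; apply: measurable_fun_EFin; exact: measurable_funM.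
    exists [set y | Mx y = +oo]; split => // y /= /not_implyP[_].
    apply: contra_notP => /eqP/negPf Myy.
    by rewrite /b Myy -EFinD mulrDl.
  rewrite ge0_integralD//; last 4 first.
  + by move=> y _; rewrite lee_fin mulr_ge0// sqrtr_ge0.
  + by apply: measurable_fun_EFin; exact: measurable_funM.
  + by move=> y _; rewrite lee_fin mulr_ge0// sqrtr_ge0.
  + by apply: measurable_fun_EFin; exact: measurable_funM.
  apply: le_trans (leeD (integral_sqrt_Mx l_gt0 Qx Mxc) (integral_sqrt_g l_gt0 Qx Mxc)) _.
  have sM := sqrtr_ge0 (fine (Mx x)).
  rewrite -ge0_muleDl ?lee_fin//; last 2 first.
  + by rewrite mulr_ge0// mulr_ge0 ?sqrtr_ge0// addr_ge0// mulr_ge0.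
  + by rewrite mulr_ge0// divr_ge0// addr_ge0.
  apply: lee_wpmul2r => //; rewrite -EFinD lee_fin -mulrDr -/K mulrC ler_pM2l//.
  by rewrite /b (negPf Mxy) lerDl sqrtr_ge0.
- move=> x e e0 gx he; have Mxe : Mx x <= e%:E.
    apply: ge_ereal_sup => _ [n _ <-]; rewrite lee_fin indicE.
    have [/set_mem Qx|_] := boolP (x \in Q n); rewrite ?mulr1 ?mulr0//.
    by rewrite rhoE; exact: he.
  have Mxy : Mx x != +oo by rewrite lt_eqF// (le_lt_trans Mxe) ?ltry.
  rewrite /b (negPf Mxy) gx sqrtr0 addr0 sqr_sqrtr; last exact/ltW/fM0.
  by rewrite -lee_fin -Mfin.
Qed.

End maximal.

(** * Muckenhoupt weights in self-dual form, and how to perturb them *)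

Section muckenhoupt.
Context {R : realType} {d : nat}.
Local Notation Rd := (d.-tuple R).
Variable mu : {measure set Rd -> \bar R}.
Hypothesis hmu : is_lebesgue_measure mu.
Implicit Types (a c : R) (s : Rd -> R).

(* For exponents [a, c] this is the class of weights with
   [(avg s^a)^(1/a) (avg s^-c)^(1/c)] bounded over cubes: [A_{p,q}] is the case
   [(a, c) = (q, p')], and [s |-> 1/s] exchanges [a] and [c]. *)
Definition dual_weight a c s :=
  [/\ measurable_fun setT s, (forall x, 0 < s x) &
   exists2 C : R, 0 < C & forall x0 l, 0 < l ->
     exists V U : R, [/\ 0 < V, 0 < U,
       (\int[mu]_(x in cube x0 l) (s x `^ a)%:E = V%:E)%E,
       (\int[mu]_(x in cube x0 l) (s x `^ (- c))%:E = U%:E)%E &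
       V `^ a^-1 * U `^ c^-1 <= C * (l ^+ d) `^ (a^-1 + c^-1)]].

Lemma measurable_fun_powR s r : measurable_fun setT s ->
  measurable_fun setT (fun x => s x `^ r).
Proof. by move=> ms; exact: measurableT_comp (measurable_powR r) ms. Qed.

Lemma dual_weightV a c s : dual_weight a c s -> dual_weight c a (fun x => (s x)^-1).
Proof.
move=> [ms s0 [C C0 H]]; split.
- have -> : (fun x => (s x)^-1) = (fun x => s x `^ (-1)).
    by apply/funext => x; rewrite powR_inv1// ltW.
  exact: measurable_fun_powR.
- by move=> x; rewrite invr_gt0.
- exists C => // x0 l l0; have [V [U [V0 U0 hV hU hC]]] := H x0 l l0.
  have sE x r : (s x)^-1 `^ r = s x `^ (- r).
    by rewrite -powR_inv1 ?(ltW (s0 x))// -powRrM mulN1r.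
  exists U, V; split; [exact: U0|exact: V0| | |].
  + by rewrite -hU; apply: eq_integral => x _; rewrite sE.
  + by rewrite -hV; apply: eq_integral => x _; rewrite sE opprK.
  + by rewrite mulrC addrC.
Qed.

Lemma integral_powR_gt0 s r (E : set Rd) : measurable E -> measurable_fun setT s ->
  (forall x, 0 < s x) -> (0 < mu E)%E -> (0 < \int[mu]_(x in E) (s x `^ r)%:E)%E.
Proof.
move=> mE ms s0 E0; rewrite lt_neqAle integral_ge0 ?andbT; last first.
  by move=> x _; rewrite lee_fin powR_ge0.
apply/eqP => h; move: E0; rewrite (@density_eq0 _ _ _ mu (fun x => s x `^ r)) ?ltxx//.
- exact: measurable_fun_powR.
- by move=> x; exact: powR_gt0.
Qed.

(** Hoelder's inequality for [1 = s^(1/th) s^(-1/th)] with [th = 1/a + 1/c], obtained from Young's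
    inequality by an optimal scaling. *)
Lemma dual_weight_holder a c s (E : set Rd) (e V U : R) : 0 < a -> 0 < c ->
  measurable_fun setT s -> (forall x, 0 < s x) -> measurable E ->
  0 < e -> mu E = e%:E ->
  (\int[mu]_(x in E) (s x `^ a)%:E = V%:E)%E ->
  (\int[mu]_(x in E) (s x `^ (- c))%:E = U%:E)%E ->
  e `^ (a^-1 + c^-1) <= V `^ a^-1 * U `^ c^-1.
Proof.
move=> a0 c0 ms s0 mE e0 muE hV hU.
have E0 : (0 < mu E)%E by rewrite muE lte_fin.
have V0 : 0 < V by rewrite -lte_fin -hV; exact: integral_powR_gt0.
have U0 : 0 < U by rewrite -lte_fin -hU; exact: integral_powR_gt0.
pose th := a^-1 + c^-1; have th0 : 0 < th by rewrite addr_gt0 ?invr_gt0.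
pose p := a * th; pose q := c * th.
have p0 : 0 < p by rewrite mulr_gt0. have q0 : 0 < q by rewrite mulr_gt0.
have pq : p^-1 + q^-1 = 1.
  by rewrite /p /q /th; field; rewrite !gt_eqF// addr_gt0.
(* This scaling balances the two terms of Young's inequality: [k^p V = k^(-q) U], because
   [p + q = p q]. *)
pose k := (U / V) `^ (p * q)^-1.
have k0 : 0 < k by rewrite powR_gt0// divr_gt0.
have pw x : 1 <= k `^ p / p * s x `^ a + k `^ (- q) / q * s x `^ (- c).
  have sx0 := s0 x; set u := k * s x `^ th^-1.
  have u0 : 0 < u by rewrite mulr_gt0// powR_gt0.
  have := @conjugate_powR R u u^-1 p q (ltW u0) _ p0 q0 pq.
  rewrite invr_ge0 => /(_ (ltW u0)); rewrite mulfV ?gt_eqF//.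
  rewrite -(powR_inv1 (ltW u0)) -powRrM mulN1r /u !powRM ?powR_ge0 ?(ltW k0)// -!powRrM.
  have -> : th^-1 * p = a by rewrite /p; field; rewrite gt_eqF.
  have -> : th^-1 * - q = - c by rewrite /q; field; rewrite gt_eqF.
  by rewrite mulrAC [X in _ + X]mulrAC.
have : (e%:E <= (k `^ p / p * V + k `^ (- q) / q * U)%R%:E)%E.
  have -> : (k `^ p / p * V + k `^ (- q) / q * U)%:E =
      (\int[mu]_(x in E) ((k `^ p / p)%:E * (s x `^ a)%:E
                         + (k `^ (- q) / q)%:E * (s x `^ (- c))%:E))%E.
    rewrite ge0_integralD//; last 4 first.
    - by move=> x _; rewrite -EFinM lee_fin mulr_ge0 ?powR_ge0// divr_ge0 ?powR_ge0// ltW.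
    - by apply: measurable_funeM; apply: measurable_fun_EFin; exact: measurable_fun_powR.
    - by move=> x _; rewrite -EFinM lee_fin mulr_ge0 ?powR_ge0// divr_ge0 ?powR_ge0// ltW.
    - by apply: measurable_funeM; apply: measurable_fun_EFin; exact: measurable_fun_powR.
    rewrite !ge0_integralZl ?hV ?hU//.
    - by apply: measurable_fun_EFin; exact: measurable_fun_powR.
    - by move=> x _; rewrite lee_fin powR_ge0.
    - by rewrite lee_fin divr_ge0 ?powR_ge0// ltW.
    - by apply: measurable_fun_EFin; exact: measurable_fun_powR.
    - by move=> x _; rewrite lee_fin powR_ge0.
    - by rewrite lee_fin divr_ge0 ?powR_ge0// ltW.
  rewrite -muE -[leLHS]mul1e -(integral_cst mu mE 1%E).
  apply: ge0_le_integral => //.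
  - apply: emeasurable_funD; apply: measurable_funeM; apply: measurable_fun_EFin; exact: measurable_fun_powR.
  - by move=> x _; rewrite -!EFinM -EFinD lee_fin.
rewrite lee_fin => le_e.
have kp : k `^ p = (U / V) `^ q^-1.
  by rewrite /k -powRrM; congr (_ `^ _); field; rewrite !gt_eqF.
have kq : k `^ (- q) = (U / V) `^ (- p^-1).
  by rewrite /k -powRrM; congr (_ `^ _); field; rewrite !gt_eqF.
have qE : q^-1 = 1 - p^-1 by move: pq; lra.
have kpV : k `^ p * V = V `^ p^-1 * U `^ q^-1.
  rewrite kp powRM ?invr_ge0 ?ltW// -[in LHS](powR_inv1 (ltW V0)) -powRrM mulN1r.
  rewrite -[X in _ * X](powRr1 (ltW V0)) -mulrA -powRD; last by rewrite (gt_eqF V0) implybT.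
  by rewrite qE opprB subrK mulrC.
have kqU : k `^ (- q) * U = V `^ p^-1 * U `^ q^-1.
  rewrite kq powRM ?invr_ge0 ?ltW// -[in LHS](powR_inv1 (ltW V0)) -powRrM mulN1r opprK.
  rewrite -[X in _ * X](powRr1 (ltW U0)) mulrAC -powRD; last by rewrite (gt_eqF U0) implybT.
  by rewrite qE addrC mulrC.
have {}le_e : e <= V `^ p^-1 * U `^ q^-1.
  apply: le_trans le_e _.
  rewrite -!(mulrAC _ _ _^-1) kpV kqU -mulrDr pq mulr1//.
have -> : V `^ a^-1 * U `^ c^-1 = (V `^ p^-1 * U `^ q^-1) `^ th.
  rewrite powRM ?powR_ge0// -!powRrM; congr (_ `^ _ * _ `^ _); rewrite /p /q; field;
  by rewrite !gt_eqF.
by apply: ge0_ler_powR => //; rewrite ?nnegrE ?mulr_ge0 ?powR_ge0// ltW.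
Qed.

(** An A_infinity property. Dividing the bound of the class on the cube by Hoelder's inequality on
    [E] removes the dual factor, as the integral of [s^-c] over [E] is at most that over the
    cube. *)
Lemma dual_weight_ainfty a c s : 0 < a -> 0 < c -> dual_weight a c s ->
  exists2 K : R, 0 < K & forall x0 l (E : set Rd) (e V' V : R), 0 < l ->
    measurable E -> E `<=` cube x0 l -> 0 < e -> mu E = e%:E ->
    (\int[mu]_(x in E) (s x `^ a)%:E = V'%:E)%E ->
    (\int[mu]_(x in cube x0 l) (s x `^ a)%:E = V%:E)%E ->
    V <= K * (l ^+ d / e) `^ (a * (a^-1 + c^-1)) * V'.
Proof.
move=> a0 c0 [ms s0 [C C0 H]]; exists (C `^ a); first exact: powR_gt0.
move=> x0 l E e V' V l0 mE Ecube e0 muE hV' hV.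
have [W [U [W0 U0 hW hU hC]]] := H x0 l l0.
have WV : W = V by apply/eqP; rewrite -eqe -hW hV.
rewrite {W}WV in W0 hW hC.
have E0 : (0 < mu E)%E by rewrite muE lte_fin.
have V'0 : 0 < V' by rewrite -lte_fin -hV'; exact: integral_powR_gt0.
have mC : measurable (cube x0 l) by exact: measurable_cube.
have UE_le : (\int[mu]_(x in E) (s x `^ (- c))%:E <= U%:E)%E.
  rewrite -hU; apply: ge0_subset_integral => //.
  - by apply: measurable_fun_EFin; exact: measurable_fun_powR.
  - by move=> x _; rewrite lee_fin powR_ge0.
have UE_ge := integral_powR_gt0 (- c) mE ms s0 E0.
pose U' := fine (\int[mu]_(x in E) (s x `^ (- c))%:E)%E.
have hU' : (\int[mu]_(x in E) (s x `^ (- c))%:E = U'%:E)%E.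
  by rewrite fineK// ge0_fin_numE ?ltW// (le_lt_trans UE_le)// ltry.
rewrite hU' lee_fin in UE_le; rewrite hU' lte_fin in UE_ge.
have hold := dual_weight_holder a0 c0 ms s0 mE e0 muE hV' hU'.
set th := a^-1 + c^-1 in hC hold *.
have l0' : 0 < l ^+ d by rewrite exprn_gt0.
have : V `^ a^-1 <= C * (l ^+ d / e) `^ th * V' `^ a^-1.
  have eth : 0 < e `^ th by exact: powR_gt0.
  have -> : (l ^+ d / e) `^ th = (l ^+ d) `^ th / e `^ th.
    by rewrite powRM ?invr_ge0 ?ltW// -(powR_inv1 (ltW e0)) -powRrM mulN1r powRN.
  have -> : C * ((l ^+ d) `^ th / e `^ th) * V' `^ a^-1 =
            C * (l ^+ d) `^ th * V' `^ a^-1 / e `^ th by ring.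
  rewrite ler_pdivlMr//.
  have Uc : 0 < U `^ c^-1 by exact: powR_gt0.
  rewrite -(ler_pM2r Uc) mulrAC -[leRHS]mulrA.
  apply: ler_pM; rewrite ?mulr_ge0 ?powR_ge0// (le_trans hold)//.
  rewrite ler_wpM2l ?powR_ge0//.
  by apply: ge0_ler_powR; rewrite ?nnegrE ?invr_ge0 ?(ltW c0) ?(ltW U0) ?(ltW UE_ge).
have : 0 <= l ^+ d / e by rewrite divr_ge0// ltW.
move: (l ^+ d / e) => Y Y0.
move=> /(@ge0_ler_powR R a (ltW a0)); rewrite !nnegrE !mulr_ge0 ?powR_ge0 ?(ltW C0)//.
move=> /(_ isT isT); rewrite (powRM _ (mulr_ge0 (ltW C0) (powR_ge0 _ _)))// ?powR_ge0//.
rewrite powRM ?powR_ge0 ?(ltW C0)// -!powRrM !mulVf ?gt_eqF// !powRr1 ?(ltW W0) ?(ltW V'0)//.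
by rewrite (mulrC a).
Qed.

Lemma dual_weight_cube a c s : dual_weight a c s -> forall x0 l, 0 < l ->
  exists2 V : R, 0 < V & (\int[mu]_(x in cube x0 l) (s x `^ a)%:E = V%:E)%E.
Proof. by move=> [_ _ [C _ H]] x0 l /(H x0)[V [U [V0 _ hV _ _]]]; exists V. Qed.

(** A cube fills the fraction [6^-d] of its dilate, so the A_infinity comparison applies to it. *)
Lemma dual_weight_doubling a c s : 0 < a -> 0 < c -> dual_weight a c s ->
  exists2 D : R, 1 <= D & forall x0 l, 0 < l ->
    (\int[mu]_(x in cube (shift x0 (- 2 * l)) (6 * l)) (s x `^ a)%:E <=
     D%:E * \int[mu]_(x in cube x0 l) (s x `^ a)%:E)%E.
Proof.
move=> a0 c0 ws; have [K K0 H] := dual_weight_ainfty a0 c0 ws.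
pose D := Num.max 1 (K * (6 ^+ d) `^ (a * (a^-1 + c^-1))).
exists D => [|x0 l l0]; first by rewrite le_max lexx.
have l60 : 0 < 6 * l by rewrite mulr_gt0.
have [V V0 hV] := dual_weight_cube ws x0 l0.
have [W W0 hW] := dual_weight_cube ws (shift x0 (- 2 * l)) l60.
rewrite hV hW -EFinM lee_fin.
have ld : 0 < l ^+ d by rewrite exprn_gt0.
apply: le_trans (H _ _ _ _ _ _ l60 (measurable_cube _ _) _ ld
  (lebesgue_cube _ hmu (ltW l0)) hV hW) _.
  by apply: cube_shiftS; lra.
rewrite ler_wpM2r ?(ltW V0)// exprMn mulfK ?gt_eqF//.
by rewrite /D le_max lexx orbT.
Qed.

(** The shell between [centered r] and [centered (2 r)] fills at least half of the larger cube,
    hence carries at least a fixed fraction [k] of its mass. So each doubling of [r >= 1] adds at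
    least [k V 1]. *)
Lemma dual_weight_infty a c s : (0 < d)%N -> 0 < a -> 0 < c -> dual_weight a c s ->
  forall K : R, exists n : nat,
    (K%:E <= \int[mu]_(x in centered n%:R) (s x `^ a)%:E)%E.
Proof.
move=> hd a0 c0 ws K; have [B B0 H] := dual_weight_ainfty a0 c0 ws.
have [ms s0 _] := ws.
have msa := measurable_fun_powR a ms.
pose V r := fine (\int[mu]_(x in centered r) (s x `^ a)%:E)%E.
have hV r : 0 < r -> (\int[mu]_(x in centered r) (s x `^ a)%:E)%E = (V r)%:E.
  move=> r0; have r20 : 0 < 2 * r by rewrite mulr_gt0.
  have [W _ hW] := dual_weight_cube ws [tuple - r | i < d] r20.
  by rewrite fineK// /centered hW.
have V0 r : 0 < r -> 0 < V r.
  move=> r0; have r20 : 0 < 2 * r by rewrite mulr_gt0.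
  have [W W0 hW] := dual_weight_cube ws [tuple - r | i < d] r20.
  by rewrite /V /centered hW.
have Vle r t : 0 < r -> r <= t -> V r <= V t.
  move=> r0 rt; have t0 := lt_le_trans r0 rt.
  rewrite -lee_fin -!hV//; apply: ge0_subset_integral => //; try exact: measurable_centered.
  - exact: measurable_fun_EFin.
  - by move=> x _; rewrite lee_fin powR_ge0.
  - exact: centeredS.
pose k := (B * 2 `^ (a * (a^-1 + c^-1)))^-1.
have k0 : 0 < k by rewrite invr_gt0 mulr_gt0// powR_gt0.
have grow r : 0 < r -> V r + k * V (2 * r) <= V (2 * r).
  move=> r0; have r20 : 0 < 2 * r by rewrite mulr_gt0.
  have r40 : 0 < 2 * (2 * r) by rewrite mulr_gt0.
  pose E : set Rd := centered (2 * r) `\` centered r.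
  have mE : measurable E by apply: measurableD; exact: measurable_centered.
  have sub : centered r `<=` (centered (2 * r) : set Rd) by apply: centeredS; lra.
  pose e := (2 * (2 * r)) ^+ d - (2 * r) ^+ d.
  have muc t : 0 < t -> mu (centered t) = ((2 * t) ^+ d)%:E.
    by move=> t0; apply: lebesgue_cube => //; rewrite mulr_ge0// ltW.
  have muE : mu E = e%:E.
    rewrite /E measureD; [|exact: measurable_centered|exact: measurable_centered|].
      by rewrite setIidr// [X in (X - _)%E](muc _ r20) [X in (_ - X)%E](muc _ r0).
    by rewrite [X in (X < _)%E](muc _ r20) ltry.
  (* This rests on [0 < d]: doubling the side must at least double the volume. *)
  have e2 : (2 * (2 * r)) ^+ d <= 2 * e.
    have : 2 * (2 * r) ^+ d <= (2 * (2 * r)) ^+ d.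
      rewrite (exprMn _ _ (2 * r)) ler_wpM2r ?exprn_ge0 ?(ltW r20)//.
      by rewrite -[leLHS]expr1 ler_weXn2l// ler1n.
    by rewrite /e; lra.
  have e0 : 0 < e.
    by rewrite -(pmulr_rgt0 _ (ltr0n R 2)) (lt_le_trans _ e2)// exprn_gt0.
  have hE : (\int[mu]_(x in E) (s x `^ a)%:E = (V (2 * r) - V r)%:E)%E.
    apply/eqP; rewrite EFinB eq_sym; rewrite sube_eq ?fin_num_adde_defl//.
    rewrite -!hV// -ge0_integral_setU//; try exact: measurable_centered.
    - by rewrite /E setUC setDUK.
    - exact: measurable_fun_EFin.
    - by move=> x _; rewrite lee_fin powR_ge0.
    - by rewrite disj_set2E /E setDE -setIA (setIC (~` _)) setICr setI0.
  have := H _ _ E _ _ _ r40 mE (@subDsetl _ _ _) e0 muE hE (hV _ r20).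
  have : ((2 * (2 * r)) ^+ d / e) `^ (a * (a^-1 + c^-1)) <= 2 `^ (a * (a^-1 + c^-1)).
    apply: ge0_ler_powR; rewrite ?nnegrE//.
    - by rewrite mulr_ge0 ?addr_ge0 ?invr_ge0 ?(ltW a0) ?(ltW c0).
    - by rewrite divr_ge0 ?exprn_ge0 ?(ltW r40) ?(ltW e0).
    - by rewrite ler_pdivrMr.
  have dV : 0 <= V (2 * r) - V r by rewrite subr_ge0 Vle//; lra.
  move=> le2 leV.
  have : V (2 * r) <= k^-1 * (V (2 * r) - V r).
    apply: le_trans leV _; rewrite /k invrK; apply: ler_wpM2r => //.
    by rewrite ler_pM2l.
  by rewrite ler_pdivlMl//; lra.
have growth n : n%:R * (k * V 1) <= V (2 ^+ n).
  elim: n => [|n IH]; first by rewrite mul0r expr0 ltW// V0.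
  rewrite exprS; apply: le_trans (grow _ _); last by rewrite exprn_gt0.
  rewrite -natr1 mulrDl mul1r lerD// ler_pM2l//.
  by apply: Vle => //; rewrite -exprS exprn_ege1// ler1n.
have kV : 0 < k * V 1 by rewrite mulr_gt0// V0.
pose N := Num.bound (`|K| / (k * V 1)).
exists (2 ^ N)%N; rewrite natrX hV ?exprn_gt0// lee_fin.
apply: le_trans (growth N); rewrite -ler_pdivrMr//.
apply: le_trans (_ : `|K| / (k * V 1) <= _).
  by rewrite ler_pM2r ?invr_gt0// ler_norm.
by rewrite ltW// archi_boundP// divr_ge0// ltW.
Qed.

(** The integral of [b s^a] is at most [K inf b] times that of [s^a], while [b^(-c/a)] is at most
    [(inf b)^(-c/a)]; after the roots [1/a] and [1/c] the powers of [inf b] cancel. *)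
Lemma dual_weight_mul_A1 a c s (b : Rd -> R) (K : R) : 0 < a -> 0 < c ->
  dual_weight a c s -> measurable_fun setT b -> (forall x, 0 < b x) -> 0 < K ->
  {ae mu, forall x, forall x0 l, 0 < l -> cube x0 l x ->
    (\int[mu]_(y in cube x0 l) (b y * s y `^ a)%:E <=
     (K * b x)%:E * \int[mu]_(y in cube x0 l) (s y `^ a)%:E)%E} ->
  dual_weight a c (fun x => s x * b x `^ a^-1).
Proof.
move=> a0 c0 [ms s0 [C C0 H]] mb b0 K0 hA.
have mba := measurable_fun_powR a^-1 mb.
split; first exact: measurable_funM.
  by move=> x; rewrite mulr_gt0// powR_gt0.
exists (K `^ a^-1 * C); first by rewrite mulr_gt0// powR_gt0.
move=> x0 l l0; have [V [U [V0 U0 hV hU hC]]] := H x0 l l0.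
have mC : measurable (cube x0 l) by exact: measurable_cube.
have muC : (0 < mu (cube x0 l))%E.
  by rewrite (lebesgue_cube _ hmu) ?ltW// lte_fin exprn_gt0.
have sbE x : (s x * b x `^ a^-1) `^ a = b x * s x `^ a.
  by rewrite powRM ?powR_ge0 ?(ltW (s0 x))// -powRrM mulVf ?gt_eqF// powRr1 ?(ltW (b0 x))// mulrC.
have sbE' x : (s x * b x `^ a^-1) `^ (- c) = s x `^ (- c) * b x `^ (- (c / a)).
  by rewrite powRM ?powR_ge0 ?(ltW (s0 x))// -powRrM mulrN (mulrC a^-1).
have msb : measurable_fun setT (fun x => b x * s x `^ a).
  by apply: measurable_funM => //; exact: measurable_fun_powR.
pose I := (\int[mu]_(y in cube x0 l) (b y * s y `^ a)%:E)%E.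
have I0 : (0 < I)%E.
  rewrite lt_neqAle integral_ge0 ?andbT; last first.
    by move=> x _; rewrite lee_fin mulr_ge0 ?powR_ge0// ltW.
  apply/eqP => h; move: muC.
  rewrite (@density_eq0 _ _ _ mu (fun x => b x * s x `^ a)) ?ltxx//.
  by move=> x; rewrite mulr_gt0// powR_gt0.
have [x [Cx hx]] : exists x, cube x0 l x /\ forall x0 l, 0 < l -> cube x0 l x ->
    (\int[mu]_(y in cube x0 l) (b y * s y `^ a)%:E <=
     (K * b x)%:E * \int[mu]_(y in cube x0 l) (s y `^ a)%:E)%E.
  apply: contrapT => /forallNP h; case: hA => N [mN N0 hN].
  move: muC; rewrite (subset_measure0 mC mN _ N0) ?ltxx// => x Cx.
  by apply: hN => /= hx; apply: (h x).
have Ifin : (I < +oo)%E.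
  by apply: le_lt_trans (hx _ _ l0 Cx) _; rewrite hV -EFinM ltry.
pose W := fine I; have IW : I = W%:E by rewrite fineK// ge0_fin_numE// ltW.
have W0 : 0 < W by rewrite -lte_fin -IW.
(* [q] plays the part of the infimum of [b] on the cube: the hypothesis, read at almost every point
   of the cube, says [q <= b]. *)
pose q := W / (K * V); have q0 : 0 < q by rewrite divr_gt0// mulr_gt0.
have qb : {ae mu, forall x, cube x0 l x -> q <= b x}.
  case: hA => N [mN N0 hN]; exists N; split => // y /= /not_implyP[Cy /negP qy].
  apply: hN => /= /(_ x0 l l0 Cy); rewrite -/I IW hV -EFinM lee_fin => h.
  by move: qy; rewrite /q ler_pdivrMr ?mulr_gt0// mulrCA mulrA h.
have mneg : measurable_fun setT (fun x => s x `^ (- c) * b x `^ (- (c / a))).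
  by apply: measurable_funM; exact: measurable_fun_powR.
have Ule : (\int[mu]_(y in cube x0 l) (s y `^ (- c) * b y `^ (- (c / a)))%:E <=
    (U * q `^ (- (c / a)))%:E)%E.
  rewrite EFinM -hU -ge0_integralZr; last 4 first.
  - exact: mC.
  - by apply: measurable_fun_EFin; exact: measurable_fun_powR.
  - by move=> y _; rewrite lee_fin powR_ge0.
  - by rewrite lee_fin powR_ge0.
  apply: ae_ge0_le_integral => //.
  - by move=> y _; rewrite lee_fin mulr_ge0 ?powR_ge0.
  - exact: measurable_fun_EFin.
  - by move=> y _; rewrite -EFinM lee_fin mulr_ge0 ?powR_ge0.
  - apply: measurable_fun_EFin; apply: measurable_funM => //; exact: measurable_fun_powR.
  case: qb => N [mN N0 hN]; exists N; split => // y /= /not_implyP[Cy /negP h].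
  apply: hN => /= /(_ Cy) qy; move: h; rewrite -EFinM lee_fin => /negP; apply.
  rewrite ler_wpM2l ?powR_ge0// !powRN lef_pV2 ?posrE ?powR_gt0//.
  by apply: ge0_ler_powR; rewrite ?nnegrE ?(ltW q0) ?(ltW (b0 y)) ?divr_ge0 ?(ltW a0) ?(ltW c0).
have Upos : (0 < \int[mu]_(y in cube x0 l) (s y `^ (- c) * b y `^ (- (c / a)))%:E)%E.
  rewrite lt_neqAle integral_ge0 ?andbT; last first.
    by move=> y _; rewrite lee_fin mulr_ge0 ?powR_ge0.
  apply/eqP => h; move: muC.
  rewrite (@density_eq0 _ _ _ mu (fun y => s y `^ (- c) * b y `^ (- (c / a)))) ?ltxx//.
  by move=> y; rewrite mulr_gt0 ?powR_gt0.
pose Z := fine (\int[mu]_(y in cube x0 l) (s y `^ (- c) * b y `^ (- (c / a)))%:E)%E.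
have hZ : (\int[mu]_(y in cube x0 l) (s y `^ (- c) * b y `^ (- (c / a)))%:E = Z%:E)%E.
  apply/esym/fineK; rewrite ge0_fin_numE; last exact: ltW Upos.
  exact: (le_lt_trans Ule (ltry _)).
have Z0 : 0 < Z by rewrite -lte_fin -hZ.
exists W, Z; split; [exact: W0|exact: Z0| | |].
- by rewrite -IW; apply: eq_integral => y _; rewrite sbE.
- by rewrite -hZ; apply: eq_integral => y _; rewrite sbE'.
rewrite hZ lee_fin in Ule; rewrite hZ lte_fin in Upos.
apply: (@le_trans _ _ (W `^ a^-1 * (U * q `^ (- (c / a))) `^ c^-1)).
  rewrite ler_wpM2l ?powR_ge0//.
  by apply: ge0_ler_powR; rewrite ?nnegrE ?invr_ge0 ?mulr_ge0 ?powR_ge0 ?(ltW c0) ?(ltW U0) ?(ltW Upos).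
have -> : W `^ a^-1 * (U * q `^ (- (c / a))) `^ c^-1 = K `^ a^-1 * (V `^ a^-1 * U `^ c^-1).
  rewrite powRM ?powR_ge0 ?(ltW U0)// -powRrM.
  have -> : - (c / a) * c^-1 = - a^-1 by field; rewrite !gt_eqF.
  have -> : W `^ a^-1 = q `^ a^-1 * (K `^ a^-1 * V `^ a^-1).
    rewrite -(powRM _ (ltW K0) (ltW V0)) -(powRM _ (ltW q0) (mulr_ge0 (ltW K0) (ltW V0))).
    by rewrite /q divfK// gt_eqF// mulr_gt0.
  by rewrite powRN; field; rewrite gt_eqF// powR_gt0.
by rewrite -mulrA; apply: ler_wpM2l => //; exact: powR_ge0.
Qed.

Lemma dual_weight_A1_exists a c s (g : Rd -> R) : 0 < a -> 0 < c ->
  dual_weight a c s -> measurable_fun setT g -> (forall x, 0 <= g x) ->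
  (forall x, centered 1 x -> 1 <= g x) ->
  (\int[mu]_x (g x * s x `^ a)%:E < +oo)%E ->
  exists b : Rd -> R, [/\ (forall x, 0 < b x), (forall x, g x <= b x ^+ 2),
    dual_weight a c (fun x => s x * b x `^ a^-1) &
    forall x (e : R), 0 <= e -> g x = 0 ->
      (forall x0 l, 0 < l -> cube x0 l x ->
        (\int[mu]_(y in cube x0 l) (g y * s y `^ a)%:E <=
            e%:E * \int[mu]_(y in cube x0 l) (s y `^ a)%:E)%E) ->
      b x ^+ 2 <= e].
Proof.
move=> a0 c0 ws mg g0 g1 gfin; have [ms s0 _] := ws.
have [D D1 hD] := dual_weight_doubling a0 c0 ws.
have v0 x : 0 < s x `^ a by exact: powR_gt0.
have nupos x0 l : 0 < l -> (0 < \int[mu]_(x in cube x0 l) (s x `^ a)%:E)%E.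
  by move=> l0; have [V V0 ->] := dual_weight_cube ws x0 l0.
have nufin x0 l : (\int[mu]_(x in cube x0 l) (s x `^ a)%:E < +oo)%E.
  have l10 : 0 < Num.max l 1 by rewrite lt_max ltr01 orbT.
  have [V V0 hV] := dual_weight_cube ws x0 l10.
  apply: (@le_lt_trans _ _ V%:E); last exact: ltry.
  rewrite -hV; apply: ge0_subset_integral; try exact: measurable_cube.
  - by apply: measurable_fun_EFin; exact: measurable_fun_powR.
  - by move=> x _; rewrite lee_fin powR_ge0.
  move=> x Cx i; have /andP[-> /lt_le_trans] := Cx i; apply.
  by rewrite lerD2l le_max lexx.
have l20 : 0 < 2 * 1 :> R by rewrite mulr1.
have [b [mb b0 gb [K K0 hK] decay]] := @A1_weight_exists R d mu _ g D D1
  (measurable_fun_powR a ms) v0 mg g0 nufin nupos hD gfin _ _ l20 g1.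
exists b; split; [exact: b0|exact: gb| |exact: decay].
exact: dual_weight_mul_A1 K0 hK.
Qed.

(** Take for [g] the indicator of [centered 1]. A cube through a far point [x] that meets the
    support of [g] is large, and its dilate swallows some [centered n], whose mass is as large as
    desired. So the means of [g] over cubes through [x] are small, and [b x] with them. *)
Lemma dual_weight_decay a c s : (0 < d)%N -> 0 < a -> 0 < c -> dual_weight a c s ->
  exists2 s', dual_weight a c s' & forall e, 0 < e -> exists n : nat,
    forall x, ~ centered n%:R x -> s' x <= e * s x.
Proof.
move=> hd a0 c0 ws; have [ms s0 _] := ws.
pose g : Rd -> R := \1_(centered 1).
have mc1 : measurable (centered 1 : set Rd) by exact: measurable_centered.
have mg : measurable_fun setT g by exact: measurable_indic.
have l20 : 0 < 2 * 1 :> R by rewrite mulr1.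
have [V V0 hV] := dual_weight_cube ws [tuple - 1 | i < d] l20.
have gint (E : set Rd) : (\int[mu]_(x in E) (g x * s x `^ a)%:E =
    \int[mu]_(x in E `&` centered 1) (s x `^ a)%:E)%E.
  rewrite integral_mkcondr epatch_indic; apply: eq_integral => x _.
  by rewrite EFinM muleC.
have g0 x : 0 <= g x by rewrite /g indicE.
have [||b [b0 _ wb decay]] := dual_weight_A1_exists a0 c0 ws mg g0 _ _.
- by move=> x C1; rewrite /g indicE mem_set.
- by rewrite gint setTI /centered hV ltry.
exists (fun x => s x * b x `^ a^-1) => // e e0.
(* The square matches [b x ^+ 2], and the power [a] undoes the exponent [a^-1] put on [b]. *)
pose eps := (e `^ a) ^+ 2; have eps0 : 0 < eps by rewrite exprn_gt0// powR_gt0.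
have [D D1 hD] := dual_weight_doubling a0 c0 ws.
have D0 : 0 < D by exact: lt_le_trans D1.
have [n hn] := dual_weight_infty hd a0 c0 ws (D * V / eps).
(* Outside [centered n.+2], a cube through [x] that meets [centered 1] has side above [n + 1],
   enough for its dilate to contain [centered n]. *)
exists n.+2 => x xn; rewrite mulrC ler_wpM2r ?(ltW (s0 x))//.
have xg : g x = 0.
  rewrite /g indicE memNset// => x1; apply: xn; apply: centeredS x1.
  by rewrite ler1n.
have : b x ^+ 2 <= eps.
  apply: decay => //; first exact: ltW.
  move=> x0 l l0 Cx; rewrite gint.
  have [->|/eqP/set0P[y [Cy y1]]] := pselect (cube x0 l `&` centered 1 = set0).
    rewrite integral_set0 mule_ge0 ?lee_fin ?(ltW eps0)//.
    by apply: integral_ge0 => y _; rewrite lee_fin powR_ge0.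
  have ln : n%:R + 1 < l.
    move/centeredP: y1 => y1.
    have /existsNP[i xi] : ~ forall i, - n.+2%:R <= tnth x i < n.+2%:R.
      by move=> h; apply: xn; exact/centeredP.
    have := y1 i; have := Cx i; have := Cy i; move/negP: xi; rewrite negb_and -!ltNge.
    rewrite -[n.+2]addn2 natrD => /orP[]; lra.
  apply: (@le_trans _ _ V%:E).
    rewrite -hV; apply: ge0_subset_integral => //.
    - by apply: measurableI => //; exact: measurable_cube.
    - by apply: measurable_fun_EFin; exact: measurable_fun_powR.
    - by move=> z _; rewrite lee_fin powR_ge0.
  have [W W0 hW] := dual_weight_cube ws x0 l0.
  rewrite hW -EFinM lee_fin -ler_pdivrMl// mulrC -(ler_pM2l D0) mulrA.
  rewrite -lee_fin; apply: le_trans hn _; rewrite EFinM -hW.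
  apply: le_trans (hD x0 l l0).
  apply: ge0_subset_integral; try exact: measurable_cube.
  - by apply: measurable_fun_EFin; exact: measurable_fun_powR.
  - by move=> z _; rewrite lee_fin powR_ge0.
  move=> z /centeredP zn i; rewrite tnth_mktuple; have := zn i.
  by move/centeredP: y1 => /(_ i); have := Cy i; have : 0 <= n%:R :> R by []; lra.
rewrite /eps ler_pXn2r ?nnegrE ?powR_ge0 ?(ltW (b0 x))// => be.
have -> : e = (e `^ a) `^ a^-1 by rewrite -powRrM mulfV ?gt_eqF// powRr1// ltW.
by apply: ge0_ler_powR; rewrite ?nnegrE ?invr_ge0 ?powR_ge0 ?(ltW a0) ?(ltW (b0 x)).
Qed.

(** Absolute continuity yields sets [E (j k)] so light that [G], the sum of [4^k] times their
    indicators, is integrable against [s^a]; then [b^2 >= g] gives [b >= 2^k] almost everywhere on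
    [E (j k)]. *)
Lemma dual_weight_blowup a c s (N : nat) (E : nat -> set Rd) : 0 < a -> 0 < c ->
  dual_weight a c s -> (forall m, measurable (E m)) ->
  (forall m, E m `<=` centered N%:R) ->
  (forall k, 0 < k -> exists m, (mu (E m) <= k%:E)%E) ->
  exists2 s', dual_weight a c s' & forall K, exists m,
    {ae mu, forall x, E m x -> K * s x <= s' x}.
Proof.
move=> a0 c0 ws mE EN smallE; have [ms s0 _] := ws.
have msa := measurable_fun_powR a ms.
have [V V0 hV] : exists2 V : R, 0 < V &
    (\int[mu]_(x in centered N%:R) (s x `^ a)%:E <= V%:E)%E.
  have N0 : 0 < 2 * N.+1%:R :> R by rewrite mulr_gt0.
  have [V V0 hV] := dual_weight_cube ws [tuple - N.+1%:R | i < d] N0.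
  exists V => //; rewrite -hV; apply: ge0_subset_integral; try exact: measurable_cube.
  - exact: measurable_fun_EFin.
  - by move=> x _; rewrite lee_fin powR_ge0.
  - by apply: centeredS; rewrite ler_nat.
have [j hj] : {j : nat -> nat & forall k,
    (\int[mu]_(x in E (j k)) (s x `^ a)%:E <= ((4 ^+ k)^-1 / 2 ^+ k.+1)%:E)%E}.
  apply: (@choice _ _ (fun k m => (\int[mu]_(x in E m) (s x `^ a)%:E <=
     ((4 ^+ k)^-1 / 2 ^+ k.+1)%:E)%E)) => k.
  have k0 : 0 < (4 ^+ k)^-1 / 2 ^+ k.+1 :> R by rewrite divr_gt0 ?invr_gt0 ?exprn_gt0.
  have Vfin : (\int[mu]_(x in centered N%:R) (s x `^ a)%:E < +oo)%E.
    by rewrite (le_lt_trans hV)// ltry.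
  have [t t0 ht] := integral_abs_cont (measurable_centered N%:R) msa
    (fun x => powR_ge0 (s x) a) Vfin k0.
  by have [m hm] := smallE t t0; exists m; exact: ht.
pose G x : \bar R := (\sum_(k <oo) (4 ^+ k * \1_(E (j k)) x)%:E)%E.
have G0 x : (0 <= G x)%E.
  by apply: nneseries_ge0 => k _ _; rewrite lee_fin mulr_ge0 ?exprn_ge0.
have mG : measurable_fun setT G.
  apply: ge0_emeasurable_sum => k.
    by move=> x _ _; rewrite lee_fin mulr_ge0 ?exprn_ge0.
  by move=> _; apply: measurable_fun_EFin; apply: measurable_funM => //; exact: measurable_indic.
have GsE : (\int[mu]_x (G x * (s x `^ a)%:E) <= 1%:E)%E.
  have -> : (\int[mu]_x (G x * (s x `^ a)%:E) =
      \int[mu]_x (\sum_(k <oo) (4 ^+ k * \1_(E (j k)) x * s x `^ a)%:E))%E.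
    apply: eq_integral => x _; rewrite /G muleC -nneseriesZl//.
    by apply: eq_eseriesr => k _; rewrite -EFinM mulrC.
  rewrite integral_nneseries//; last 2 first.
  - move=> k; apply: measurable_fun_EFin; apply: measurable_funM => //.
    by apply: measurable_funM => //; exact: measurable_indic.
  - by move=> k x _; rewrite lee_fin !mulr_ge0 ?exprn_ge0 ?powR_ge0.
  apply: le_trans (epsilon_trick0 xpredT (@ler01 R)); apply: lee_nneseries => [k _ _|k _].
    by apply: integral_ge0 => x _; rewrite lee_fin !mulr_ge0 ?exprn_ge0 ?powR_ge0.
  under eq_integral do rewrite -mulrA EFinM.
  rewrite ge0_integralZl//; last 2 first.
  - by apply: measurable_fun_EFin; apply: measurable_funM => //; exact: measurable_indic.
  - by move=> x _; rewrite lee_fin mulr_ge0 ?powR_ge0.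
  have -> : (\int[mu]_x (\1_(E (j k)) x * s x `^ a)%:E =
             \int[mu]_(x in E (j k)) (s x `^ a)%:E)%E.
    rewrite -[in RHS](setTI (E (j k))) integral_mkcondr epatch_indic.
    by apply: eq_integral => x _; rewrite EFinM muleC.
  apply: le_trans (lee_wpmul2l _ (hj k)) _; first by rewrite lee_fin exprn_ge0.
  by rewrite -EFinM lee_fin mulrA divff ?gt_eqF ?exprn_gt0// natrX.
(* The indicator provides the cube where [g >= 1] that the maximal construction asks for; [fine]
   changes [G] only where it is infinite, which is a null set. *)
pose g x := \1_(centered 1) x + fine (G x).
have mc1 : measurable (centered 1 : set Rd) by exact: measurable_centered.
have mfG : measurable_fun setT (fine \o G).
  exact: measurableT_comp (fine_measurable measurableT) mG.
have mg : measurable_fun setT g.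
  by apply: measurable_funD => //; exact: measurable_indic.
have fG0 x : 0 <= fine (G x) by exact: fine_ge0.
have g0 x : 0 <= g x by rewrite addr_ge0.
have [||b [b0 gb wb _]] := dual_weight_A1_exists a0 c0 ws mg g0 _ _.
- by move=> x C1; rewrite /g indicE mem_set// lerDl.
- have l20 : 0 < 2 * 1 :> R by rewrite mulr1.
  have [W W0 hW] := dual_weight_cube ws [tuple - 1 | i < d] l20.
  apply: (@le_lt_trans _ _ (W%:E + 1%:E)%E); last by rewrite -EFinD ltry.
  have -> : (\int[mu]_x (g x * s x `^ a)%:E = \int[mu]_x ((\1_(centered 1) x * s x `^ a)%:E
      + (fine (G x) * s x `^ a)%:E))%E.
    by apply: eq_integral => x _; rewrite -EFinD mulrDl.
  rewrite ge0_integralD//; last 4 first.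
  - by move=> x _; rewrite lee_fin mulr_ge0 ?powR_ge0.
  - by apply: measurable_fun_EFin; apply: measurable_funM => //; exact: measurable_indic.
  - by move=> x _; rewrite lee_fin mulr_ge0 ?powR_ge0.
  - by apply: measurable_fun_EFin; apply: measurable_funM.
  apply: leeD.
    rewrite -hW -/(centered 1) -[in leRHS](setTI (centered 1)) integral_mkcondr epatch_indic.
    rewrite le_eqVlt; apply/orP; left; apply/eqP; apply: eq_integral => x _.
    by rewrite EFinM muleC.
  apply: le_trans GsE; apply: ge0_le_integral => //.
  - by move=> x _; rewrite lee_fin mulr_ge0 ?powR_ge0.
  - by apply: measurable_fun_EFin; apply: measurable_funM.
  - by apply: emeasurable_funM => //; exact: measurable_fun_EFin.
  - move=> x _; rewrite EFinM; apply: lee_wpmul2r; first by rewrite lee_fin powR_ge0.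
    by have := G0 x; case: (G x) => //= *; rewrite leey.
exists (fun x => s x * b x `^ a^-1) => // K.
have Gfin : {ae mu, forall x, (G x < +oo)%E}.
  have mGs : measurable_fun setT (fun x => (G x * (s x `^ a)%:E)%E).
    by apply: emeasurable_funM => //; exact: measurable_fun_EFin.
  have Gs0 x : (0 <= G x * (s x `^ a)%:E)%E by rewrite mule_ge0// lee_fin powR_ge0.
  have Gi : mu.-integrable setT (fun x => (G x * (s x `^ a)%:E)%E).
    apply/integrableP; split => //.
    under eq_integral do rewrite gee0_abs//.
    by rewrite (le_lt_trans GsE)// ltry.
  case: (integrable_ae measurableT Gi) => A [mA A0 hA]; exists A; split => // x /= Gx.
  apply: hA => /= /(_ I); have := G0 x; move: Gx; case: (G x) => [r|_ _|//].
    by rewrite ltry.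
  by rewrite gt0_mulye// lte_fin powR_gt0.
(* As [s' = s b^(1/a)], gaining a factor [K] takes [b >= |K|^a]. *)
have [k Kk] : exists k : nat, `|K| `^ a <= 2 ^+ k.
  exists (Num.bound (`|K| `^ a)).
  by rewrite (le_trans (ltW (archi_boundP (powR_ge0 _ _))))// -natrX ler_nat ltnW// ltn_expl.
exists (j k); case: Gfin => A [mA A0 hA]; exists A; split => // x /= /not_implyP[Ex].
move=> hx; apply: hA => /= Gx; apply: hx.
have Gk : 4 ^+ k <= fine (G x).
  rewrite -lee_fin fineK ?ge0_fin_numE//.
  apply: le_trans (nneseries_lim_ge k.+1 _); last first.
    by move=> i _ _; rewrite lee_fin mulr_ge0 ?exprn_ge0.
  rewrite big_nat_recr//= indicE mem_set// mulr1 leeDr// sume_ge0//.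
have bk : 2 ^+ k <= b x.
  rewrite -(@ler_pXn2r _ 2)// ?nnegrE ?exprn_ge0 ?(ltW (b0 x))//.
  apply: le_trans (gb x); rewrite exprAC -[2 ^+ 2]natrX.
  by rewrite (le_trans Gk)// /g lerDr.
rewrite mulrC ler_wpM2l ?(ltW (s0 x))// (le_trans (ler_norm K))//.
have -> : `|K| = (`|K| `^ a) `^ a^-1 by rewrite -powRrM mulfV ?gt_eqF// powRr1.
apply: ge0_ler_powR; rewrite ?nnegrE ?invr_ge0 ?powR_ge0 ?(ltW a0) ?(ltW (b0 x))//.
exact: le_trans bk.
Qed.

End muckenhoupt.

(** * From [Apq] to [dual_weight] and back *)

Section Apq_dual_weight.
Context {R : realType} {d : nat}.
Local Notation Rd := (d.-tuple R).
Variable mu : {measure set Rd -> \bar R}.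
Hypothesis hmu : is_lebesgue_measure mu.

Lemma conj_exp_gt0 (p : R) : 1 < p -> 0 < conj_exp p.
Proof. by move=> p1; rewrite divr_gt0 ?subr_gt0// (lt_trans ltr01). Qed.

Lemma inv_conj_exp (p : R) : 1 < p -> (conj_exp p)^-1 = 1 - p^-1.
Proof.
move=> p1; rewrite /conj_exp; field.
by rewrite subr_eq0 !gt_eqF// (lt_trans ltr01).
Qed.

Lemma avg_cube x0 l (g : Rd -> R) : 0 < l ->
  avg mu (cube x0 l) g = ((l ^+ d)^-1%:E * \int[mu]_(x in cube x0 l) (g x)%:E)%E.
Proof. by move=> l0; rewrite /avg (lebesgue_cube _ hmu) ?ltW. Qed.

Lemma poweR_avg (L V r : R) : 0 < L -> 0 < V ->
  poweR ((L^-1)%:E * V%:E)%E r = (V `^ r / L `^ r)%:E.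
Proof.
move=> L0 V0; rewrite -EFinM poweR_EFin mulrC powRM ?invr_ge0 ?(ltW L0) ?(ltW V0)//.
by rewrite -(powR_inv1 (ltW L0)) -powRrM mulN1r powRN.
Qed.

(** Two positive averages whose product is bounded by a real number are both finite, since infinity
    times a positive number is infinite. The maximum with 1 makes the constant positive. *)
Lemma dual_weight_Apq (p q : R) (w : Rd -> R) : 1 < p -> 1 < q ->
  (forall x, 0 < w x) -> Apq mu p q w -> dual_weight mu q (conj_exp p) w.
Proof.
move=> p1 q1 w0 [mw _ [C hC]]; split => //.
have q0 : 0 < q by rewrite (lt_trans ltr01).
have c0 := conj_exp_gt0 p1.
exists (Num.max C 1) => [|x0 l l0]; first by rewrite lt_max ltr01 orbT.
have mC : measurable (cube x0 l) by exact: measurable_cube.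
have muC : (0 < mu (cube x0 l))%E.
  by rewrite (lebesgue_cube _ hmu) ?ltW// lte_fin exprn_gt0.
have L0 : 0 < l ^+ d by rewrite exprn_gt0.
have := hC _ (is_cube_cube x0 l0); rewrite !avg_cube//.
have := integral_powR_gt0 q mC mw w0 muC.
have := integral_powR_gt0 (- conj_exp p) mC mw w0 muC.
set I1 := (\int[mu]_(x in _) (w x `^ q)%:E)%E.
set I2 := (\int[mu]_(x in _) (w x `^ (- conj_exp p))%:E)%E.
move=> I2_gt0 I1_gt0 hle.
have Li : (0 < ((l ^+ d)^-1)%:E)%E by rewrite lte_fin invr_gt0.
have pos I r : (0 < I)%E -> (0 < poweR (((l ^+ d)^-1)%:E * I) r)%E.
  by move=> I0; rewrite poweR_gt0// mule_gt0.
have top r : 0 < r -> poweR (((l ^+ d)^-1)%:E * +oo)%E r = +oo%E.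
  by move=> r0; rewrite gt0_muley// poweRyr// gt_eqF.
have fI1 : I1 \is a fin_num.
  rewrite ge0_fin_numE ?(ltW I1_gt0)// ltNge leye_eq; apply/eqP => I1y.
  move: hle; rewrite I1y top ?invr_gt0// gt0_mulye ?pos//.
have fI2 : I2 \is a fin_num.
  rewrite ge0_fin_numE ?(ltW I2_gt0)// ltNge leye_eq; apply/eqP => I2y.
  move: hle; rewrite I2y top ?invr_gt0// gt0_muley ?pos//.
have [W hW] : exists W, I1 = W%:E by exists (fine I1); rewrite (fineK fI1).
have [U hU] : exists U, I2 = U%:E by exists (fine I2); rewrite (fineK fI2).
rewrite hW lte_fin in I1_gt0; rewrite hU lte_fin in I2_gt0.
exists W, U; split; [exact: I1_gt0|exact: I2_gt0|exact: hW|exact: hU|].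
move: hle; rewrite hW hU (poweR_avg _ L0 I1_gt0) (poweR_avg _ L0 I2_gt0) -EFinM lee_fin.
move=> hle.
rewrite powRD; last by rewrite (gt_eqF L0) implybT.
have Lq : 0 < (l ^+ d) `^ q^-1 * (l ^+ d) `^ (conj_exp p)^-1 by rewrite mulr_gt0 ?powR_gt0.
move: hle; rewrite mulrACA -invfM ler_pdivrMr// => /le_trans; apply.
by apply: ler_wpM2r; [exact: ltW Lq|rewrite le_max lexx].
Qed.

Lemma Apq_dual_weight (p q : R) (w : Rd -> R) : 1 < p -> 1 < q ->
  dual_weight mu q (conj_exp p) w -> Apq mu p q w.
Proof.
move=> p1 q1 [mw w0 [C C0 hC]]; split => //; first exact: aeW.
exists C => _ [x0 [l [l0 ->]]]; rewrite -/(cube x0 l) !avg_cube//.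
have [V [U [V0 U0 hV hU hVU]]] := hC x0 l l0.
have L0 : 0 < l ^+ d by rewrite exprn_gt0.
rewrite hV hU !poweR_avg// -EFinM lee_fin mulrACA -invfM.
have Lq : 0 < (l ^+ d) `^ q^-1 * (l ^+ d) `^ (conj_exp p)^-1 by rewrite mulr_gt0 ?powR_gt0.
by rewrite ler_pdivrMr// -powRD// (gt_eqF L0) implybT.
Qed.

Lemma dual_weight_cst1 (a c : R) : dual_weight mu a c (fun=> 1).
Proof.
split => //; exists 1 => // x0 l l0; have L0 : 0 < l ^+ d by rewrite exprn_gt0.
exists (l ^+ d), (l ^+ d).
have I1 r : (\int[mu]_(x in cube x0 l) (1 `^ r)%:E = (l ^+ d)%:E)%E.
  under eq_integral do rewrite powR1.
  by rewrite (integral_cst mu (measurable_cube x0 l)) mul1e (lebesgue_cube _ hmu) ?ltW.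
split; [exact: L0|exact: L0|exact: I1|exact: I1|].
by rewrite mul1r powRD// (gt_eqF L0) implybT.
Qed.

End Apq_dual_weight.

(** * Absolute values and restrictions of complex functions *)

Section complex_functions.
Context {dd} {X : measurableType dd} {R : realType}.

Lemma cabs_ge0 (z : R[i]) : 0 <= cabs z.
Proof. by case: z => a b; exact: sqrtr_ge0. Qed.

Lemma cabs0 : cabs (0 : R[i]) = 0.
Proof. exact: Normc.normc0. Qed.

Lemma cabsD (z w : R[i]) : cabs (z + w) <= cabs z + cabs w.
Proof. exact: le_normcD. Qed.

Lemma cabsN (z : R[i]) : cabs (- z) = cabs z.
Proof. exact: normcN. Qed.

Lemma cabsB (z w : R[i]) : cabs (z - w) <= cabs z + cabs w.
Proof. by rewrite (le_trans (cabsD _ _))// cabsN. Qed.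

Lemma cabs_Re (z : R[i]) : `|complex.Re z| <= cabs z.
Proof.
case: z => a b /=; rewrite -sqrtr_sqr ler_sqrt ?addr_ge0 ?sqr_ge0//.
by rewrite lerDl sqr_ge0.
Qed.

Lemma cabs_Im (z : R[i]) : `|complex.Im z| <= cabs z.
Proof.
case: z => a b /=; rewrite -sqrtr_sqr ler_sqrt ?addr_ge0 ?sqr_ge0//.
by rewrite lerDr sqr_ge0.
Qed.

Lemma powR_cabsB (p : R) (z w : R[i]) : 0 < p ->
  cabs (z - w) `^ p <= 2 `^ p * (cabs z `^ p + cabs w `^ p).
Proof.
move=> p0; wlog zw : z w / cabs w <= cabs z.
  move=> h; have [|/ltW] := leP (cabs w) (cabs z); first exact: h.
  by move=> /h; rewrite -cabsN opprB (addrC (cabs w `^ p)).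
apply: (@le_trans _ _ ((2 * cabs z) `^ p)).
  apply: ge0_ler_powR; rewrite ?nnegrE ?mulr_ge0 ?cabs_ge0 ?(ltW p0)//.
  by rewrite (le_trans (cabsB _ _))//; lra.
by rewrite powRM ?cabs_ge0// ler_wpM2l ?powR_ge0// lerDl powR_ge0.
Qed.

Definition crestrict (A : set X) (f : X -> R[i]) : X -> R[i] :=
  fun x => if x \in A then f x else 0.

Lemma cabs_crestrict A f x : cabs (crestrict A f x) = \1_A x * cabs (f x).
Proof. by rewrite /crestrict indicE; case: ifP; rewrite ?mul1r ?mul0r ?cabs0. Qed.

End complex_functions.

(** * Weighted L^p integrals, smallness in L^1 of cubes, and equi-integrability *)

Section weighted_Lp.
Context {R : realType} {d : nat}.
Local Notation Rd := (d.-tuple R).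
Variable mu : {measure set Rd -> \bar R}.
Implicit Types (f g : Rd -> R[i]) (s : Rd -> R) (p q : R).

Local Notation Lpint p s f := (wint mu p (wpow s p) f).

Lemma cmeasurable_cabs f : cmeasurable f -> measurable_fun setT (fun x => cabs (f x)).
Proof.
move=> [mr mi].
have -> : (fun x => cabs (f x)) =
    (fun x => Num.sqrt (complex.Re (f x) ^+ 2 + complex.Im (f x) ^+ 2)).
  by apply/funext => x; rewrite /cabs; case: (f x).
apply: measurableT_comp measurable_sqrt _.
by apply: measurable_funD; exact: measurable_funX.
Qed.

Lemma cmeasurable_crestrict A f : measurable A -> cmeasurable f -> cmeasurable (crestrict A f).
Proof.
move=> mA [mr mi]; split.
- have -> : (fun x => complex.Re (crestrict A f x)) =
      (fun x => \1_A x * complex.Re (f x)).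
    by apply/funext => x; rewrite /crestrict indicE; case: ifP; rewrite ?mul1r ?mul0r.
  by apply: measurable_funM => //; exact: measurable_indic.
- have -> : (fun x => complex.Im (crestrict A f x)) =
      (fun x => \1_A x * complex.Im (f x)).
    by apply/funext => x; rewrite /crestrict indicE; case: ifP; rewrite ?mul1r ?mul0r.
  by apply: measurable_funM => //; exact: measurable_indic.
Qed.

Lemma cmeasurableB f g : cmeasurable f -> cmeasurable g ->
  cmeasurable (fun x => f x - g x).
Proof.
move=> [fr fi] [gr gi]; split.
- have -> : (fun x => complex.Re (f x - g x)) =
      (fun x => complex.Re (f x) - complex.Re (g x)).
    by apply/funext => x; case: (f x) => a b; case: (g x).
  exact: measurable_funB.
- have -> : (fun x => complex.Im (f x - g x)) =
      (fun x => complex.Im (f x) - complex.Im (g x)).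
    by apply/funext => x; case: (f x) => a b; case: (g x).
  exact: measurable_funB.
Qed.

Lemma measurable_Lp_integrand p s f D : cmeasurable f -> measurable_fun setT s ->
  measurable_fun D (fun x => (cabs (f x) `^ p * wpow s p x)%:E).
Proof.
move=> mf ms; apply: measurable_fun_EFin; apply: measurable_funM.
  by apply: measurableT_comp (measurable_powR p) _; exact: cmeasurable_cabs.
exact: measurable_fun_powR.
Qed.

Lemma Lp_integrand_ge0 p s f x : (0 <= (cabs (f x) `^ p * wpow s p x)%:E)%E.
Proof. by rewrite lee_fin mulr_ge0 ?powR_ge0. Qed.

Lemma wint_ge0 p s f : (0 <= Lpint p s f)%E.
Proof. by apply: integral_ge0 => x _; exact: Lp_integrand_ge0. Qed.

Lemma wintB p s f g : 0 < p -> cmeasurable f -> cmeasurable g -> measurable_fun setT s ->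
  (Lpint p s (fun x => f x - g x)%R
     <= (2 `^ p)%:E * (Lpint p s f + Lpint p s g))%E.
Proof.
move=> p0 mf mg ms; rewrite /wint.
have m1 := @measurable_Lp_integrand p s f setT mf ms.
have m2 := @measurable_Lp_integrand p s g setT mg ms.
rewrite -ge0_integralD//; try by move=> x _; exact: Lp_integrand_ge0.
rewrite -ge0_integralZl; last 4 first.
- exact: measurableT.
- exact: emeasurable_funD.
- by move=> x _; rewrite adde_ge0// Lp_integrand_ge0.
- by rewrite lee_fin powR_ge0.
apply: ge0_le_integral => //.
- by move=> x _; rewrite lee_fin mulr_ge0 ?powR_ge0.
- by apply: measurable_Lp_integrand => //; exact: cmeasurableB.
- by apply: measurable_funeM; exact: emeasurable_funD.
move=> x _; rewrite -EFinD -EFinM lee_fin -mulrDl mulrA ler_wpM2r ?powR_ge0//.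
exact: powR_cabsB.
Qed.

Lemma wint_crestrict p s f A : 0 < p -> measurable A ->
  Lpint p s (crestrict A f) = (\int[mu]_(x in A) (cabs (f x) `^ p * wpow s p x)%:E)%E.
Proof.
move=> p0 mA; rewrite -[in RHS](setTI A) integral_mkcondr epatch_indic.
apply: eq_integral => x _; rewrite cabs_crestrict /= indicE -EFinM; congr EFin.
by case: (x \in A); rewrite ?mul1r ?mulr1// mul0r mulr0 powR0 ?mul0r// gt_eqF.
Qed.

(** The comparison behind the truncations: on [A] it exchanges both weight and exponent at the price
    of a constant [k]. *)
Lemma wint_crestrict_le p s p' s' k A f : 0 < p' -> measurable A ->
  cmeasurable f -> measurable_fun setT s -> measurable_fun setT s' -> 0 <= k ->
  {ae mu, forall x, A x ->
     cabs (f x) `^ p' * s' x `^ p' <= k * (cabs (f x) `^ p * s x `^ p)} ->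
  (Lpint p' s' (crestrict A f) <= k%:E * Lpint p s f)%E.
Proof.
move=> p0 mA mf ms ms' k0 hA; rewrite wint_crestrict// /wint.
rewrite -ge0_integralZl; last 4 first.
- exact: measurableT.
- exact: measurable_Lp_integrand.
- by move=> x _; exact: Lp_integrand_ge0.
- by rewrite lee_fin.
have mk : measurable_fun setT (fun x => k%:E * (cabs (f x) `^ p * wpow s p x)%:E)%E.
  by apply: measurable_funeM; exact: measurable_Lp_integrand.
have k0' x : (0 <= k%:E * (cabs (f x) `^ p * wpow s p x)%:E)%E.
  by rewrite mule_ge0// Lp_integrand_ge0.
apply: (@le_trans _ _ (\int[mu]_(x in A) (k%:E * (cabs (f x) `^ p * wpow s p x)%:E))%E).
  apply: ae_ge0_le_integral => //.
  - by move=> x _; exact: Lp_integrand_ge0.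
  - exact: measurable_Lp_integrand.
  - exact: measurable_funTS.
by apply: ge0_subset_integral.
Qed.

Lemma ge0_integral_split (D A : set Rd) (h : Rd -> \bar R) : measurable D -> measurable A ->
  measurable_fun D h -> (forall x, D x -> 0 <= h x)%E ->
  (\int[mu]_(x in D) h x = \int[mu]_(x in D `&` A) h x + \int[mu]_(x in D `\` A) h x)%E.
Proof.
move=> mD mA mh h0; rewrite -ge0_integral_setU ?setUIDK//.
- exact: measurableI.
- exact: measurableD.
- by rewrite disj_set2E setDE setIACA setICr setI0.
Qed.

Hypothesis hmu : is_lebesgue_measure mu.

(* Young's inequality against [s^-1], which is locally in [L^c] and hence in
   [L^(a')]. *)
Lemma Lp_small_L1_small a c s (n : nat) : 1 < a -> conj_exp a <= c ->
  dual_weight mu a c s -> forall e, 0 < e -> exists2 t, 0 < t &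
  forall g, cmeasurable g -> (Lpint a s g <= t%:E)%E ->
    (\int[mu]_(x in centered n%:R) (cabs (g x))%:E <= e%:E)%E.
Proof.
move=> a1 ac ws e e0; have [ms s0 _] := ws.
have a0 : 0 < a by rewrite (lt_trans ltr01).
have a'0 := conj_exp_gt0 a1.
have a'1 : 1 <= conj_exp a.
  by rewrite /conj_exp ler_pdivlMr ?subr_gt0// mul1r lerBlDr lerDl.
(* The index [n.+1] keeps the side positive when [n = 0]. *)
have N0 : 0 < 2 * n.+1%:R :> R by rewrite mulr_gt0.
have [_ _ [_ _ /(_ [tuple - n.+1%:R | i < d] _ N0) [_ [U [_ U0 _ hU _]]]]] := ws.
pose Q : set Rd := centered n.+1%:R.
have mQ : measurable Q by exact: measurable_cube.
pose L := (2 * n.+1%:R : R) ^+ d; have L0 : 0 < L by rewrite exprn_gt0.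
have muQ : mu Q = L%:E by rewrite (lebesgue_cube _ hmu)// ltW.
(* [k (L + U) <= e / 2] pays for the term with [s^-c], and [k <= 1] gives [k^(a') <= k]. *)
pose k := Num.min 1 (e / 2 / (L + U)).
have k0 : 0 < k by rewrite lt_min ltr01 !divr_gt0// addr_gt0.
have kU : k * (L + U) <= e / 2.
  by rewrite -ler_pdivlMr ?addr_gt0// ge_min lexx orbT.
have k1 : k <= 1 by rewrite ge_min lexx.
exists (e / 2 * k `^ a); first by rewrite mulr_gt0 ?divr_gt0// powR_gt0.
move=> g mg gt.
have pw x : cabs (g x) <= (k `^ a)^-1 * (cabs (g x) `^ a * s x `^ a)
     + k * (1 + s x `^ (- c)).
  have sx0 := s0 x; set y := cabs (g x).
  have y0 : 0 <= y by exact: cabs_ge0.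
  have -> : y = (y * s x / k) * (k / s x) by field; rewrite !gt_eqF.
  have conjE : a^-1 + (conj_exp a)^-1 = 1 by rewrite inv_conj_exp// addrC subrK.
  have ys0 : 0 <= y * s x / k by rewrite divr_ge0 ?mulr_ge0// ltW.
  have ks0 : 0 <= k / s x by rewrite divr_ge0 ?ltW.
  apply: le_trans (conjugate_powR ys0 ks0 a0 a'0 conjE) _.
  have -> : (y * s x / k) * (k / s x) = y by field; rewrite !gt_eqF.
  apply: lerD.
    rewrite (_ : (y * s x / k) `^ a = (k `^ a)^-1 * (y `^ a * s x `^ a)); last first.
      rewrite !powRM ?mulr_ge0 ?invr_ge0 ?(ltW sx0) ?(ltW k0)// mulrC; congr (_ * _).
      by rewrite -(powR_inv1 (ltW k0)) -powRrM mulN1r powRN.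
    rewrite ler_pdivrMr// ler_peMr ?(ltW a1)//.
    by rewrite mulr_ge0 ?invr_ge0 ?mulr_ge0 ?powR_ge0.
  apply: (@le_trans _ _ ((k / s x) `^ conj_exp a)).
    by rewrite ler_pdivrMr// ler_peMr ?powR_ge0.
  rewrite powRM ?invr_ge0 ?(ltW sx0) ?(ltW k0)//.
  apply: ler_pM; rewrite ?powR_ge0//.
    rewrite -[leRHS](powRr1 (ltW k0)); apply: ger_powR => //.
    by rewrite k0 k1.
  rewrite -(powR_inv1 (ltW sx0)) -powRrM mulN1r.
  (* [s^(-a') <= 1 + s^(-c)]: for [s >= 1] the left side is at most 1, and otherwise [a' <= c]
     applies. *)
  have [sx1|sx1] := leP 1 (s x).
    apply: (@le_trans _ _ 1); last by rewrite lerDl powR_ge0.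
    by rewrite -(powRr0 (s x)); apply: ler_powR => //; rewrite oppr_le0 ltW.
  apply: (@le_trans _ _ (s x `^ (- c))); last by rewrite lerDr.
  by apply: ger_powR; rewrite ?sx0 ?(ltW sx1)// lerN2.
have mgs D : measurable_fun D (fun x => (cabs (g x) `^ a * s x `^ a)%:E).
  exact: measurable_Lp_integrand.
have msc D : measurable_fun D (fun x => (1 + s x `^ (- c))%:E).
  apply: measurable_fun_EFin; apply: measurable_funD => //.
  exact: measurable_fun_powR.
apply: (@le_trans _ _ (\int[mu]_(x in Q) (cabs (g x))%:E)%E).
  apply: ge0_subset_integral => //; first exact: measurable_cube.
  - by apply: measurable_fun_EFin; exact: cmeasurable_cabs.
  - by move=> x _; rewrite lee_fin cabs_ge0.
  - by apply: centeredS; rewrite ler_nat.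
apply: (@le_trans _ _ (\int[mu]_(x in Q) (((k `^ a)^-1)%:E * (cabs (g x) `^ a * s x `^ a)%:E
    + k%:E * (1 + s x `^ (- c))%:E))%E).
  apply: ge0_le_integral => //.
  - by move=> x _; rewrite lee_fin cabs_ge0.
  - by apply: measurable_fun_EFin; exact: cmeasurable_cabs.
  - by apply: emeasurable_funD; exact: measurable_funeM.
  - by move=> x _; rewrite -!EFinM -EFinD lee_fin.
have ki0 : (0 <= ((k `^ a)^-1)%:E)%E by rewrite lee_fin invr_ge0 powR_ge0.
have gs0 x : (0 <= (cabs (g x) `^ a * s x `^ a)%:E)%E by exact: Lp_integrand_ge0.
have sc0 x : (0 <= (1 + s x `^ (- c))%:E)%E by rewrite lee_fin addr_ge0 ?powR_ge0.
have k0e : (0 <= k%:E)%E by rewrite lee_fin ltW.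
rewrite ge0_integralD//; last 4 first.
- by move=> x _; rewrite mule_ge0.
- exact: measurable_funeM.
- by move=> x _; rewrite mule_ge0.
- exact: measurable_funeM.
rewrite !ge0_integralZl//.
rewrite [e in leRHS]splitr EFinD; apply: leeD.
  apply: (@le_trans _ _ (((k `^ a)^-1)%:E * (e / 2 * k `^ a)%:E)%E).
    apply: lee_wpmul2l => //; apply: le_trans gt.
    by apply: ge0_subset_integral.
  by rewrite -EFinM lee_fin mulrC mulfK// gt_eqF// powR_gt0.
have -> : (\int[mu]_(x in Q) (1 + s x `^ (- c))%:E = (L + U)%:E)%E.
  under eq_integral do rewrite EFinD.
  rewrite ge0_integralD//; last 2 first.
  - by move=> x _; rewrite lee_fin powR_ge0.
  - by apply: measurable_fun_EFin; exact: measurable_fun_powR.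
  by rewrite hU (integral_cst mu mQ) mul1e muQ.
by rewrite -EFinM lee_fin.
Qed.

(** Decay at infinity for the dual weight [s^-1], inverted. *)
Lemma dual_weight_grow_infty a c s : (0 < d)%N -> 0 < a -> 0 < c ->
  dual_weight mu a c s ->
  exists2 s', dual_weight mu a c s' & forall e, 0 < e -> exists n : nat,
    forall x, ~ centered n%:R x -> s x <= e * s' x.
Proof.
move=> hd a0 c0 ws; have [_ s0 _] := ws.
have [u wu hu] := dual_weight_decay hmu hd c0 a0 (dual_weightV ws).
have [_ u0 _] := wu.
exists (fun x => (u x)^-1); first exact: dual_weightV.
move=> e e0; have [n hn] := hu e e0; exists n => x /hn.
by rewrite !ler_pdivlMr// mulrC.
Qed.

(* Boundedness for a whole class of weights is equi-integrability for each of
   them: mass escaping to infinity or to small sets would be unbounded for the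
   weights of [dual_weight_grow_infty] and [dual_weight_blowup]. *)
Lemma Lp_small_of_L1_small a c s (F : set (Rd -> R[i])) : (0 < d)%N -> 0 < a -> 0 < c ->
  dual_weight mu a c s -> (forall g, F g -> cmeasurable g) ->
  (forall s', dual_weight mu a c s' ->
    exists C : R, forall g, F g -> (Lpint a s' g <= C%:E)%E) ->
  forall e, 0 < e -> exists n : nat, exists2 t, 0 < t & forall g, F g ->
    (\int[mu]_(x in centered n%:R) (cabs (g x))%:E <= t%:E)%E ->
    (Lpint a s g <= e%:E)%E.
Proof.
move=> hd a0 c0 ws Fm Fb e e0; have [ms s0 _] := ws.
have [s1 ws1 hs1] := dual_weight_grow_infty hd a0 c0 ws.
have [ms1 s10 _] := ws1.
have [C1 hC1] := Fb _ ws1.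
pose k1 := (e / 2 / (`|C1| + 1)) `^ a^-1.
have C1p : 0 < `|C1| + 1 by rewrite ltr_wpDl.
have k10 : 0 < k1 by rewrite powR_gt0// !divr_gt0.
have [n hn] := hs1 k1 k10.
pose Q : set Rd := centered n%:R.
have mQ : measurable Q by exact: measurable_centered.
(* If no [t] works, some [g m] in [F] have L^1 norms on [Q] tending to 0 and integrals above [e].
   The sets where they reach a level [r] shrink, and the bound on [F] for a weight blowing up on
   these sets gives the contradiction. *)
exists n; apply: contrapT => noT.
have off g : F g -> (Lpint a s (crestrict (~` Q) g) <= (e / 2)%:E)%E.
  move=> Fg; have k1a : 0 <= k1 `^ a by exact: powR_ge0.
  apply: (@le_trans _ _ ((k1 `^ a)%:E * Lpint a s1 g)%E).
    apply: wint_crestrict_le => //; [exact: measurableC|exact: Fm|].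
    apply: aeW => x /hn sx; rewrite mulrCA ler_wpM2l ?powR_ge0//.
    rewrite -powRM ?(ltW k10) ?(ltW (s10 x))//.
    by apply: ge0_ler_powR; rewrite ?nnegrE ?mulr_ge0 ?(ltW a0) ?(ltW (s0 x)) ?(ltW k10) ?(ltW (s10 x)).
  apply: (@le_trans _ _ ((k1 `^ a)%:E * (`|C1| + 1)%:E)%E).
    apply: lee_wpmul2l; first by rewrite lee_fin.
    apply: le_trans (hC1 _ Fg) _; rewrite lee_fin.
    by rewrite (le_trans (ler_norm _))// lerDl.
  rewrite -EFinM lee_fin /k1 -powRrM mulVf ?gt_eqF// powRr1 ?divfK ?gt_eqF//.
  by rewrite ltW// !divr_gt0.
have [V V0 hV] : exists2 V : R, 0 < V &
    (\int[mu]_(x in Q) (s x `^ a)%:E <= V%:E)%E.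
  have N0 : 0 < 2 * n.+1%:R :> R by rewrite mulr_gt0.
  have [V V0 hV] := dual_weight_cube ws [tuple - n.+1%:R | i < d] N0.
  exists V => //; rewrite -hV; apply: ge0_subset_integral; try exact: measurable_cube.
  - by apply: measurable_fun_EFin; exact: measurable_fun_powR.
  - by move=> x _; rewrite lee_fin powR_ge0.
  - by apply: centeredS; rewrite ler_nat.
(* The budget is [e / 2] off [Q], [e / 4] on [E m], and [e / 4] on the rest of [Q], where
   [|g m| < r] and the integral is at most [r^a V = e / 8]. *)
pose r := (e / 8 / V) `^ a^-1.
have r0 : 0 < r by rewrite powR_gt0// !divr_gt0.
have ra : r `^ a * V = e / 8.
  by rewrite /r -powRrM mulVf ?gt_eqF// powRr1 ?divfK ?gt_eqF// ltW// !divr_gt0.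
have [g hg] : {g : nat -> Rd -> R[i] & forall m, F (g m) /\
    (\int[mu]_(x in Q) (cabs (g m x))%:E <= (r / m.+1%:R)%:E)%E /\
    ~ (Lpint a s (g m) <= e%:E)%E}.
  apply: (@choice _ _ (fun m g => F g /\
    (\int[mu]_(x in Q) (cabs (g x))%:E <= (r / m.+1%:R)%:E)%E /\
    ~ (Lpint a s g <= e%:E)%E)) => m; apply: contrapT => /forallNP h.
  apply: noT; exists (r / m.+1%:R); first by rewrite divr_gt0.
  by move=> g Fg gr; apply: contrapT => ge; apply: (h g).
pose E m := Q `&` [set x | (r%:E <= (cabs (g m x))%:E)%E].
have mg m : measurable_fun setT (fun x => cabs (g m x)).
  by apply: cmeasurable_cabs; apply: Fm; case: (hg m).
have mE m : measurable (E m).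
  by apply: emeasurable_fun_c_infty => //; exact: measurable_fun_EFin.
have muE m : (mu (E m) <= (m.+1%:R^-1)%:E)%E.
  have [_ [gm _]] := hg m.
  have := @le_integral_abse _ _ _ mu Q mQ _ r (measurable_fun_EFin (mg m)) r0.
  have -> : (\int[mu]_(x in Q) `|(cabs (g m x))%:E| = \int[mu]_(x in Q) (cabs (g m x))%:E)%E.
    by apply: eq_integral => x _; rewrite gee0_abs// lee_fin cabs_ge0.
  have -> : Q `&` [set x | (r%:E <= `|(cabs (g m x))%:E|)%E] = E m.
    by apply/seteqP; split => x [Qx /=]; rewrite ger0_norm ?cabs_ge0.
  move=> /le_trans /(_ gm).
  by rewrite muleC -lee_pdivlMr// -EFinM mulrAC divff ?gt_eqF// mul1r.
have smallE t : 0 < t -> exists m, (mu (E m) <= t%:E)%E.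
  move=> t0; exists (Num.bound t^-1); apply: le_trans (muE _) _.
  rewrite lee_fin -[leRHS]invrK lef_pV2 ?posrE ?invr_gt0//.
  by rewrite ltW// (lt_trans (archi_boundP _)) ?invr_ge0 ?(ltW t0)// ltr_nat.
have [s2 ws2 hs2] := dual_weight_blowup hmu a0 c0 ws mE (fun m => @subIsetl _ _ _) smallE.
have [ms2 s20 _] := ws2.
have [C2 hC2] := Fb _ ws2.
have C2p : 0 < `|C2| + 1 by rewrite ltr_wpDl.
pose k2 := (e / 8 / (`|C2| + 1)) `^ a^-1.
have k20 : 0 < k2 by rewrite powR_gt0// !divr_gt0.
have [m hm] := hs2 k2^-1.
have [Fg [_ gE]] := hg m; apply: gE.
have mgm := Fm _ Fg.
have mint D := @measurable_Lp_integrand a s (g m) D mgm ms.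
rewrite /wint (@ge0_integral_split setT Q)//; last by move=> x _; exact: Lp_integrand_ge0.
rewrite setTI setTD [e in leRHS]splitr EFinD; apply: leeD; last first.
  by have := off _ Fg; rewrite wint_crestrict//; exact: measurableC.
rewrite (@ge0_integral_split Q (E m))//; last by move=> x _; exact: Lp_integrand_ge0.
rewrite [X in (_ <= X%:E)%E](splitr (e / 2)) EFinD; apply: leeD.
  have -> : Q `&` E m = E m by rewrite setIidr// => x [].
  rewrite -(wint_crestrict _ _ a0 (mE m)).
  apply: (@le_trans _ _ ((k2 `^ a)%:E * Lpint a s2 (g m))%E).
    apply: wint_crestrict_le => //; first exact: powR_ge0.
    case: hm => N [mN N0 hN]; exists N; split => // x /= /not_implyP[Ex h].
    apply: hN => /= /(_ Ex) sx; apply: h.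
    rewrite mulrCA ler_wpM2l ?powR_ge0//.
    rewrite -powRM ?(ltW k20) ?(ltW (s20 x))//.
    apply: ge0_ler_powR; rewrite ?nnegrE ?mulr_ge0 ?(ltW a0) ?(ltW (s0 x)) ?(ltW k20) ?(ltW (s20 x))//.
    by rewrite -ler_pdivrMl.
  apply: (@le_trans _ _ ((k2 `^ a)%:E * (`|C2| + 1)%:E)%E).
    apply: lee_wpmul2l; first by rewrite lee_fin powR_ge0.
    apply: le_trans (hC2 _ Fg) _; rewrite lee_fin.
    by rewrite (le_trans (ler_norm _))// lerDl.
  rewrite -EFinM lee_fin /k2 -powRrM mulVf ?gt_eqF// powRr1 ?divfK ?gt_eqF//.
    by lra.
  by rewrite ltW// !divr_gt0.
have mQE : measurable (Q `\` E m) by exact: measurableD.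
apply: (@le_trans _ _ (\int[mu]_(x in Q `\` E m) ((r `^ a)%:E * (s x `^ a)%:E))%E).
  apply: ge0_le_integral => //.
  - by move=> x _; exact: Lp_integrand_ge0.
  - by apply: measurable_funeM; apply: measurable_fun_EFin; exact: measurable_fun_powR.
  move=> x [Qx Ex]; rewrite -EFinM lee_fin ler_wpM2r ?powR_ge0//.
  apply: ge0_ler_powR; rewrite ?nnegrE ?cabs_ge0 ?(ltW a0) ?(ltW r0)//.
  by rewrite leNgt; apply/negP => rg; apply: Ex; split => //=; rewrite lee_fin ltW.
rewrite ge0_integralZl//; last 3 first.
- by apply: measurable_fun_EFin; exact: measurable_fun_powR.
- by move=> x _; rewrite lee_fin powR_ge0.
- by rewrite lee_fin powR_ge0.
apply: (@le_trans _ _ ((r `^ a)%:E * V%:E)%E).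
  apply: lee_wpmul2l; first by rewrite lee_fin powR_ge0.
  apply: le_trans hV; apply: ge0_subset_integral => //.
  - by apply: measurable_fun_EFin; exact: measurable_fun_powR.
  - by move=> x _; rewrite lee_fin powR_ge0.
by rewrite -EFinM ra lee_fin; lra.
Qed.

End weighted_Lp.

(** * Diagonal extraction *)

Section subsequences.

Lemma increasing_comp (f g : nat -> nat) : (forall k, f k < f k.+1)%N ->
  (forall k, g k < g k.+1)%N -> forall k, (f (g k) < f (g k.+1))%N.
Proof. by move=> hf hg k; apply: (homo_ltn ltn_trans hf). Qed.

Lemma increasing_ge (f : nat -> nat) : (forall k, f k < f k.+1)%N -> forall k, (k <= f k)%N.
Proof. by move=> hf; elim=> // k IH; exact: leq_ltn_trans IH (hf k). Qed.

(** Each [F k] refines the previous one so as to satisfy [P k]; from index [k] on, the diagonal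
    takes its values in [F k]. *)
Lemma diagonal_subsequence (P : nat -> nat -> nat -> Prop) :
  (forall k (f : nat -> nat), (forall i, f i < f i.+1)%N ->
    exists g : nat -> nat, (forall i, g i < g i.+1)%N /\
      forall i j, P k (f (g i)) (f (g j))) ->
  exists f : nat -> nat, (forall i, f i < f i.+1)%N /\
    forall k i j, (k <= i)%N -> (k <= j)%N -> P k (f i) (f j).
Proof.
move=> H.
have [G hG] : {G : nat * (nat -> nat) -> (nat -> nat) & forall u,
    (forall i, u.2 i < u.2 i.+1)%N -> (forall i, G u i < G u i.+1)%N /\
      forall i j, P u.1 (u.2 (G u i)) (u.2 (G u j))}.
  apply: (@choice _ _ (fun (u : nat * (nat -> nat)) g =>
    (forall i, u.2 i < u.2 i.+1)%N -> (forall i, g i < g i.+1)%N /\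
      forall i j, P u.1 (u.2 (g i)) (u.2 (g j)))) => -[k f] /=.
  (* The choice function is defined on all pairs; [id] is its default where [f] is not
     increasing. *)
  have [fi|nfi] := pselect (forall i, f i < f i.+1)%N; last by exists id.
  by have [g hg] := H k f fi; exists g.
pose F := fix F k := if k is k'.+1 then F k' \o G (k'.+1, F k') else G (0%N, id).
have Fi k i : (F k i < F k i.+1)%N.
  elim: k i => [|k IH] i; first by have [h _] := hG (0%N, id) ltnSn; exact: h.
  have [h _] := hG (k.+1, F k) IH; exact: (increasing_comp IH h).
have FP k i j : P k (F k i) (F k j).
  case: k => [|k]; first by have [_ h] := hG (0%N, id) ltnSn; exact: h.
  by have [_ h] := hG (k.+1, F k) (Fi k); exact: h.
have Fsub k m i : exists j, F (k + m)%N i = F k j.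
  elim: m i => [|m IH] i; first by exists i; rewrite addn0.
  by rewrite addnS /=; exact: IH.
exists (fun i => F i i); split => [i|k i j ki kj].
  have [h _] := hG (i.+1, F i) (Fi i).
  exact: (homo_ltn ltn_trans (Fi i)) (increasing_ge h i.+1).
have [i' ->] : exists i', F i i = F k i'.
  by rewrite -{1}(subnKC ki); exact: Fsub.
have [j' ->] : exists j', F j j = F k j'.
  by rewrite -{1}(subnKC kj); exact: Fsub.
exact: FP.
Qed.

End subsequences.

(** * Real sequences with geometrically small increments *)

Section geometric_increments.
Context {R : realType}.

Lemma geometric_increments_dist (u : nat -> R) (C : R) (k : nat) :
  (forall i, `|u (k + i).+1 - u (k + i)%N| <= C / 2 ^+ (k + i)) ->
  forall n, `|u (k + n)%N - u k| <= 2 * C / 2 ^+ k.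
Proof.
move=> H n.
have C0 : 0 <= C.
  have := le_trans (normr_ge0 _) (H 0%N).
  by rewrite pmulr_lge0// invr_gt0 exprn_gt0.
(* Subtracting the remaining tail strengthens the claim enough for the induction to close. *)
suff : `|u (k + n)%N - u k| <= 2 * C / 2 ^+ k - 2 * C / 2 ^+ (k + n).
  by move=> /le_trans; apply; rewrite gerBl divr_ge0 ?mulr_ge0 ?exprn_ge0.
elim: n => [|n IH]; first by rewrite addn0 !subrr normr0.
rewrite addnS.
have -> : u (k + n).+1 - u k = (u (k + n).+1 - u (k + n)%N) + (u (k + n)%N - u k).
  by rewrite addrA subrK.
rewrite (le_trans (ler_normD _ _))// (le_trans (lerD (H n) IH))//.
rewrite exprS invfM le_eqVlt; apply/orP; left; apply/eqP; field.
by rewrite !expf_neq0.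
Qed.

(** Adding the tail bound [2 C / 2^i] makes the sequence nonincreasing and bounded below, and this
    correction tends to 0. *)
Lemma geometric_increments_cvg (u : nat -> R) (C : R) :
  (forall i, `|u i.+1 - u i| <= C / 2 ^+ i) -> cvgn u.
Proof.
move=> H.
have g0 : (fun i => 2 * C / 2 ^+ i) @ \oo --> (0 : R).
  have := @cvg_geometric R (2 * C) 2^-1; rewrite ger0_norm ?invr_ge0// invf_lt1 ?ltr1n//.
  move=> /(_ isT); apply: cvg_trans.
  by apply: near_eq_cvg; near=> i; rewrite /geometric /= exprVn.
have dec : cvgn (fun i => u i + 2 * C / 2 ^+ i).
  apply: nonincreasing_is_cvgn.
    apply/nonincreasing_seqP => i.
    have := H i; rewrite ler_norml => /andP[_].
    rewrite exprS invfM => h.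
    have -> : 2 * C * (2^-1 / 2 ^+ i) = C / 2 ^+ i by field; rewrite expf_neq0.
    have -> : 2 * C / 2 ^+ i = C / 2 ^+ i + C / 2 ^+ i by field; rewrite expf_neq0.
    lra.
  exists (u 0%N - 2 * C) => _ [i _ <-].
  have H0 j : `|u (0 + j).+1 - u (0 + j)%N| <= C / 2 ^+ (0 + j) by rewrite add0n.
  have := geometric_increments_dist H0 i; rewrite add0n expr0 divr1.
  rewrite ler_norml => /andP[h _].
  have C0 : 0 <= C.
    have := le_trans (normr_ge0 _) (H 0%N).
    by rewrite pmulr_lge0// invr_gt0 exprn_gt0.
  have : 0 <= 2 * C / 2 ^+ i by rewrite divr_ge0 ?mulr_ge0 ?exprn_ge0.
  lra.
have -> : u = (fun i => (u i + 2 * C / 2 ^+ i) - 2 * C / 2 ^+ i).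
  by apply/funext => i; rewrite addrK.
by apply: is_cvgB => //; apply/cvg_ex; exists 0.
Unshelve. all: by end_near. Qed.

Lemma geometric_increments_lim (u : nat -> R) (C : R) (k : nat) : cvgn u ->
  (forall i, `|u (k + i).+1 - u (k + i)%N| <= C / 2 ^+ (k + i)) ->
  `|u k - limn u| <= 2 * C / 2 ^+ k.
Proof.
move=> cu H.
have lu : (fun n => `|u k - u n|) @ \oo --> `|u k - limn u|.
  by apply: cvg_norm; apply: cvgB => //; exact: cvg_cst.
rewrite -(cvg_lim _ lu)//; apply: limr_le; first by apply/cvg_ex; eexists; exact: lu.
exists k => // n /= kn; rewrite distrC -(subnKC kn).
exact: geometric_increments_dist.
Qed.

End geometric_increments.

(** * Completeness of the weighted spaces *)

Section completeness.
Context {R : realType} {d : nat}.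
Local Notation Rd := (d.-tuple R).
Variable mu : {measure set Rd -> \bar R}.
Local Notation Lpint p s f := (wint mu p (wpow s p) f).

(* Riesz-Fischer for fast Cauchy sequences; the tails
   [D k = sum_(i >= k) (2^i |g (i+1) - g i|)^a s^a] control both the pointwise
   convergence and the distance to the limit. *)
Lemma Lp_fast_cauchy_cvg (a : R) (s : Rd -> R) (g : nat -> Rd -> R[i]) :
  0 < a -> measurable_fun setT s -> (forall x, 0 < s x) ->
  (forall k, inLp mu a (wpow s a) (g k)) ->
  (forall k, (Lpint a s (fun x => (g k.+1 x - g k x)%R) <=
     (((2 ^+ k) `^ a)^-1 / 2 ^+ k.+1)%:E)%E) ->
  exists h, inLp mu a (wpow s a) h /\
    ((fun k => wnorm mu a (wpow s a) (fun x => g k x - h x)%R) @ \oo --> 0%E).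
Proof.
move=> a0 ms s0 gLp gd.
pose dg i x := cabs (g i.+1 x - g i x).
pose t i x := (2 ^+ i * dg i x) `^ a * s x `^ a.
have t0 i x : 0 <= t i x by rewrite mulr_ge0 ?powR_ge0.
have mdg i : cmeasurable (fun x => g i.+1 x - g i x).
  by apply: cmeasurableB; [case: (gLp i.+1)|case: (gLp i)].
have mt i D : measurable_fun D (fun x => (t i x)%:E).
  apply: measurable_fun_EFin; apply: measurable_funM; last exact: measurable_fun_powR.
  apply: (@measurable_fun_powR _ _ (fun x => 2 ^+ i * dg i x)).
  by apply: measurable_funM => //; exact: cmeasurable_cabs.
have it i : (\int[mu]_x (t i x)%:E <= (1 / (2 ^ i.+1)%:R)%:E)%E.
  have -> : (\int[mu]_x (t i x)%:E = ((2 ^+ i) `^ a)%:E * Lpint a s (fun x => (g i.+1 x - g i x)%R))%E.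
    rewrite /wint -ge0_integralZl; last 4 first.
    - exact: measurableT.
    - exact: measurable_Lp_integrand.
    - by move=> x _; rewrite lee_fin mulr_ge0 ?powR_ge0.
    - by rewrite lee_fin powR_ge0.
    apply: eq_integral => x _; rewrite /t powRM ?exprn_ge0 ?cabs_ge0//.
    by rewrite -mulrA EFinM.
  apply: le_trans (lee_wpmul2l _ (gd i)) _; first by rewrite lee_fin powR_ge0.
  by rewrite -EFinM lee_fin mulrA divff ?natrX// gt_eqF// powR_gt0 ?exprn_gt0.
pose D k x : \bar R := (\sum_(i <oo) (t (k + i)%N x)%:E)%E.
have D0 k x : (0 <= D k x)%E by apply: nneseries_ge0 => i _ _; rewrite lee_fin.
have mD k B : measurable_fun B (D k).
  by apply: ge0_emeasurable_sum => i; [move=> x _ _; rewrite lee_fin|move=> _; exact: mt].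
have tD k i x : ((t (k + i)%N x)%:E <= D k x)%E.
  apply: le_trans (nneseries_lim_ge i.+1 _); last by move=> j _ _; rewrite lee_fin.
  by rewrite big_nat_recr//= leeDr// sume_ge0// => j _; rewrite lee_fin.
have iD k : (\int[mu]_x D k x <= (1 / 2 ^+ k)%:E)%E.
  rewrite integral_nneseries//; last by move=> i x _; rewrite lee_fin.
  have e0 : 0 <= 1 / 2 ^+ k :> R by rewrite divr_ge0// exprn_ge0.
  apply: le_trans (epsilon_trick0 xpredT e0).
  apply: lee_nneseries => [i _ _|i _]; first by apply: integral_ge0 => x _; rewrite lee_fin.
  apply: le_trans (it _) _; rewrite lee_fin le_eqVlt; apply/orP; left; apply/eqP.
  by rewrite !natrX -addnS exprD !mul1r invfM.
pose A := [set x | (D 0%N x < +oo)%E].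
have mA : measurable A.
  by rewrite -[A]setTI; exact: emeasurable_fun_infty_o.
have muA : mu (~` A) = 0%E.
  have Di : mu.-integrable setT (D 0%N).
    apply/integrableP; split => //.
    under eq_integral do rewrite gee0_abs//.
    by rewrite (le_lt_trans (iD 0%N))// ltry.
  have := integrable_ae measurableT Di.
  move=> [N [mN N0 hN]]; apply: (subset_measure0 (measurableC mA) mN _ N0) => x Ax.
  apply: hN => /= /(_ Logic.I) Df; apply: Ax; rewrite /A /=.
  by move: Df; rewrite ge0_fin_numE.
have Dfin k x : A x -> (D k x < +oo)%E.
  move=> Ax; apply: le_lt_trans Ax; rewrite /D.
  rewrite [leRHS](nneseries_split _ k); last by move=> i _; rewrite lee_fin.
  rewrite add0n -nneseries_addn; last by move=> i; rewrite lee_fin.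
  under [X in (_ <= _ + X)%E]eq_eseriesr do rewrite add0n addnC.
  by rewrite leeDr// sume_ge0// => i _; rewrite lee_fin.
(* Taking [a]-th roots in [t (k + i) x <= D k x] bounds the increment [dg (k + i) x] by
   [c k x / 2^(k + i)]. *)
pose c k x := (fine (D k x)) `^ a^-1 / s x.
have dgc k i x : A x -> dg (k + i)%N x <= c k x / 2 ^+ (k + i).
  move=> Ax; rewrite /c ler_pdivlMr ?exprn_gt0// ler_pdivlMr// (mulrC (dg _ _)).
  have p0 : 0 <= 2 ^+ (k + i) * dg (k + i)%N x * s x.
    by rewrite !mulr_ge0 ?exprn_ge0 ?cabs_ge0 ?(ltW (s0 x)).
  have fD0 : 0 <= fine (D k x) by exact: fine_ge0.
  have -> : 2 ^+ (k + i) * dg (k + i)%N x * s x =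
      ((2 ^+ (k + i) * dg (k + i)%N x * s x) `^ a) `^ a^-1.
    by rewrite -powRrM mulfV ?gt_eqF// powRr1.
  apply: ge0_ler_powR; rewrite ?nnegrE ?powR_ge0 ?invr_ge0 ?(ltW a0) ?fD0//.
  rewrite powRM ?mulr_ge0 ?exprn_ge0 ?cabs_ge0 ?(ltW (s0 x))// -/(t _ _).
  rewrite -lee_fin fineK ?ge0_fin_numE ?Dfin//; exact: tD.
(* Cutting to [A], where the series is finite, makes the limits exist at every point, so that [h] is
   measurable. *)
pose gA k := crestrict A (g k).
have gAd k x : gA k.+1 x - gA k x = crestrict A (fun x => g k.+1 x - g k x) x.
  by rewrite /gA /crestrict; case: ifP => //; rewrite subrr.
have incr k i x : cabs (gA (k + i).+1 x - gA (k + i)%N x) <= \1_A x * c k x / 2 ^+ (k + i).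
  rewrite gAd cabs_crestrict indicE; have [/set_mem Ax|_] := boolP (x \in A).
    by rewrite !mul1r dgc.
  by rewrite !mul0r.
have Reincr k i x : `|complex.Re (gA (k + i).+1 x) - complex.Re (gA (k + i)%N x)|
    <= \1_A x * c k x / 2 ^+ (k + i).
  apply: le_trans (incr k i x); apply: le_trans (cabs_Re _).
  by case: (gA _.+1 x) => ? ?; case: (gA _ x).
have Imincr k i x : `|complex.Im (gA (k + i).+1 x) - complex.Im (gA (k + i)%N x)|
    <= \1_A x * c k x / 2 ^+ (k + i).
  apply: le_trans (incr k i x); apply: le_trans (cabs_Im _).
  by case: (gA _.+1 x) => ? ?; case: (gA _ x).
pose rg k x := complex.Re (gA k x); pose ig k x := complex.Im (gA k x).
have cr x : cvgn (rg ^~ x) by exact: (geometric_increments_cvg (fun i => Reincr 0%N i x)).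
have ci x : cvgn (ig ^~ x) by exact: (geometric_increments_cvg (fun i => Imincr 0%N i x)).
pose h x : R[i] := Complex (limn (rg ^~ x)) (limn (ig ^~ x)).
have mgA k : cmeasurable (gA k) by apply: cmeasurable_crestrict => //; case: (gLp k).
have mh : cmeasurable h.
  split => /=.
  - apply: (measurable_fun_cvg (fun k => (mgA k).1)) => x _; exact: cr.
  - apply: (measurable_fun_cvg (fun k => (mgA k).2)) => x _; exact: ci.
(* A factor 2 comes from the geometric tail, another from adding real and imaginary parts. *)
have gAh k x : cabs (gA k x - h x) <= 4 * (\1_A x * c k x) / 2 ^+ k.
  have hr := @geometric_increments_lim R (rg ^~ x) _ k (cr x) (fun i => Reincr k i x).
  have hi := @geometric_increments_lim R (ig ^~ x) _ k (ci x) (fun i => Imincr k i x).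
  have cabs_le (z : R[i]) : cabs z <= `|complex.Re z| + `|complex.Im z|.
    case: z => u v /=; rewrite -(@ler_pXn2r _ 2) ?nnegrE ?sqrtr_ge0 ?addr_ge0//.
    rewrite sqr_sqrtr ?addr_ge0 ?sqr_ge0// sqrrD !real_normK ?num_real//.
    by rewrite addrAC lerDl mulrn_wge0// mulr_ge0.
  apply: le_trans (cabs_le _) _.
  have -> : complex.Re (gA k x - h x) = rg k x - limn (rg ^~ x).
    by rewrite /rg /h; case: (gA k x).
  have -> : complex.Im (gA k x - h x) = ig k x - limn (ig ^~ x).
    by rewrite /ig /h; case: (gA k x).
  apply: le_trans (lerD hr hi) _.
  by rewrite le_eqVlt; apply/orP; left; apply/eqP; field; rewrite expf_neq0.
have mgh k : cmeasurable (fun x => g k x - h x).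
  by apply: cmeasurableB => //; case: (gLp k).
have dist k : (Lpint a s (fun x => (g k x - h x)%R) <= (4 `^ a / 2 ^+ k)%:E)%E.
  apply: (@le_trans _ _ (\int[mu]_x ((4 `^ a)%:E * D k x))%E).
    apply: ae_ge0_le_integral => //.
    - by move=> x _; rewrite lee_fin mulr_ge0 ?powR_ge0.
    - exact: measurable_Lp_integrand.
    - by move=> x _; rewrite mule_ge0// lee_fin powR_ge0.
    - exact: measurable_funeM.
    exists (~` A); split; [exact: measurableC|exact: muA|].
    move=> x /= /not_implyP[_ nle] Ax; apply: nle.
    have -> : g k x = gA k x by rewrite /gA /crestrict mem_set.
    rewrite -(fineK (_ : D k x \is a fin_num)) ?ge0_fin_numE ?Dfin//.
    rewrite -EFinM lee_fin /wpow -powRM ?cabs_ge0 ?(ltW (s0 x))//.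
    have -> : 4 `^ a * fine (D k x) = (4 * (c k x * s x)) `^ a.
      rewrite /c divfK ?gt_eqF// powRM ?powR_ge0// -powRrM mulVf ?gt_eqF// powRr1//.
      exact: fine_ge0.
    have c0 : 0 <= c k x by rewrite divr_ge0 ?powR_ge0 ?(ltW (s0 x)).
    have h1 : 0 <= cabs (gA k x - h x) * s x by rewrite mulr_ge0 ?cabs_ge0 ?(ltW (s0 x)).
    have h2 : 0 <= 4 * (c k x * s x) := mulr_ge0 (ler0n _ 4) (mulr_ge0 c0 (ltW (s0 x))).
    apply: (ge0_ler_powR (ltW a0) h1 h2).
    rewrite mulrA ler_wpM2r ?(ltW (s0 x))//.
    apply: le_trans (gAh k x) _; rewrite indicE mem_set// mul1r.
    rewrite ler_pdivrMr ?exprn_gt0//; apply: ler_peMr.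
      exact: (mulr_ge0 (ler0n _ 4) c0).
    by rewrite exprn_ege1// ler1n.
  have p4 : (0 <= (4 `^ a : R)%:E)%E by rewrite lee_fin powR_ge0.
  rewrite (ge0_integralZl mu measurableT (mD k setT) (fun x _ => D0 k x) p4).
  apply: le_trans (lee_wpmul2l p4 (iD k)) _.
  by rewrite -EFinM mul1r.
exists h; split.
  split => //.
  have -> : h = (fun x => g 0%N x - (g 0%N x - h x)).
    by apply/funext => x; rewrite opprB addrC subrK.
  apply: le_lt_trans (wintB _ a0 _ (mgh 0%N) ms) _; first by case: (gLp 0%N).
  apply: lte_mul_pinfty; rewrite ?lee_fin ?powR_ge0//.
  apply: lte_add_pinfty; first by case: (gLp 0%N).
  by apply: le_lt_trans (dist 0%N) _; rewrite ltry.
(* The ratio that remains after taking the [a]-th root of [4^a / 2^k]. *)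
pose r := 2^-1 `^ a^-1 : R.
have r1 : `|r| < 1.
  rewrite ger0_norm ?powR_ge0//.
  apply: (@lt_le_trans _ _ (1 `^ a^-1)); last by rewrite powR1.
  by apply: gt0_ltr_powR; rewrite ?nnegrE ?invr_gt0 ?invr_ge0// invf_lt1// ltr1n.
have geo : (fun k => (4 * r ^+ k)%:E) @ \oo --> (0%E : \bar R).
  by apply/fine_cvgP; split; [exact: nearW|exact: (cvg_geometric 4 r1)].
apply: squeeze_cvge geo; last exact: cvg_cst.
apply: nearW => k; rewrite poweR_ge0/=.
have -> : ((4 * r ^+ k)%:E = poweR (4 `^ a / 2 ^+ k)%:E a^-1)%E.
  rewrite poweR_EFin powRM ?powR_ge0 ?invr_ge0 ?exprn_ge0//.
  rewrite -powRrM mulfV ?gt_eqF// powRr1//; congr (_ * _)%:E.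
  have i2 : 0 <= 2^-1 :> R by rewrite invr_ge0.
  rewrite -exprVn -(powR_mulrn k i2) -(powR_mulrn k (powR_ge0 2^-1 a^-1)) -!powRrM.
  by rewrite (mulrC a^-1).
apply: gt0_ler_poweR => //; rewrite ?invr_ge0 ?(ltW a0)// in_itv/= ?leey ?andbT//.
exact: wint_ge0.
Qed.

End completeness.

(** * Extrapolation of compactness for everywhere positive weights *)

Section extrapolation.
Context {R : realType} {d : nat}.
Local Notation Rd := (d.-tuple R).
Variable mu : {measure set Rd -> \bar R}.
Hypothesis hmu : is_lebesgue_measure mu.
Hypothesis hd : (0 < d)%N.
Variables (p1 q1 : R) (w1 : Rd -> R).
Hypotheses (hp1 : 1 < p1) (hpq1 : p1 <= q1).
Hypothesis ww1 : dual_weight mu q1 (conj_exp p1) w1.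
Variables (V : set (Rd -> R[i])) (T : (Rd -> R[i]) -> (Rd -> R[i])).
Hypothesis hT : simultaneously_linear mu p1 q1 V T.
Hypothesis hcomp : compact_op mu T p1 w1 q1 w1.
Hypothesis hbdd : forall (p q : R) (sigma lambda : Rd -> R),
  admissible p1 q1 p q -> Apq mu p q sigma -> Apq mu p q lambda ->
  bounded_op mu T p sigma q lambda.

Local Notation Lpint p s f := (wint mu p (wpow s p) f).
Local Notation Lp p s f := (inLp mu p (wpow s p) f).
Local Notation L1 n f := (\int[mu]_(x in centered n%:R) (cabs (f x))%:E)%E.
Local Notation adm := (admissible p1 q1).

Let adm_le p q : adm p q -> p <= q.
Proof.
move=> [p1' [q1' pq]].
have : q^-1 <= p^-1.
  rewrite -subr_ge0 pq subr_ge0 lef_pV2 ?posrE//.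
    exact: lt_le_trans (lt_trans ltr01 hp1) hpq1.
  exact: lt_trans hp1.
by rewrite lef_pV2 ?posrE ?(lt_trans ltr01).
Qed.

Let adm1 : adm p1 q1.
Proof. by split => //; split => //; exact: lt_le_trans hpq1. Qed.

(** Supplies the condition [conj_exp a <= c] of [Lp_small_L1_small] for [a = q] and
    [c = conj_exp p]; it comes from [p <= q]. *)
Let adm_conj p q : adm p q -> conj_exp q <= conj_exp p.
Proof.
move=> pq; have := adm_le pq; have [p1' [q1' _]] := pq => le_pq.
rewrite -lef_pV2 ?posrE ?conj_exp_gt0// !inv_conj_exp// lerD2l lerN2.
by rewrite lef_pV2 ?posrE ?(lt_trans ltr01).
Qed.

Let T_sub (f g : Rd -> R[i]) : V f -> V g ->
  V (fun x => f x - g x) /\ T (fun x => f x - g x) = (fun x => T f x - T g x).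
Proof.
case: hT => hV hlin _ _ Vf Vg.
have e (u v : Rd -> R[i]) : (fun x => u x - v x) = (fun x => -1 * v x + u x).
  by apply/funext => x; rewrite mulN1r addrC.
by rewrite !e; split; [exact: hV|exact: hlin].
Qed.

Let VLp p q s f : adm p q -> dual_weight mu q (conj_exp p) s -> Lp p s f -> V f.
Proof.
case: hT => _ _ h _ a ws; have [p1' [q1' _]] := a.
by apply: h a _; exact: Apq_dual_weight.
Qed.

Let bounded_Lpint p q s t : adm p q -> dual_weight mu q (conj_exp p) s ->
  dual_weight mu q (conj_exp p) t -> exists2 C, 0 <= C & forall f, Lp p s f ->
    Lp q t (T f) /\ forall M, 0 <= M -> (Lpint p s f <= M%:E)%E ->
      (Lpint q t (T f) <= (C * M `^ (p^-1 * q))%:E)%E.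
Proof.
move=> a ws wt; have [p1' [q1' _]] := a.
have p0 : 0 < p by exact: lt_trans p1'.
have q0 : 0 < q by exact: lt_trans q1'.
have [C hC] := hbdd a (Apq_dual_weight hmu p1' q1' ws) (Apq_dual_weight hmu p1' q1' wt).
exists (`|C| `^ q); first exact: powR_ge0.
move=> f Lf; have [TLf hle] := hC f Lf; split => // M M0 fM.
have {}hle : (wnorm mu q (wpow t q) (T f) <= (`|C| * M `^ p^-1)%:E)%E.
  apply: le_trans hle _.
  apply: (@le_trans _ _ (`|C|%:E * wnorm mu p (wpow s p) f)%E).
    by apply: lee_wpmul2r; [exact: poweR_ge0|rewrite lee_fin ler_norm].
  rewrite EFinM; apply: lee_wpmul2l; first by rewrite lee_fin.
  rewrite /wnorm -poweR_EFin; apply: gt0_ler_poweR => //.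
  - by rewrite invr_ge0 ltW.
  - by rewrite in_itv/= wint_ge0 leey.
  - by rewrite in_itv/= lee_fin M0 leey.
have -> : Lpint q t (T f) = poweR (wnorm mu q (wpow t q) (T f)) q.
  by rewrite /wnorm -poweRrM mulVf ?gt_eqF// poweRe1// wint_ge0.
have -> : (`|C| `^ q * M `^ (p^-1 * q))%:E = poweR (`|C| * M `^ p^-1)%:E q.
  by rewrite poweR_EFin powRM ?powR_ge0// -powRrM.
apply: gt0_ler_poweR => //; rewrite ?(ltW q0)// in_itv/= leey andbT.
  exact: poweR_ge0.
by rewrite lee_fin mulr_ge0 ?powR_ge0.
Qed.

(** The constant 1 is a weight of the class, so [T] is bounded into the unweighted L^q, where
    smallness implies smallness in L^1 of a cube. *)
Let L1_small p q s n : adm p q -> dual_weight mu q (conj_exp p) s ->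
  forall e, 0 < e -> exists2 t, 0 < t & forall f, Lp p s f ->
    (Lpint p s f <= t%:E)%E -> (L1 n (T f) <= e%:E)%E.
Proof.
move=> a ws e e0; have [p1' [q1' _]] := a.
have p0 : 0 < p by exact: lt_trans p1'.
have q0 : 0 < q by exact: lt_trans q1'.
have wt := dual_weight_cst1 hmu q (conj_exp p).
have [t t0 ht] := Lp_small_L1_small hmu n q1' (adm_conj a) wt e0.
have [C C0 hC] := bounded_Lpint a ws wt.
have C1 : 0 < C + 1 by rewrite ltr_wpDl.
pose k := (t / (C + 1)) `^ (p^-1 * q)^-1.
have k0 : 0 < k by rewrite powR_gt0// divr_gt0.
exists k => // f Lf fk; have [[mTf _] hTf] := hC f Lf.
apply: ht => //; apply: le_trans (hTf k (ltW k0) fk) _; rewrite lee_fin /k.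
rewrite -powRrM mulVf; last by rewrite gt_eqF// mulr_gt0// invr_gt0.
rewrite powRr1; last by rewrite divr_ge0// ltW.
by rewrite mulrA ler_pdivrMr// mulrC ler_wpM2l ?(ltW t0)// lerDl.
Qed.

Let mT p q s f : adm p q -> dual_weight mu q (conj_exp p) s -> Lp p s f ->
  cmeasurable (T f).
Proof. by move=> a ws Lf; have [C _ h] := bounded_Lpint a ws ws; have [[]] := h f Lf. Qed.

(** As the exponents have opposite signs, the threshold [y0] with [y0^e2 = t] separates the region
    where [y^e2 <= t] from the one where [y^e1 <= y0^e1]. *)
Let power_dichotomy (e1 e2 t : R) : (0 <= e1 /\ e2 < 0) \/ (e1 < 0 /\ 0 < e2) ->
  0 < t -> exists2 N, 0 < N & forall y, 0 < y -> y `^ e1 <= N \/ y `^ e2 <= t.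
Proof.
move=> he t0; have e2N0 : e2 != 0 by case: he => [[_ /lt_eqF->]|[_ /gt_eqF->]].
pose y0 := t `^ e2^-1; have y00 : 0 < y0 by exact: powR_gt0.
have y0t : y0 `^ e2 = t by rewrite /y0 -powRrM mulVf// powRr1// ltW.
have neg e y z : e < 0 -> 0 < y -> y <= z -> z `^ e <= y `^ e.
  move=> e0 yp yz; rewrite -(opprK e) (powRN z) (powRN y) lef_pV2 ?posrE ?powR_gt0//.
    by apply: ge0_ler_powR; rewrite ?nnegrE ?oppr_ge0 ?(ltW e0) ?(ltW yp)// (le_trans (ltW yp)).
  exact: lt_le_trans yz.
exists (y0 `^ e1) => [|y yp]; first exact: powR_gt0.
have [yy0|/ltW yy0] := leP y y0; case: he => [[h1 h2]|[h1 h2]].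
- by left; apply: ge0_ler_powR; rewrite ?nnegrE ?(ltW yp) ?(ltW y00).
- by right; rewrite -y0t; apply: ge0_ler_powR; rewrite ?nnegrE ?(ltW yp) ?(ltW y00) ?(ltW h2).
- by right; rewrite -y0t; exact: neg.
- by left; exact: neg.
Qed.

Let measure_tail (D : set Rd) (h : Rd -> R) : measurable D -> (mu D < +oo)%E ->
  measurable_fun setT h -> forall t, 0 < t ->
  exists m : nat, (mu (D `&` [set x | (m%:R < h x)%R]) <= t%:E)%E.
Proof.
move=> mD Dfin mh t t0.
pose E (m : nat) := D `&` [set x | (m%:R%:E < (h x)%:E)%E].
have mE m : measurable (E m).
  by apply: emeasurable_fun_o_infty => //; exact: measurable_fun_EFin.
have nd : nonincreasing_seq E.
  move=> m n mn; apply/subsetPset => x [Dx /= h1]; split => //=.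
  by apply: le_lt_trans h1; rewrite lee_fin ler_nat.
have cap0 : \bigcap_m E m = set0.
  apply/seteqP; split => // x /(_ (Num.bound `|h x|) Logic.I) [_ /=].
  rewrite lte_fin ltNge => /negP; apply.
  by rewrite (le_trans (ler_norm _))// ltW// archi_boundP.
have E0fin : (mu (E 0%N) < +oo)%E.
  by apply: le_lt_trans Dfin; apply: le_measure; rewrite ?inE// => x [].
have := @nonincreasing_cvg_mu _ _ _ mu E E0fin mE _ nd.
rewrite cap0 measure0 => /(_ measurable0) cv.
apply: contrapT => /forallNP nE.
have : (t%:E <= 0)%E.
  rewrite -(cvg_lim _ cv)//; apply: lime_ge; first by apply/cvg_ex; eexists; exact: cv.
  by apply: nearW => m /=; have /negP := nE m; rewrite -ltNge => /ltW.
by rewrite leNgt lte_fin t0.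
Qed.

(** Provides the exponents [p1 - p] and [p2 - p] of opposite signs that [power_dichotomy] asks
    for. *)
Let companion p q : adm p q -> exists p2 q2, adm p2 q2 /\
  ((0 <= p1 - p /\ p2 - p < 0) \/ (p1 - p < 0 /\ 0 < p2 - p)).
Proof.
move=> a; have [p1' [q1' pq]] := a.
have p0 : 0 < p by exact: lt_trans p1'.
have q0 : 0 < q by exact: lt_trans q1'.
have al0 : 0 <= p1^-1 - q1^-1.
  rewrite subr_ge0 lef_pV2 ?posrE//.
    exact: lt_le_trans (lt_trans ltr01 hp1) hpq1.
  exact: lt_trans hp1.
have inv_lt1 (r : R) : 0 < r -> r < 1 -> 1 < r^-1 by move=> r0 r1; rewrite invf_gt1.
have [pp1|pp1] := leP p p1.
  (* With [alpha] the common difference of the inverse exponents, lowering [p] to [p2] leaves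
     [1/q2 = 1/p2 - alpha] above [1/q > 0]; any [p2] strictly between 1 and [p] would do. *)
  pose p2 := (1 + p) / 2; have p21 : 1 < p2 by rewrite /p2; lra.
  have p2p : p2 < p by rewrite /p2; lra.
  have p20 : 0 < p2 by exact: lt_trans p21.
  pose r := p2^-1 - (p1^-1 - q1^-1).
  have r0 : 0 < r.
    have : p^-1 < p2^-1 by rewrite ltf_pV2 ?posrE.
    have : 0 < q^-1 by rewrite invr_gt0.
    by rewrite /r -pq; lra.
  have r1 : r < 1.
    by rewrite /r (le_lt_trans (_ : _ <= p2^-1))// ?invf_lt1// gerBl.
  exists p2, r^-1; split; last by left; rewrite subr_ge0 subr_lt0.
  by split => //; split; [exact: inv_lt1|rewrite invrK /r opprB addrCA subrr addr0].
(* [r = 1/p2] is the midpoint of [alpha] and [1/p], which makes [1/q2 = r - alpha] equal to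
   [1/(2 q)]. *)
pose r := (p^-1 + (p1^-1 - q1^-1)) / 2.
have qi : 0 < q^-1 by rewrite invr_gt0.
have r0 : 0 < r by rewrite /r divr_gt0// ltr_pwDl// invr_gt0.
have rp : r < p^-1 by rewrite /r -pq; lra.
have p1i : p^-1 < 1 by rewrite invf_lt1.
exists r^-1, (2 * q); split; last first.
  right; rewrite subr_lt0 subr_gt0; split => //.
  by rewrite -[p]invrK ltf_pV2 ?posrE// invr_gt0.
split; first by rewrite inv_lt1// (lt_trans rp).
split; first by lra.
rewrite invrK invfM /r -pq; field.
by rewrite !gt_eqF.
Qed.

(** Blow-up of the dual weight [s^-1] on the sets [E m], inverted. *)
Let dual_weight_decay_loc p q s : adm p q -> dual_weight mu q (conj_exp p) s ->
  forall (N : nat) (E : nat -> set Rd), (forall m, measurable (E m)) ->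
  (forall m, E m `<=` centered N%:R) ->
  (forall k, 0 < k -> exists m, (mu (E m) <= k%:E)%E) ->
  exists2 s', dual_weight mu q (conj_exp p) s' & forall e, 0 < e -> exists m,
    {ae mu, forall x, E m x -> s' x <= e * s x}.
Proof.
move=> a ws N E mE EN smallE; have [p1' [q1' _]] := a.
have q0 : 0 < q by exact: lt_trans q1'.
have c0 := conj_exp_gt0 p1'.
have [_ s0 _] := ws.
have [u wu hu] := dual_weight_blowup hmu c0 q0 (dual_weightV ws) mE EN smallE.
have [_ u0 _] := wu.
exists (fun x => (u x)^-1); first exact: dual_weightV.
move=> e e0; have [m hm] := hu e^-1; exists m.
case: hm => A [mA A0 hA]; exists A; split => // x /= /not_implyP[Ex h].
apply: hA => /= /(_ Ex) le_u; apply: h.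
by rewrite -[leRHS]invrK lef_pV2 ?posrE ?invr_gt0 ?mulr_gt0// invfM.
Qed.

(* Up to a part with small image, a bounded subset of [L^p(s)] is bounded in
   [L^p1(w1)].  What is discarded from [f]: the part at infinity, the part on the
   set [E m] where the weights are not comparable, and the part where [|f|] is on
   the wrong side of the level [s^(p/e2)], measured in the unweighted [L^p2]. *)
Let decomposition p q s (M : R) n e : adm p q -> dual_weight mu q (conj_exp p) s ->
  0 <= M -> 0 < e -> exists M0 : R, forall f, Lp p s f -> (Lpint p s f <= M%:E)%E ->
    exists f0, [/\ Lp p1 w1 f0, (Lpint p1 w1 f0 <= M0%:E)%E &
      (L1 n (fun x => (T f x - T f0 x)%R) <= e%:E)%E].
Proof.
move=> a ws M0 e0; have [p1' [q1' _]] := a.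
have p0 : 0 < p by exact: lt_trans p1'.
have p10 : 0 < p1 by exact: lt_trans hp1.
have q0 : 0 < q by exact: lt_trans q1'.
have c0 := conj_exp_gt0 p1'.
have [p2 [q2 [a2 he]]] := companion a.
have [p21 [q21 _]] := a2; have p20 : 0 < p2 by exact: lt_trans p21.
have [ms s0 _] := ws; have [mw1 w10 _] := ww1.
have e30 : 0 < e / 3 by rewrite divr_gt0.
have M1 : 0 < M + 1 by rewrite ltr_wpDl.
have e2N0 : p2 - p != 0 by case: he => [[_ /lt_eqF->]|[_ /gt_eqF->]].
have [sI wsI hsI] := dual_weight_decay hmu hd q0 c0 ws.
have [msI sI0 _] := wsI.
have [ta ta0 hta] := L1_small n a wsI e30.
have small_root t : 0 < t -> exists2 k, 0 < k & k `^ p * M <= t.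
  move=> t0; exists ((t / (M + 1)) `^ p^-1); first by rewrite powR_gt0// divr_gt0.
  rewrite -powRrM mulVf ?gt_eqF// powRr1 ?divr_ge0 ?(ltW t0) ?(ltW M1)//.
  by rewrite mulrAC ler_pdivrMr// ler_wpM2l ?(ltW t0)// lerDl.
have [ka ka0 kaM] := small_root _ ta0.
have [N hN] := hsI ka ka0.
pose Q : set Rd := centered N%:R.
have mQ : measurable Q by exact: measurable_centered.
(* On the set [G] below, [|f|^p1 w1^p1] is at most [B h |f|^p s^p]; where moreover [h <= m], the
   bound on [f] in L^p(s^p) passes to L^p1(w1^p1). *)
pose h x := s x `^ (p / (p2 - p) * (p1 - p)) * w1 x `^ p1 / s x `^ p.
have mh : measurable_fun setT h.
  have -> : h = (fun x => s x `^ (p / (p2 - p) * (p1 - p)) * w1 x `^ p1 * s x `^ (- p)).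
    by apply/funext => x; rewrite /h powRN.
  by apply: measurable_funM; [apply: measurable_funM|]; exact: measurable_fun_powR.
pose E (m : nat) := Q `&` [set x | (m%:R < h x)%R].
have mE m : measurable (E m).
  have -> : E m = Q `&` [set x | (m%:R%:E < (h x)%:E)%E].
    by apply/seteqP; split => x [Qx /=]; rewrite lte_fin.
  by apply: emeasurable_fun_o_infty => //; exact: measurable_fun_EFin.
have Qfin : (mu Q < +oo)%E.
  have N20 : 0 <= 2 * N%:R :> R by rewrite mulr_ge0.
  by rewrite [X in (X < _)%E](lebesgue_cube _ hmu N20) ltry.
have [sL wsL hsL] := dual_weight_decay_loc a ws mE (fun m => @subIsetl _ _ _)
  (measure_tail mQ Qfin mh).
have [msL sL0 _] := wsL.
have [tb tb0 htb] := L1_small n a wsL e30.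
have [kb kb0 kbM] := small_root _ tb0.
have [m hm] := hsL kb kb0.
have ws2 := dual_weight_cst1 hmu q2 (conj_exp p2).
have [tc tc0 htc] := L1_small n a2 ws2 e30.
have tcM : 0 < tc / (M + 1) by rewrite divr_gt0.
have [B B0 hB] := power_dichotomy he tcM.
exists (B * m%:R * M) => f Lf fM; have [mf ffin] := Lf.
have mcf := cmeasurable_cabs mf.
(* With [l = s^(p/(p2-p))], this says [(|f|/l)^(p1-p) <= B] wherever [f] is not 0. Off [G] the
   dichotomy makes [(|f|/l)^(p2-p)] small, and since [l^(p2-p) = s^p] the unweighted [|f|^p2] is a
   small multiple of [|f|^p s^p]. *)
pose G := [set x | cabs (f x) `^ p1 <=
  B * (cabs (f x) `^ p * s x `^ (p / (p2 - p) * (p1 - p)))].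
have mG : measurable G.
  have -> : G = [set x | (0%:E <= (B * (cabs (f x) `^ p *
      s x `^ (p / (p2 - p) * (p1 - p))) - cabs (f x) `^ p1)%:E)%E].
    by apply/seteqP; split => x; rewrite /G /= lee_fin subr_ge0.
  rewrite -[X in measurable X]setTI; apply: emeasurable_fun_c_infty => //.
  apply: measurable_fun_EFin; apply: measurable_funB.
    apply: measurable_funM => //; apply: measurable_funM.
      exact: measurableT_comp (measurable_powR p) mcf.
    exact: measurable_fun_powR.
  exact: measurableT_comp (measurable_powR p1) mcf.
have Gc x : ~ G x -> cabs (f x) `^ p2 <= tc / (M + 1) * (cabs (f x) `^ p * s x `^ p).
  rewrite /G /= => /negP; rewrite -ltNge => ltG.
  have [f0|fN0] := eqVneq (cabs (f x)) 0.
    by rewrite f0 !powR0 ?gt_eqF// mul0r mulr0.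
  have fx0 : 0 < cabs (f x) by rewrite lt_neqAle eq_sym fN0 cabs_ge0.
  pose l := s x `^ (p / (p2 - p)); have l0 : 0 < l by exact: powR_gt0.
  have split_pow r : cabs (f x) `^ r =
      cabs (f x) `^ p * (l `^ (r - p) * (cabs (f x) / l) `^ (r - p)).
    rewrite -powRM ?divr_ge0 ?(ltW l0) ?cabs_ge0// mulrCA divff ?gt_eqF// mulr1.
    by rewrite -powRD ?fN0 ?implybT// addrC subrK.
  have [yN|yt] := hB _ (divr_gt0 fx0 l0).
    exfalso; move: ltG; apply/negP; rewrite -leNgt (split_pow p1) [leRHS]mulrCA.
    apply: ler_wpM2l; first exact: powR_ge0.
    by rewrite mulrC powRrM ler_wpM2r ?powR_ge0.
  rewrite (split_pow p2) [leRHS]mulrCA; apply: ler_wpM2l; first exact: powR_ge0.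
  rewrite mulrC /l -powRrM divfK// ler_wpM2r ?powR_ge0//.
pose A := (Q `\` E m) `&` G.
have mA : measurable A by apply: measurableI => //; exact: measurableD.
pose f0 := crestrict A f.
pose ra := crestrict (~` Q) f.
pose rb := crestrict (E m) f.
pose rc := crestrict ((Q `\` E m) `\` G) f.
have mC : measurable (~` Q) by exact: measurableC.
have mD : measurable ((Q `\` E m) `\` G) by apply: measurableD => //; exact: measurableD.
have Lf0 : (Lpint p1 w1 f0 <= (B * m%:R)%:E * Lpint p s f)%E.
  apply: wint_crestrict_le => //; first by rewrite mulr_ge0// ltW.
  apply: aeW => x [[Qx nEx] Gx].
  have hx : h x <= m%:R by rewrite leNgt; apply/negP => hm'; apply: nEx.
  apply: (@le_trans _ _ (B * (cabs (f x) `^ p * s x `^ (p / (p2 - p) * (p1 - p)))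
      * w1 x `^ p1)); first by rewrite ler_wpM2r ?powR_ge0.
  rewrite -!mulrA ler_wpM2l ?(ltW B0)// [leRHS]mulrCA ler_wpM2l ?powR_ge0//.
  by move: hx; rewrite /h ler_pdivrMr ?powR_gt0// !mulrA.
have Lra : (Lpint p sI ra <= (ka `^ p)%:E * Lpint p s f)%E.
  apply: wint_crestrict_le => //; first exact: powR_ge0.
  apply: aeW => x /hN sx; rewrite mulrCA ler_wpM2l ?powR_ge0//.
  rewrite -powRM ?(ltW ka0) ?(ltW (s0 x))//.
  by apply: ge0_ler_powR; rewrite ?nnegrE ?mulr_ge0 ?(ltW p0) ?(ltW (s0 x)) ?(ltW ka0) ?(ltW (sI0 x)).
have Lrb : (Lpint p sL rb <= (kb `^ p)%:E * Lpint p s f)%E.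
  apply: wint_crestrict_le => //; first exact: powR_ge0.
  case: hm => W [mW W0 hW]; exists W; split => // x /= /not_implyP[Ex nle].
  apply: hW => /= /(_ Ex) sx; apply: nle; rewrite mulrCA ler_wpM2l ?powR_ge0//.
  rewrite -powRM ?(ltW kb0) ?(ltW (s0 x))//.
  by apply: ge0_ler_powR; rewrite ?nnegrE ?mulr_ge0 ?(ltW p0) ?(ltW (s0 x)) ?(ltW kb0) ?(ltW (sL0 x)).
have Lrc : (Lpint p2 (fun=> 1%R) rc <= (tc / (M + 1))%:E * Lpint p s f)%E.
  apply: wint_crestrict_le => //; first exact: ltW.
  by apply: aeW => x [_ /Gc le_f]; rewrite powR1 mulr1.
have finK (K : R) : 0 <= K -> (K%:E * Lpint p s f <= (K * M)%:E)%E.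
  by move=> K0; rewrite EFinM; apply: lee_wpmul2l => //; rewrite lee_fin.
have Lp_of p' s' g K : cmeasurable g -> 0 <= K ->
    (Lpint p' s' g <= K%:E * Lpint p s f)%E -> Lp p' s' g.
  move=> mg K0 gK; split; [exact: mg|apply: le_lt_trans gK _].
  by apply: le_lt_trans (finK _ K0) _; rewrite ltry.
have Bm0 : 0 <= B * m%:R by rewrite mulr_ge0// ltW.
have Lpf0 : Lp p1 w1 f0 by apply: Lp_of Bm0 Lf0; exact: cmeasurable_crestrict.
have Lpra : Lp p sI ra by apply: Lp_of (powR_ge0 _ _) Lra; exact: cmeasurable_crestrict.
have Lprb : Lp p sL rb by apply: Lp_of (powR_ge0 _ _) Lrb; exact: cmeasurable_crestrict.
have Lprc : Lp p2 (fun=> 1%R) rc by apply: Lp_of (ltW tcM) Lrc; exact: cmeasurable_crestrict.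
exists f0; split; [exact: Lpf0|exact: le_trans Lf0 (finK _ Bm0)|].
have Vf := VLp a ws Lf; have Vf0 := VLp adm1 ww1 Lpf0.
have Vra := VLp a wsI Lpra; have Vrb := VLp a wsL Lprb; have Vrc := VLp a2 ws2 Lprc.
have [V1 T1] := T_sub Vf Vf0.
have [V2 T2] := T_sub V1 Vra.
have [V3 T3] := T_sub V2 Vrb.
have rcE : rc = (fun x => f x - f0 x - ra x - rb x).
  apply/funext => x; rewrite /rc /f0 /ra /rb /crestrict.
  have -> : (x \in A) = (x \in Q) && (x \notin E m) && (x \in G).
    by rewrite /A in_setI in_setD.
  have -> : (x \in (Q `\` E m) `\` G) = (x \in Q) && (x \notin E m) && (x \notin G).
    by rewrite !in_setD.
  rewrite in_setC; have QE : x \in E m -> x \in Q by rewrite !inE => -[].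
  have [/QE ->|_] := boolP (x \in E m); last case: (x \in Q);
    case: (x \in G) => /=; by rewrite ?subr0 ?subrr ?subr0.
have TE x : T f x - T f0 x = T ra x + T rb x + T rc x.
  have := congr1 (fun g => g x) T3; rewrite -rcE T2 T1 /= => ->.
  ring.
have mTra := mT a wsI Lpra; have mTrb := mT a wsL Lprb; have mTrc := mT a2 ws2 Lprc.
have mabs g : cmeasurable g -> measurable_fun (centered n%:R) (fun x => (cabs (g x))%:E).
  by move=> mg; apply: measurable_fun_EFin; exact: cmeasurable_cabs.
have mTf := mT a ws Lf; have mTf0 := mT adm1 ww1 Lpf0.
apply: (@le_trans _ _ (\int[mu]_(x in centered n%:R)
    ((cabs (T ra x))%:E + (cabs (T rb x))%:E + (cabs (T rc x))%:E))%E).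
  apply: ge0_le_integral; [exact: measurable_centered|..].
  - by move=> x _; rewrite lee_fin cabs_ge0.
  - by apply: mabs; exact: cmeasurableB.
  - by apply: emeasurable_funD; [apply: emeasurable_funD|]; exact: mabs.
  move=> x _; rewrite -!EFinD lee_fin TE.
  by apply: le_trans (cabsD _ _) _; rewrite lerD2r cabsD.
rewrite ge0_integralD; last 5 first.
- exact: measurable_centered.
- by move=> x _; rewrite -EFinD lee_fin addr_ge0 ?cabs_ge0.
- by apply: emeasurable_funD; exact: mabs.
- by move=> x _; rewrite lee_fin cabs_ge0.
- exact: mabs.
rewrite ge0_integralD; last 5 first.
- exact: measurable_centered.
- by move=> x _; rewrite lee_fin cabs_ge0.
- exact: mabs.
- by move=> x _; rewrite lee_fin cabs_ge0.
- exact: mabs.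
have -> : e = e / 3 + e / 3 + e / 3 by lra.
rewrite !EFinD; apply: leeD; first apply: leeD.
- apply: hta => //; apply: le_trans Lra _; apply: le_trans (finK _ (powR_ge0 _ _)) _.
  by rewrite lee_fin.
- apply: htb => //; apply: le_trans Lrb _; apply: le_trans (finK _ (powR_ge0 _ _)) _.
  by rewrite lee_fin.
- apply: htc => //; apply: le_trans Lrc _; apply: le_trans (finK _ (ltW tcM)) _.
  by rewrite lee_fin mulrAC ler_pdivrMr// ler_wpM2l ?(ltW tc0)// lerDl.
Qed.

Let Lpint_wnorm p s f : 0 < p -> Lpint p s f = poweR (wnorm mu p (wpow s p) f) p.
Proof. by move=> p0; rewrite /wnorm -poweRrM mulVf ?gt_eqF// poweRe1// wint_ge0. Qed.

(** The decomposition replaces the [f k] by functions bounded in L^p1(w1^p1), to which compactness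
    applies, at a small cost in L^1 of a cube. Equi-integrability of the images of the differences
    then lifts closeness from L^1 to L^q(t^q). *)
Let close_subsequence p q s t (f : nat -> Rd -> R[i]) (M : R) : adm p q ->
  dual_weight mu q (conj_exp p) s -> dual_weight mu q (conj_exp p) t ->
  0 <= M -> (forall k, Lp p s (f k)) -> (forall k, Lpint p s (f k) <= M%:E)%E ->
  forall e, 0 < e -> exists g : nat -> nat, (forall k, (g k < g k.+1)%N) /\
    forall i j, (Lpint q t (fun x => (T (f (g i)) x - T (f (g j)) x)%R) <= e%:E)%E.
Proof.
move=> a ws wt M0 fL fM e e0; have [p1' [q1' _]] := a.
have p0 : 0 < p by exact: lt_trans p1'.
have q0 : 0 < q by exact: lt_trans q1'.
have p10 : 0 < p1 by exact: lt_trans hp1.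
have q11 : 1 < q1 by exact: lt_le_trans hpq1.
have q10 : 0 < q1 by exact: lt_trans q11.
have [ms s0 _] := ws.
(* A bound for the differences of two terms of the sequence, by [wintB]. *)
pose M' := 2 `^ p * (M + M); have M'0 : 0 <= M' by rewrite mulr_ge0 ?powR_ge0 ?addr_ge0.
pose F : set (Rd -> R[i]) := [set g | exists2 u, Lp p s u /\ (Lpint p s u <= M'%:E)%E & g = T u].
have [n [r r0 hr]] : exists n : nat, exists2 r, 0 < r & forall g, F g ->
    (L1 n g <= r%:E)%E -> (Lpint q t g <= e%:E)%E.
  apply: (Lp_small_of_L1_small hmu hd q0 (conj_exp_gt0 p1') wt) => //.
    by move=> _ [u [Lu _] ->]; exact: mT a ws Lu.
  move=> t' wt'; have [C _ hC] := bounded_Lpint a ws wt'.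
  by exists (C * M' `^ (p^-1 * q)) => _ [u [Lu uM] ->]; have [_] := hC u Lu; exact.
have r40 : 0 < r / 4 by rewrite divr_gt0.
have [N hN] := decomposition n a ws M0 r40.
have [f0 hf0] := choice (fun k => hN (f k) (fL k) (fM k)).
have L0 k : Lp p1 w1 (f0 k) by case: (hf0 k).
have [_ /(_ f0 L0)[]] := hcomp.
  exists (`|N| `^ p1^-1) => k; rewrite /wnorm -poweR_EFin.
  apply: gt0_ler_poweR; rewrite ?invr_ge0 ?(ltW p10)// ?in_itv/= ?leey ?andbT.
  - exact: wint_ge0.
  - by rewrite lee_fin.
  - by have [_ h _] := hf0 k; apply: le_trans h _; rewrite lee_fin ler_norm.
move=> phi [g [phi_incr [[mg _] cvg]]].
have [t1 t10 ht1] := Lp_small_L1_small hmu n q11 (adm_conj adm1) ww1 r40.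
have [k0 hk0] : exists k0, forall k, (k0 <= k)%N ->
    (Lpint q1 w1 (fun x => (T (f0 (phi k)) x - g x)%R) <= t1%:E)%E.
  have tq : 0 < t1 `^ q1^-1 by exact: powR_gt0.
  have [[A _ hA] /cvgrPdist_lt /(_ _ tq) [B _ hB]] := (fine_cvgP _ _).1 cvg.
  exists (maxn A B) => k; rewrite geq_max => /andP[Ak Bk].
  have := hB k Bk; rewrite /= sub0r normrN => /ltW/(le_trans (ler_norm _)).
  rewrite -lee_fin fineK; last exact: hA.
  rewrite Lpint_wnorm// => le_t.
  have -> : t1 = (t1 `^ q1^-1) `^ q1 by rewrite -powRrM mulVf ?gt_eqF// powRr1// ltW.
  rewrite -poweR_EFin; apply: gt0_ler_poweR => //; rewrite ?(ltW q10)//.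
  - by rewrite in_itv/= poweR_ge0 leey.
  - by rewrite in_itv/= lee_fin powR_ge0 leey.
(* Dropping the first [k0] terms makes closeness hold for all pairs of indices. *)
pose psi k := phi (k + k0)%N.
exists psi; split; first by move=> k; rewrite /psi addSn; exact: phi_incr.
move=> i j; apply: hr.
  have Vf k := VLp a ws (fL k).
  have [_ Tij] := T_sub (Vf (psi i)) (Vf (psi j)).
  have mf k : cmeasurable (f k) by case: (fL k).
  have le_M' : (Lpint p s (fun x => (f (psi i) x - f (psi j) x)%R) <= M'%:E)%E.
    apply: le_trans (wintB _ p0 (mf _) (mf _) ms) _.
    rewrite /M' EFinM EFinD; apply: lee_wpmul2l; first by rewrite lee_fin powR_ge0.
    exact: leeD.
  exists (fun x => f (psi i) x - f (psi j) x) => //; split => //.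
  split; first exact: cmeasurableB.
  by apply: le_lt_trans le_M' _; exact: ltry.
have mTf k := mT a ws (fL k); have mTf0 k := mT adm1 ww1 (L0 k).
have mabs h : cmeasurable h -> measurable_fun (centered n%:R) (fun x => (cabs (h x))%:E).
  by move=> mh; apply: measurable_fun_EFin; exact: cmeasurable_cabs.
(* The difference of two images splits into two decomposition errors [u1] and two distances [u2] to
   the limit [g], each at most [r / 4] in L^1 of the cube. *)
pose u1 k x := T (f k) x - T (f0 k) x; pose u2 k x := T (f0 k) x - g x.
have mu1 k : cmeasurable (u1 k) by exact: cmeasurableB.
have mu2 k : cmeasurable (u2 k) by exact: cmeasurableB.
have b1 k : (L1 n (u1 k) <= (r / 4)%:E)%E by case: (hf0 k).
have b2 k : (L1 n (u2 (psi k)) <= (r / 4)%:E)%E.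
  by apply: ht1; [exact: mu2|apply: hk0; exact: leq_addl].
apply: (@le_trans _ _ (\int[mu]_(x in centered n%:R)
    (((cabs (u1 (psi i) x))%:E + (cabs (u2 (psi i) x))%:E) +
     ((cabs (u2 (psi j) x))%:E + (cabs (u1 (psi j) x))%:E)))%E).
  apply: ge0_le_integral; [exact: measurable_centered|..].
  - by move=> x _; rewrite lee_fin cabs_ge0.
  - by apply: mabs; exact: cmeasurableB.
  - by apply: emeasurable_funD; apply: emeasurable_funD; exact: mabs.
  move=> x _; rewrite -!EFinD lee_fin.
  have -> : T (f (psi i)) x - T (f (psi j)) x =
      (u1 (psi i) x + u2 (psi i) x) - (u2 (psi j) x + u1 (psi j) x).
    by rewrite /u1 /u2; ring.
  by apply: le_trans (cabsB _ _) _; apply: lerD; exact: cabsD.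
rewrite ge0_integralD; last 5 first.
- exact: measurable_centered.
- by move=> x _; rewrite -EFinD lee_fin addr_ge0 ?cabs_ge0.
- by apply: emeasurable_funD; exact: mabs.
- by move=> x _; rewrite -EFinD lee_fin addr_ge0 ?cabs_ge0.
- by apply: emeasurable_funD; exact: mabs.
rewrite !ge0_integralD; try exact: measurable_centered; try exact: mabs;
  try by move=> x _; rewrite lee_fin cabs_ge0.
have -> : r = (r / 4 + r / 4) + (r / 4 + r / 4) by lra.
by rewrite !EFinD; apply: leeD; apply: leeD.
Qed.

(** Diagonal extraction along [eps k] gives images that are Cauchy at the rate [Lp_fast_cauchy_cvg]
    requires, and completeness provides the limit. *)
Lemma compact_op_dual_weight p q s t : adm p q ->
  dual_weight mu q (conj_exp p) s -> dual_weight mu q (conj_exp p) t ->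
  compact_op mu T p s q t.
Proof.
move=> a ws wt; have [p1' [q1' _]] := a.
have p0 : 0 < p by exact: lt_trans p1'.
have q0 : 0 < q by exact: lt_trans q1'.
have [mt t0 _] := wt.
split=> [f Lf|f fL [M fM]].
  by have [C _ hC] := bounded_Lpint a ws wt; have [] := hC f Lf.
pose N := `|M| `^ p; have N0 : 0 <= N by exact: powR_ge0.
have fN k : (Lpint p s (f k) <= N%:E)%E.
  rewrite Lpint_wnorm// /N -poweR_EFin; apply: gt0_ler_poweR; rewrite ?(ltW p0)//.
  - by rewrite in_itv/= poweR_ge0 leey.
  - by rewrite in_itv/= lee_fin normr_ge0 leey.
  - by apply: le_trans (fM k) _; rewrite lee_fin ler_norm.
pose eps k : R := ((2 ^+ k) `^ q)^-1 / 2 ^+ k.+1.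
have eps0 k : 0 < eps k by rewrite divr_gt0 ?invr_gt0 ?powR_gt0 ?exprn_gt0.
have [phi [phi_incr hphi]] := @diagonal_subsequence
  (fun k i j => (Lpint q t (fun x => (T (f i) x - T (f j) x)%R) <= (eps k)%:E)%E)
  (fun k u _ => close_subsequence a ws wt N0 (fun i => fL (u i)) (fun i => fN (u i)) (eps0 k)).
have TL k : Lp q t (T (f (phi k))).
  by have [C _ hC] := bounded_Lpint a ws wt; have [] := hC _ (fL (phi k)).
have [g [Lg cg]] := Lp_fast_cauchy_cvg q0 mt t0 TL
  (fun k => hphi k k.+1 k (leqnSn k) (leqnn k)).
by exists phi, g.
Qed.

End extrapolation.

(** * Changing weights on null sets *)

Section positive_weights.
Context {R : realType} {d : nat}.
Local Notation Rd := (d.-tuple R).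
Variable mu : {measure set Rd -> \bar R}.
Implicit Types (s t : Rd -> R).

(* An [A_{p,q}] weight is positive only almost everywhere, and [powR] is [1] at
   negative numbers. *)
Definition positive_version s : Rd -> R := fun x => if 0 < s x then s x else 1.

Lemma positive_version_gt0 s x : 0 < positive_version s x.
Proof. by rewrite /positive_version; case: ifP. Qed.

Lemma measurable_positive_version s : measurable_fun setT s ->
  measurable_fun setT (positive_version s).
Proof.
by move=> ms; apply: measurable_fun_ifT => //; exact: measurable_fun_ltr.
Qed.

Lemma ae_positive_version s : {ae mu, forall x, 0 < s x} ->
  {ae mu, forall x, s x = positive_version s x}.
Proof.
move=> [N [mN N0 hN]]; exists N; split => // x /= sx; apply: hN => /= sx0.
by apply: sx; rewrite /positive_version sx0.
Qed.

Lemma ae_eq_integral_powR (E : set Rd) s t (r : R) : measurable E ->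
  measurable_fun setT s -> measurable_fun setT t -> {ae mu, forall x, s x = t x} ->
  (\int[mu]_(x in E) (s x `^ r)%:E = \int[mu]_(x in E) (t x `^ r)%:E)%E.
Proof.
move=> mE ms mt [N [mN N0 hN]]; apply: ae_eq_integral => //.
- by apply: measurable_fun_EFin; exact: measurable_fun_powR.
- by apply: measurable_fun_EFin; exact: measurable_fun_powR.
exists N; split => // x /= h; apply: hN => /= st; apply: h => _.
by rewrite st.
Qed.

Lemma Apq_ae_eq (p q : R) s t : measurable_fun setT t -> (forall x, 0 < t x) ->
  {ae mu, forall x, s x = t x} -> Apq mu p q s -> Apq mu p q t.
Proof.
move=> mt t0 st [ms _ [C hC]]; split => //; first exact: aeW.
exists C => Q Qc; apply: le_trans (hC Q Qc).
have mQ : measurable Q by have [a [l [_ ->]]] := Qc; exact: measurable_cube.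
by rewrite /avg !(ae_eq_integral_powR _ mQ ms mt st).
Qed.

Lemma wint_ae_eq (p : R) s t (f : Rd -> R[i]) : cmeasurable f ->
  measurable_fun setT s -> measurable_fun setT t -> {ae mu, forall x, s x = t x} ->
  wint mu p (wpow s p) f = wint mu p (wpow t p) f.
Proof.
move=> mf ms mt [N [mN N0 hN]]; apply: ae_eq_integral => //.
- exact: measurable_Lp_integrand.
- exact: measurable_Lp_integrand.
exists N; split => // x /= h; apply: hN => /= st; apply: h => _.
by rewrite /wpow st.
Qed.

Lemma inLp_ae_eq (p : R) s t (f : Rd -> R[i]) :
  measurable_fun setT s -> measurable_fun setT t -> {ae mu, forall x, s x = t x} ->
  inLp mu p (wpow s p) f -> inLp mu p (wpow t p) f.
Proof. by move=> ms mt st [mf]; rewrite (wint_ae_eq p mf ms mt st). Qed.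

Lemma compact_op_ae_eq (T : (Rd -> R[i]) -> (Rd -> R[i])) (p q : R) s s' t t' :
  measurable_fun setT s -> measurable_fun setT s' -> {ae mu, forall x, s x = s' x} ->
  measurable_fun setT t -> measurable_fun setT t' -> {ae mu, forall x, t x = t' x} ->
  compact_op mu T p s q t -> compact_op mu T p s' q t'.
Proof.
have sym u v : {ae mu, forall x : Rd, u x = v x :> R} -> {ae mu, forall x, v x = u x}.
  by apply: filterS => x ->.
move=> ms ms' /sym ss mt mt' tt [TL Tc]; split.
  by move=> f /(inLp_ae_eq ms' ms ss)/TL; exact: inLp_ae_eq.
move=> f fL [M fM]; have fL' k := inLp_ae_eq ms' ms ss (fL k).
have [|phi [g [phi_incr [gL cvg]]]] := Tc f fL'.
  exists M => k; apply: le_trans (fM k).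
  by rewrite /wnorm -(wint_ae_eq p _ ms' ms ss)//; case: (fL k).
exists phi, g; split; first exact: phi_incr.
split; first exact: inLp_ae_eq gL.
suff -> : (fun k => wnorm mu q (wpow t' q) (fun x => T (f (phi k)) x - g x)) =
    (fun k => wnorm mu q (wpow t q) (fun x => T (f (phi k)) x - g x)) by [].
apply/funext => k; rewrite /wnorm -(wint_ae_eq q _ mt mt' tt)//.
by apply: cmeasurableB; [case: (TL _ (fL' (phi k)))|case: gL].
Qed.

Lemma dual_weight_positive_version (p q : R) s : is_lebesgue_measure mu ->
  1 < p -> 1 < q -> Apq mu p q s ->
  dual_weight mu q (conj_exp p) (positive_version s).
Proof.
move=> hmu p1 q1 ws; have [ms s0 _] := ws.
exact: (dual_weight_Apq hmu p1 q1 (positive_version_gt0 s)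
  (Apq_ae_eq (measurable_positive_version ms) (positive_version_gt0 s)
    (ae_positive_version s0) ws)).
Qed.

End positive_weights.

Theorem theorem1p2 (R : realType) (d : nat) (hd : (0 < d)%N)
  (mu : {measure set (d.-tuple R) -> \bar R}) (hmu : is_lebesgue_measure mu)
  (p1 q1 : R) (w1 : d.-tuple R -> R)
  (hp1 : 1 < p1) (hpq1 : p1 <= q1) (hw1 : Apq mu p1 q1 w1)
  (V : set (d.-tuple R -> R[i])) (T : (d.-tuple R -> R[i]) -> (d.-tuple R -> R[i]))
  (hT : simultaneously_linear mu p1 q1 V T)
  (hcomp : compact_op mu T p1 w1 q1 w1)
  (hbdd : forall (p q : R) (sigma lambda : d.-tuple R -> R),
      admissible p1 q1 p q -> Apq mu p q sigma -> Apq mu p q lambda ->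
      bounded_op mu T p sigma q lambda) :
  forall (p q : R) (sigma lambda : d.-tuple R -> R),
    admissible p1 q1 p q -> Apq mu p q sigma -> Apq mu p q lambda ->
    compact_op mu T p sigma q lambda.
Proof.
move=> p q s t a ws wt; have [p1' [q1' _]] := a.
have [[ms s0 _] [mt t0 _] [mw1 w10 _]] := And3 ws wt hw1.
have q11 : 1 < q1 by exact: lt_le_trans hpq1.
(* Altering a weight on a null set changes neither spaces nor norms, so compactness passes to the
   everywhere positive versions, and back at the end. *)
have hcomp' : compact_op mu T p1 (positive_version w1) q1 (positive_version w1).
  exact: (compact_op_ae_eq mw1 (measurable_positive_version mw1)
    (ae_positive_version w10) mw1 (measurable_positive_version mw1)
    (ae_positive_version w10) hcomp).
have sym (u v : d.-tuple R -> R) :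
    {ae mu, forall x, u x = v x} -> {ae mu, forall x, v x = u x}.
  by apply: filterS => x ->.
apply: (compact_op_ae_eq (measurable_positive_version ms) ms
  (sym _ _ (ae_positive_version s0)) (measurable_positive_version mt) mt
  (sym _ _ (ae_positive_version t0))).
exact: (compact_op_dual_weight hmu hd hp1 hpq1
  (dual_weight_positive_version hmu hp1 q11 hw1) hT hcomp' hbdd a
  (dual_weight_positive_version hmu p1' q1' ws)
  (dual_weight_positive_version hmu p1' q1' wt)).
Qed.
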